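(* Let $\chi^*=(z^*,\lambda^* )$, $z^*=(L^*,\xi^* )$, be a global solution of problem (P) together with its Lagrange multiplier $\lambda^*=0$, and assume it satisfies the first order necessary conditions and the second order sufficient conditions with constant $\underline{\mathcal B}>0$. Moreover, let there be $c>0$ and $u\in\mathbb R^2$ with $\|u\|=1$ such that $u^T\xi^*_\tau(\tau)\ge c$ for almost all $\tau\in\,]0,1[$. Let $\omega:=\omega_1\omega_2$, with $\omega_1=\omega_1(R)$ and $\omega_2=\omega_2(R)=(8+\hat{\mathcal B})R$ as defined in the context. Then there is $R_C>0$ such that the ordinary Newton iterates $\chi^k$ converge to $\chi^*$ at the estimated rate $$\|\chi^{k+1}-\chi^*\|_{Y^2}\le \frac{\omega}{2}\,\|\chi^k-\chi^*\|_{Y^2},$$ provided they are initialized with $\chi^0\in\mathcal N_{R_C}(\chi^* )$ and the iterates $\chi^k$ remain in $\mathcal N_{R_C}(\chi^* )$. Moreover, $\chi^*$ is the unique solution of $F(\chi)=0$ in $\mathcal N_{R_C}(\chi^* )$.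
   Context: Setting (free flight problem). Fix an airspeed $\bar v>0$, points $x_O,x_D\in\mathbb R^2$ (origin, destination), $\tilde L:=\|x_D-x_O\|$, and a wind field $w\in C^3(\mathbb R^2,\mathbb R^2)$ with $\|w(x)\|<\bar v$ for all $x$. $\|\cdot\|$ is the Euclidean norm; for a (vector-valued) function $g$, $\|g\|_{L^\infty(D)}:=\inf\{C\ge0:\|g(x)\|\le C \text{ for a.a. } x\in D\}$ (default $D=]0,1[$), and $\|g\|_{L^2}$ is the $L^2(]0,1[)$ norm with the Euclidean norm pointwise. Let $\Omega\subset\mathbb R^2$ be an ellipse with foci $x_O,x_D$ containing every globally optimal trajectory. Constants: $\|w\|_{L^\infty(\Omega)}\le\bar c_0\le\bar v/\sqrt5$, $\|w_x\|_{L^\infty(\Omega)}\le\bar c_1$, $\|w_{xx}\|_{L^\infty(\Omega)}\le\bar c_2$, $\|w_{xxx}\|_{L^\infty(\Omega)}\le\bar c_3$, and $\underline v^2:=\bar v^2-\bar c_0^2$. For $x,p\in\mathbb R^2$ let $f(x,p)=\frac{-p^Tw(x)+\sqrt{(p^Tw(x))^2+(\bar v^2-w(x)^Tw(x))\,p^Tp}}{\bar v^2-w(x)^Tw(x)}$. Let $X=\{\xi\in W^{1,\infty}(]0,1[,\mathbb R^2):\xi(0)=x_O,\xi(1)=x_D\}$, $\delta X=W^{1,\infty}_0(]0,1[,\mathbb R^2)$, $\xi_\tau$ the derivative, and $T(\xi)=\int_0^1 f(\xi(\tau),\xi_\tau(\tau))\,d\tau$, with Fréchet derivatives $T',T'',\dots$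 in directions from $\delta X$. Problem (P): minimize $T(\xi)$ over $\xi\in X$, $L\in\mathbb R$, subject to $\|\xi_\tau(\tau)\|^2=L^2$ for a.a. $\tau$. Write $z=(L,\xi)\in Z=\mathbb R\times X$, $\delta z=(\delta L,\delta\xi)\in\delta Z=\mathbb R\times\delta X$, $h(z)=\xi_\tau^T\xi_\tau-L^2\in\Lambda:=L^\infty(]0,1[)$. Norms: $\|z\|_{Z^\infty}=|L|+\|\xi\|_{L^\infty}+\|\xi_\tau\|_{L^\infty}$, $\|z\|_{Z^2}=|L|+\|\xi\|_{L^2}+\|\xi_\tau\|_{L^2}$; for $\chi=(z,\lambda)$ (multiplier $\lambda$ a function on $]0,1[$), $\|\chi\|_{Y^\infty}=\|z\|_{Z^\infty}+\|\lambda\|_{L^\infty}$, $\|\chi\|_{Y^2}=\|z\|_{Z^2}+\|\lambda\|_{L^2}$, and $\mathcal N_R(\chi^* )=\{\chi:\|\chi-\chi^*\|_{Y^\infty}\le R\}$. Lagrangian $\mathcal L(z,\lambda)=T(\xi)+\int_0^1\lambda\,h(z)\,d\tau$; $F(\chi):=\mathcal L'(z,\lambda)$ (total derivative, i.e. $F(\chi)[\delta z,\delta\lambda]=T'(\xi)[\delta\xi]+2\int_0^1\lambda(\xi_\tau^T\delta\xi_\tau-L\delta L)d\tau+\int_0^1\delta\lambda\,h(z)d\tau$), and $F'(\chi)$ its derivative (KKT operator). Newton iteration: given $\chi^0$, solve $F'(\chi^k)[\Delta\chi^k]=-F(\chi^k)$ and set $\chi^{k+1}=\chi^k+\Delta\chi^k$.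 First order conditions: $F(\chi^* )=0$. Second order sufficient conditions with $\underline{\mathcal B}>0$: there is $\kappa>0$ with $\inf_{0\ne\delta\lambda\in L^2}\sup_{\delta z\in\delta Z}\frac{\int_0^1\delta\lambda(2\xi^{*T}_\tau\delta\xi_\tau-2L^*\delta L)d\tau}{\|\delta\lambda\|_{L^2}\|\delta z\|_{Z^2}}\ge\kappa$, and $T''(\xi^* )[\delta\xi]^2\ge\underline{\mathcal B}\|\delta z\|_{Z^2}^2$ for all $\delta z\in\delta Z$ with $\delta\xi_\tau^T\xi^*_\tau=\delta L\,L^*$ a.e. Constants: $\kappa(R)=(c-R)\big[\tfrac38+2\big(\tfrac{\bar v+\bar c_0}{\bar v-\bar c_0}+\tfrac{R}{\tilde L}\big)^2\big]^{-1/2}$; $\bar\beta_0=14\bar c_1^2/\underline v^3+4\bar c_2/\underline v^2$, $\bar\beta_1=7\bar c_1/\underline v^2$, $\bar\beta_2=4/\underline v$; $\bar{\mathcal B}(R)=\bar\beta_1+\max\{(\tfrac{\bar v+\bar c_0}{\bar v-\bar c_0}\tilde L+R)\bar\beta_0,\ \bar\beta_2/(\tilde L+R)\}$; $\omega_1=\sqrt2\max\{\tfrac{4}{\underline{\mathcal B}},\ \tfrac1\kappa(1+\tfrac{4(\bar{\mathcal B}+R)}{\underline{\mathcal B}}),\ \tfrac{\bar{\mathcal B}+R}{\kappa^2}\}$; $\omega_2=(8+\hat{\mathcal B})R$, where $\hat{\mathcal B}<\infty$ is a constant such that $\|(F'(\chi_2)-F'(\chi_1))[\chi_2-\chi_1]\|_{Y^2}\le\omega_2\|\chi_2-\chi_1\|_{Y^2}$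 for $\chi_1,\chi_2\in\mathcal N_R(\chi^* )$ (norm of the functional $\delta\chi\mapsto (F'(\chi_2)-F'(\chi_1))[\chi_2-\chi_1,\delta\chi]$ over $\|\delta\chi\|_{Y^2}\le1$). *)

(* Defs.v *)
From HB Require Import structures.
From mathcomp Require Import all_boot all_order all_algebra.
From mathcomp Require Import all_classical all_reals all_analysis.
Set Implicit Arguments. Unset Strict Implicit. Unset Printing Implicit Defensive.
Import Order.TTheory GRing.Theory Num.Theory.
Import numFieldNormedType.Exports.
Local Open Scope classical_set_scope.
Local Open Scope ring_scope.

Section FreeFlight.
Variable R : realType.

Definition vadd (x y : R * R) : R * R := (x.1 + y.1, x.2 + y.2).
Definition vsub (x y : R * R) : R * R := (x.1 - y.1, x.2 - y.2).
Definition vscale (s : R) (x : R * R) : R * R := (s * x.1, s * x.2).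
Definition vdot (x y : R * R) : R := x.1 * y.1 + x.2 * y.2.
Definition vnorm (x : R * R) : R := Num.sqrt (vdot x x).
Definition vzero : R * R := (0, 0).

Definition dpath (xi : R -> R * R) (t : R) : R * R :=
  (derive1 (fun s => (xi s).1) t, derive1 (fun s => (xi s).2) t).

Definition ddir (g : R * R -> R * R) (x h : R * R) : R * R :=
  dpath (fun s => g (vadd x (vscale s h))) 0.

Definition ddir_ex (g : R * R -> R * R) (x h : R * R) : Prop :=
  derivable (fun s : R => (g (vadd x (vscale s h))).1) 0 1 /\
  derivable (fun s : R => (g (vadd x (vscale s h))).2) 0 1.

(* C^k(R^2,R^2): all iterated directional derivatives up to order k exist
   and are continuous (equivalently: all partials up to order k continuous) *)
Fixpoint Ck (k : nat) (g : R * R -> R * R) : Prop :=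
  match k with
  | O => continuous g
  | S k' => continuous g /\ (forall x h, ddir_ex g x h) /\
            (forall h, Ck k' (fun x => ddir g x h))
  end.

Definition ff (vbar : R) (w : R * R -> R * R) (x p : R * R) : R :=
  let a := vbar ^+ 2 - vdot (w x) (w x) in
  (- vdot p (w x) + Num.sqrt ((vdot p (w x)) ^+ 2 + a * vdot p p)) / a.

Definition I01 : set R := `]0, 1[%classic.
Definition I01c : set R := `[0, 1]%classic.
Definition Int01 (g : R -> R) : R := Rintegral (@lebesgue_measure R) I01 g.
Definition ae01 (P : R -> Prop) : Prop :=
  \forall t \ae (@lebesgue_measure R), I01 t -> P t.

Definition LinfN (n : R -> R) : R :=
  inf [set C : R | 0 <= C /\ ae01 (fun t => n t <= C)].
Definition L2N (n : R -> R) : R := Num.sqrt (Int01 (fun t => n t ^+ 2)).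

Definition Linf (lam : R -> R) : Prop :=
  measurable_fun I01 lam /\ exists C : R, ae01 (fun t => `|lam t| <= C).
Definition L2 (lam : R -> R) : Prop :=
  measurable_fun I01 lam /\
  (@lebesgue_measure R).-integrable I01 (fun t => ((lam t) ^+ 2)%:E).

(* W^{1,infty}(]0,1[,R^2), identified with Lipschitz functions on [0,1] *)
Definition Lip01 (xi : R -> R * R) : Prop :=
  exists K : R, forall s t, I01c s -> I01c t ->
    vnorm (vsub (xi s) (xi t)) <= K * `|s - t|.
Definition inX (xO xD : R * R) (xi : R -> R * R) : Prop :=
  Lip01 xi /\ xi 0 = xO /\ xi 1 = xD.
Definition indX (dxi : R -> R * R) : Prop :=
  Lip01 dxi /\ dxi 0 = vzero /\ dxi 1 = vzero.

Definition Tt (vbar : R) (w : R * R -> R * R) (xi : R -> R * R) : R :=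
  Int01 (fun t => ff vbar w (xi t) (dpath xi t)).
Definition pathpert (xi dxi : R -> R * R) (s : R) : R -> R * R :=
  fun t => vadd (xi t) (vscale s (dxi t)).
Definition Td1 vbar w (xi dxi : R -> R * R) : R :=
  derive1 (fun s => Tt vbar w (pathpert xi dxi s)) 0.
Definition Td2 vbar w (xi dxi : R -> R * R) : R :=
  derive1 (derive1 (fun s => Tt vbar w (pathpert xi dxi s))) 0.

Record chi := mkChi { cL : R; cxi : R -> R * R; clam : R -> R }.
Definition cadd (a b : chi) : chi :=
  mkChi (cL a + cL b) (fun t => vadd (cxi a t) (cxi b t)) (fun t => clam a t + clam b t).
Definition csub (a b : chi) : chi :=
  mkChi (cL a - cL b) (fun t => vsub (cxi a t) (cxi b t)) (fun t => clam a t - clam b t).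
Definition cscale (s : R) (a : chi) : chi :=
  mkChi (s * cL a) (fun t => vscale s (cxi a t)) (fun t => s * clam a t).

Definition inY xO xD (a : chi) : Prop := inX xO xD (cxi a) /\ Linf (clam a).
Definition indY (a : chi) : Prop := indX (cxi a) /\ Linf (clam a).

(* F(chi)[dchi] = L'(z,lambda)[dz,dlambda] *)
Definition Fop vbar w (a d : chi) : R :=
  Td1 vbar w (cxi a) (cxi d)
  + 2 * Int01 (fun t => clam a t *
        (vdot (dpath (cxi a) t) (dpath (cxi d) t) - cL a * cL d))
  + Int01 (fun t => clam d t *
        (vdot (dpath (cxi a) t) (dpath (cxi a) t) - cL a ^+ 2)).

Definition Fd vbar w (a D d : chi) : R :=
  derive1 (fun s => Fop vbar w (cadd a (cscale s D)) d) 0.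

Definition nYinf (a : chi) : R :=
  `|cL a| + LinfN (fun t => vnorm (cxi a t)) + LinfN (fun t => vnorm (dpath (cxi a) t))
  + LinfN (fun t => `|clam a t|).
Definition nY2 (a : chi) : R :=
  `|cL a| + L2N (fun t => vnorm (cxi a t)) + L2N (fun t => vnorm (dpath (cxi a) t))
  + L2N (fun t => `|clam a t|).
Definition nZ2 (dL : R) (dxi : R -> R * R) : R :=
  `|dL| + L2N (fun t => vnorm (dxi t)) + L2N (fun t => vnorm (dpath dxi t)).
Definition inN (Rad : R) (astar a : chi) : Prop := nYinf (csub a astar) <= Rad.

Definition feasibleP xO xD (L : R) (xi : R -> R * R) : Prop :=
  inX xO xD xi /\ ae01 (fun t => vdot (dpath xi t) (dpath xi t) = L ^+ 2).
Definition globsolP vbar w xO xD (L : R) (xi : R -> R * R) : Prop :=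
  feasibleP xO xD L xi /\
  forall L' xi', feasibleP xO xD L' xi' -> Tt vbar w xi <= Tt vbar w xi'.

Definition kappaR (vbar c0 Ltil c Rad : R) : R :=
  (c - Rad) / Num.sqrt (3 / 8 + 2 * ((vbar + c0) / (vbar - c0) + Rad / Ltil) ^+ 2).
Definition vunder (vbar c0 : R) : R := Num.sqrt (vbar ^+ 2 - c0 ^+ 2).
Definition beta0 vbar c0 c1 c2 : R :=
  14 * c1 ^+ 2 / vunder vbar c0 ^+ 3 + 4 * c2 / vunder vbar c0 ^+ 2.
Definition beta1 vbar c0 c1 : R := 7 * c1 / vunder vbar c0 ^+ 2.
Definition beta2 vbar c0 : R := 4 / vunder vbar c0.
Definition Bbar (vbar c0 c1 c2 Ltil Rad : R) : R :=
  beta1 vbar c0 c1 +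
  Num.max (((vbar + c0) / (vbar - c0) * Ltil + Rad) * beta0 vbar c0 c1 c2)
          (beta2 vbar c0 / (Ltil + Rad)).
Definition omega1 (Bl kap Bb Rad : R) : R :=
  Num.sqrt 2 * Num.max (4 / Bl)
    (Num.max (kap^-1 * (1 + 4 * (Bb + Rad) / Bl)) ((Bb + Rad) / kap ^+ 2)).
Definition omega2 (Bhat Rad : R) : R := (8 + Bhat) * Rad.

Definition Bhat_ok vbar w xO xD (astar : chi) (Rad Bhat : R) : Prop :=
  forall a1 a2, inY xO xD a1 -> inY xO xD a2 -> inN Rad astar a1 -> inN Rad astar a2 ->
  forall d, indY d -> nY2 d <= 1 ->
    `|Fd vbar w a2 (csub a2 a1) d - Fd vbar w a1 (csub a2 a1) d|
      <= omega2 Bhat Rad * nY2 (csub a2 a1).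

Definition newton_seq vbar w xO xD (chis : nat -> chi) : Prop :=
  (forall k, inY xO xD (chis k)) /\
  forall k d, indY d ->
    Fd vbar w (chis k) (csub (chis k.+1) (chis k)) d = - Fop vbar w (chis k) d.

End FreeFlight.

(* Main.v *)
(* At the optimum the multiplier vanishes, so the KKT operator is the saddle-point form built from A = T''(xi star)
   and the linearised constraint.  A is coercive on the kernel of the constraint by assumption.  It is nonnegative on all
   directions: T does not see parametrizations, and every path close to xi star can be reparametrized to constant speed,
   hence competes with xi star in (P).  It is bounded by N = beta1 + max(ratio Ltil beta0, beta2 / (2 Ltil)): differentiate
   |p - f w| = v f twice.  Moreover, moving in the direction u solves the linearised constraint with an explicit L2 bound.
   These facts together bound the inverse of the KKT operator by 2.05 M with M = max(4/Bl, (1 + 4N/Bl)/k0, N/k0^2) and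
   k0 = 2c/3, whereas omega1 >= sqrt 2 M.

   The Newton residual at b equals, up to third order, a quarter of (F'(b) - F'(b'))[b - chi star], where b' is the
   reflection of b in chi star.  The pair b, b' has distance 2 |b - chi star|, so the definition of omega2 bounds the
   residual by omega2 / 4 times |b - chi star|; the error terms are absorbed because omega2 >= 4 RC for every admissible
   Bhat.  The slack in the constants gives the factor omega / 2.  Without Bhat, the residual is at most a small multiple of
   |b - chi star|, which yields convergence, and local uniqueness since a KKT point is a constant Newton sequence. *)
Require Import Defs.
From HB Require Import structures.
From mathcomp Require Import all_boot all_order all_algebra.
From mathcomp Require Import all_classical all_reals all_analysis.
From mathcomp Require Import measurable_realfun ring lra.
Import Order.TTheory GRing.Theory Num.Theory.
Import numFieldNormedType.Exports.
Local Open Scope classical_set_scope.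
Local Open Scope ring_scope.
Set Implicit Arguments. Unset Strict Implicit. Unset Printing Implicit Defensive.
Import HBNNSimple.
(* mathcomp-analysis also defines cadd and cscale. *)
Import Defs.

(** Velocities exist only almost everywhere, and [derive1] takes default values elsewhere.
    Integrands are therefore handled through bounded Borel representatives, and derivatives of
    functionals through pointwise Taylor estimates that are uniform near the compact set of optimal
    states. The constants leave little room. The factor 2.05 is the sum of 1/4, 4/5 and 1, the
    shares of the three terms in the bound of the inverse. Estimating the residual with the pair b,
    chi star would give omega2 / 2, and 2.05 / 2 exceeds sqrt 2 / 2; the reflected pair halves this,
    and 2.05 / 4 fits. Nonnegativity of A on all directions yields Cauchy-Schwarz for A outside the
    kernel, hence sqrt N instead of N in the cross terms. The value 2c/3 appears because the norm of
    the lift has three components, each at most |mu| / (2c). Only the operator at chi star is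
    inverted: the Newton equation at b is rewritten with F'(chi star) and a small drift, so no
    invertibility of F'(b) is required. *)

(** * Bounded integrands on the unit interval *)

(* Restricting a simple minorant to the complement of the null set keeps its integral. *)
Lemma nnintegral_ae_le d (T : measurableType d) (R : realType)
  (m : {measure set T -> \bar R}) (f g : T -> \bar R) (N : set T) :
  (forall x, 0 <= f x)%E -> (forall x, 0 <= g x)%E ->
  measurable N -> m N = 0%E -> (forall x, ~ N x -> f x = g x) ->
  (\int[m]_x f x <= \int[m]_x g x)%E.
Proof.
move=> f0 g0 mN N0 fg; rewrite !ge0_integralTE//.
apply: ge_ereal_sup => _ [h hf <-].
pose k : {nnsfun T >-> R} := mul_nnsfun h (indic_nnsfun R (measurableC mN)).
have -> : sintegral m h = sintegral m k.
  rewrite -!integralT_nnsfun; apply: ae_eq_integral => //.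
  - exact/measurable_EFinP.
  - exact/measurable_EFinP.
  exists N; split => // x /= H; apply: contrapT => nNx; apply: H => _.
  by rewrite /mindic indicE mem_set//= mulr1.
apply: ereal_sup_ubound; exists k => // x /=.
rewrite /mindic indicE; case: (pselect (N x)) => Nx.
  by rewrite memNset ?mulr0// => -[].
by rewrite mem_set// mulr1 -fg.
Qed.

Section AlmostEverywhere.
Variable R : realType.
Local Notation mu := (@lebesgue_measure R).
Local Notation I := (@I01 R).

Lemma measurable_I01 : measurable I.
Proof. exact: measurable_itv. Qed.

Lemma lebesgue_I01 : mu I = 1%E.
Proof. by rewrite /I01 lebesgue_measure_itv/= lte_fin ltr01 sube0. Qed.

Lemma ae01_all (P : R -> Prop) : (forall t, I t -> P t) -> ae01 P.
Proof. by move=> H; rewrite /ae01; apply: aeW => t; exact: H. Qed.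

Lemma ae01_mp (P Q : R -> Prop) : ae01 P -> (forall t, I t -> P t -> Q t) -> ae01 Q.
Proof.
move=> aP H; apply: (@filterS _ _ (ae_filter_ringOfSetsType mu) _ _ _ aP) => t Pt It; apply: H => //; exact: Pt.
Qed.

Lemma ae01_mp2 (P Q W : R -> Prop) : ae01 P -> ae01 Q ->
  (forall t, I t -> P t -> Q t -> W t) -> ae01 W.
Proof.
move=> aP aQ H; apply: (@filterS2 _ _ (ae_filter_ringOfSetsType mu) _ _ _ _ aP aQ) => t Pt Qt It.
by apply: H => //; [exact: Pt|exact: Qt].
Qed.

Lemma ae01_and (P Q : R -> Prop) : ae01 P -> ae01 Q -> ae01 (fun t => P t /\ Q t).
Proof. by move=> aP aQ; apply: (ae01_mp2 aP aQ). Qed.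

Lemma ae01_forall_nat (P : nat -> R -> Prop) :
  (forall n, ae01 (P n)) -> ae01 (fun t => forall n, P n t).
Proof.
move=> H; have := @ae_foralln _ _ _ mu (fun n t => I t -> P n t) H.
by apply: (@filterS _ _ (ae_filter_ringOfSetsType mu)) => t Ht It n; exact: Ht.
Qed.

Lemma ae01_ex (P : R -> Prop) : ae01 P -> exists2 t, I t & P t.
Proof.
move=> aP; apply: contrapT => nP.
have : mu.-negligible I.
  apply: negligibleS aP => t It /= H; apply: nP; exists t => //; exact: H.
rewrite negligibleP; last exact: measurable_I01.
by move=> /eqP; rewrite [X in X == _]lebesgue_I01 onee_eq0.
Qed.

(** No measurability is asked, so integrands containing [derive1], known only almost everywhere, can
    be replaced freely. *)
Lemma integral_ae_congr (f g : R -> \bar R) : ae01 (fun t => f t = g t) ->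
  (\int[mu]_(x in I) f x = \int[mu]_(x in I) g x)%E.
Proof.
move=> [N [mN N0 HN]]; rewrite integralE [RHS]integralE.
suff H (f1 f2 : R -> \bar R) : (forall x, 0 <= f1 x)%E -> (forall x, 0 <= f2 x)%E ->
   (forall x, ~ N x -> I x -> f1 x = f2 x) ->
   (\int[mu]_(x in I) f1 x = \int[mu]_(x in I) f2 x)%E.
  have fg x : ~ N x -> I x -> f x = g x.
    by move=> nN Ix; apply: contrapT => nfg; apply: nN; apply: HN => /(_ Ix).
  congr (_ - _)%E; apply: H => // x nN Ix; first by rewrite !funeposE fg.
  by rewrite !funenegE fg.
move=> f10 f20 f12; rewrite integral_mkcond [RHS]integral_mkcond.
have p1 x : (0 <= (f1 \_ I) x)%E by rewrite patchE; case: ifP.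
have p2 x : (0 <= (f2 \_ I) x)%E by rewrite patchE; case: ifP.
apply/eqP; rewrite eq_le; apply/andP; split; apply: (@nnintegral_ae_le _ _ _ _ _ _ N) => // x nN;
  rewrite !patchE; case: ifP => // xI; rewrite f12//; exact: set_mem.
Qed.

Lemma Int_ae (f g : R -> R) : ae01 (fun t => f t = g t) -> Int01 f = Int01 g.
Proof.
move=> fg; rewrite /Int01 /Rintegral; congr fine; apply: integral_ae_congr.
by apply: (ae01_mp fg) => t _ ->.
Qed.

(** Agreement almost everywhere with a bounded Borel function: the class on which [Int01] is linear
    and monotone, closed under the pointwise operations below, and containing derivatives of
    Lipschitz functions. *)
Definition abounded (h : R -> R) : Prop := exists g : R -> R, exists C : R,
  [/\ measurable_fun setT g, forall t, `|g t| <= C & ae01 (fun t => h t = g t)].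

Lemma abounded_ae (f g : R -> R) : ae01 (fun t => f t = g t) -> abounded g -> abounded f.
Proof.
move=> fg [k [C [mk kC gk]]]; exists k, C; split => //.
by apply: (ae01_mp2 fg gk) => t _ -> ->.
Qed.

Lemma abounded_cst (c : R) : abounded (fun=> c).
Proof. by exists (fun=> c), `|c|; split => //; exact: ae01_all. Qed.

Lemma aboundedD (f g : R -> R) : abounded f -> abounded g -> abounded (fun t => f t + g t).
Proof.
move=> [f' [C [mf fC ff]]] [g' [D [mg gD gg]]].
exists (fun t => f' t + g' t), (C + D); split.
- exact: measurable_funD.
- by move=> t; rewrite (le_trans (ler_normD _ _))// lerD.
- by apply: (ae01_mp2 ff gg) => t _ -> ->.
Qed.

Lemma aboundedM (f g : R -> R) : abounded f -> abounded g -> abounded (fun t => f t * g t).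
Proof.
move=> [f' [C [mf fC ff]]] [g' [D [mg gD gg]]].
exists (fun t => f' t * g' t), (C * D); split.
- exact: measurable_funM.
- by move=> t; rewrite normrM ler_pM.
- by apply: (ae01_mp2 ff gg) => t _ -> ->.
Qed.

Lemma aboundedZ (c : R) (f : R -> R) : abounded f -> abounded (fun t => c * f t).
Proof. by move=> Hf; exact: aboundedM (abounded_cst c) Hf. Qed.

Lemma aboundedN (f : R -> R) : abounded f -> abounded (fun t => - f t).
Proof.
by move=> /(aboundedZ (-1)); apply: abounded_ae; apply: ae01_all => t _; rewrite mulN1r.
Qed.

Lemma aboundedB (f g : R -> R) : abounded f -> abounded g -> abounded (fun t => f t - g t).
Proof. by move=> Hf /aboundedN; exact: aboundedD. Qed.

Lemma abounded_norm (f : R -> R) : abounded f -> abounded (fun t => `|f t|).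
Proof.
move=> [f' [C [mf fC ff]]]; exists (fun t => `|f' t|), C; split.
- exact: measurableT_comp.
- by move=> t; rewrite normr_id.
- by apply: (ae01_mp ff) => t _ ->.
Qed.

Lemma abounded_sqr (f : R -> R) : abounded f -> abounded (fun t => f t ^+ 2).
Proof. by move=> Hf; have := aboundedM Hf Hf; under eq_fun do rewrite -expr2. Qed.

Lemma abounded_sqrt (f : R -> R) : abounded f -> abounded (fun t => Num.sqrt (f t)).
Proof.
move=> [f' [C [mf fC ff]]]; exists (fun t => Num.sqrt (f' t)), (Num.sqrt C); split.
- by apply: measurableT_comp => //; apply: continuous_measurable_fun; exact: sqrt_continuous.
- move=> t; rewrite ger0_norm ?sqrtr_ge0// ler_wsqrtr//.
  exact: le_trans (ler_norm _) (fC t).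
- by apply: (ae01_mp ff) => t _ ->.
Qed.

Lemma abounded_sum (J : finType) (F : J -> R -> R) :
  (forall i, abounded (F i)) -> abounded (fun t => \sum_i F i t).
Proof.
move=> H; elim: (index_enum J) => [|i s IH].
  by under eq_fun do rewrite big_nil; exact: abounded_cst.
by under eq_fun do rewrite big_cons; exact: aboundedD.
Qed.

Lemma abounded_measurable (h : R -> R) (C : R) :
  measurable_fun I h -> ae01 (fun t => `|h t| <= C) -> abounded h.
Proof.
move=> mh hC.
(* Clipping and extending by 0 give a representative that is measurable and bounded on the whole
   line. *)
pose g := (fun t => Num.min (Num.max (h t) (- `|C|)) `|C|) \_ I.
exists g, `|C|; split.
- apply/(measurable_restrictT _ measurable_I01).
  apply: measurable_minr => //; apply: measurable_maxr => //.
- move=> t; rewrite /g patchE; case: ifP => _; last by rewrite normr0.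
  have nC : - `|C| <= `|C| by rewrite (le_trans _ (normr_ge0 C))// oppr_le0.
  by rewrite ler_norml le_min le_max ge_min !lexx !orbT nC.
- apply: (ae01_mp hC) => t It ht; rewrite /g patchE mem_set//.
  have /andP[h1 h2] : - `|C| <= h t <= `|C|.
    by rewrite -ler_norml (le_trans ht)// ler_norm.
  by rewrite max_l// min_l.
Qed.

Lemma abounded_bound (f : R -> R) : abounded f -> exists2 C, 0 <= C & ae01 (fun t => `|f t| <= C).
Proof.
move=> [g [C [mg gC fg]]]; exists C; first exact: le_trans (normr_ge0 _) (gC 0).
by apply: (ae01_mp fg) => t _ ->.
Qed.

Lemma abounded_Linf (f : R -> R) : abounded f -> exists2 g, Linf g & ae01 (fun t => f t = g t).
Proof.
move=> [g [C [mg gC fg]]]; exists g => //; split; first exact: measurable_funTS.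
by exists C; apply: ae01_all.
Qed.

Lemma Linf_abounded f : Linf f -> abounded f.
Proof. by case=> mf [C fC]; exact: abounded_measurable mf fC. Qed.

Lemma bounded_integrable (g : R -> R) (C : R) : measurable_fun setT g ->
  (forall t, `|g t| <= C) -> mu.-integrable I (EFin \o g).
Proof.
move=> mg gC; apply: measurable_bounded_integrable => //.
- exact: measurable_I01.
- by rewrite [X in (X < _)%E]lebesgue_I01 ltry.
- exact: measurable_funTS.
- exists C; split; first exact: num_real.
  by move=> x Cx t _; apply: le_trans (gC t) (ltW Cx).
Qed.

Lemma IntD (f g : R -> R) : abounded f -> abounded g ->
  Int01 (fun t => f t + g t) = Int01 f + Int01 g.
Proof.
move=> [f' [C [mf fC ff]]] [g' [D [mg gD gg]]].
rewrite (Int_ae ff) (Int_ae gg) (@Int_ae _ (fun t => f' t + g' t)); last first.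
  by apply: (ae01_mp2 ff gg) => t _ -> ->.
rewrite /Int01 RintegralD//; first exact: measurable_I01.
- exact: bounded_integrable mf fC.
- exact: bounded_integrable mg gD.
Qed.

Lemma IntZ (c : R) (f : R -> R) : abounded f -> Int01 (fun t => c * f t) = c * Int01 f.
Proof.
move=> [f' [C [mf fC ff]]].
rewrite (Int_ae ff) (@Int_ae _ (fun t => c * f' t)); last first.
  by apply: (ae01_mp ff) => t _ ->.
rewrite /Int01 RintegralZl//; first exact: measurable_I01.
exact: bounded_integrable mf fC.
Qed.

Lemma IntN (f : R -> R) : abounded f -> Int01 (fun t => - f t) = - Int01 f.
Proof.
move=> Hf; rewrite -mulN1r -IntZ//; apply: Int_ae; apply: ae01_all => t _.
by rewrite mulN1r.
Qed.

Lemma IntB (f g : R -> R) : abounded f -> abounded g ->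
  Int01 (fun t => f t - g t) = Int01 f - Int01 g.
Proof. by move=> Hf Hg; rewrite IntD ?IntN//; exact: aboundedN. Qed.

Lemma Int_cst (c : R) : Int01 (fun=> c) = c.
Proof.
rewrite /Int01 Rintegral_cst; last exact: measurable_I01.
by have -> : fine (mu I) = 1; [rewrite lebesgue_I01|rewrite mulr1].
Qed.


Lemma Int_ge0 (f : R -> R) : ae01 (fun t => 0 <= f t) -> 0 <= Int01 f.
Proof.
move=> f0; rewrite (@Int_ae _ (fun t => Num.max (f t) 0)); last first.
  by apply: (ae01_mp f0) => t _ ft; rewrite max_l.
by apply: Rintegral_ge0 => t _; rewrite le_max lexx orbT.
Qed.

Lemma Int_le (f g : R -> R) : abounded f -> abounded g -> ae01 (fun t => f t <= g t) ->
  Int01 f <= Int01 g.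
Proof.
move=> Hf Hg fg; rewrite -subr_ge0 -IntB//; apply: Int_ge0.
by apply: (ae01_mp fg) => t _; rewrite subr_ge0.
Qed.

Lemma Int_norm_le (f g : R -> R) : abounded f -> abounded g -> ae01 (fun t => `|f t| <= g t) ->
  `|Int01 f| <= Int01 g.
Proof.
move=> Hf Hg fg; rewrite ler_norml; apply/andP; split.
  rewrite -IntN//; apply: Int_le => //; first exact: aboundedN.
  by apply: (ae01_mp fg) => t _; rewrite ler_norml => /andP[].
apply: Int_le => //; by apply: (ae01_mp fg) => t _; rewrite ler_norml => /andP[].
Qed.

Lemma Int_eq0 (f : R -> R) : abounded f -> ae01 (fun t => 0 <= f t) -> Int01 f = 0 ->
  ae01 (fun t => f t = 0).
Proof.
move=> [g [C [mg gC fg]]] f0; rewrite (Int_ae fg) => g0.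
have g_ge0 : ae01 (fun t => 0 <= g t) by apply: (ae01_mp2 fg f0) => t _ <-.
pose k t := Num.max (g t) 0.
have gk : ae01 (fun t => g t = k t) by apply: (ae01_mp g_ge0) => t _ ?; rewrite /k max_l.
have mk : measurable_fun setT k by apply: measurable_maxr.
have kint : mu.-integrable I (EFin \o k).
  apply: (bounded_integrable (C := C)) => // t; rewrite /k.
  have C0 : 0 <= C := le_trans (normr_ge0 _) (gC 0).
  by rewrite ger0_norm ?le_max ?lexx ?orbT// ge_max C0 andbT (le_trans (ler_norm _)).
have : (\int[mu]_(t in I) `|(EFin \o k) t| = 0)%E.
  rewrite -[LHS]fineK; last first.
    by apply: integrable_fin_num => //; [exact: measurable_I01|exact: integrable_abse].
  congr EFin; rewrite -g0 (Int_ae gk) /Int01 /Rintegral; congr fine.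
  by apply: eq_integral => t _ /=; rewrite ger0_norm// /k le_max lexx orbT.
have mkE : measurable_fun I (EFin \o k) by exact/measurable_EFinP/measurable_funTS.
move/(ae_eq_integral_abs mu measurable_I01 mkE) => H.
have kk : ae01 (fun t => k t = 0) by apply: (@filterS _ _ (ae_filter_ringOfSetsType mu) _ _ _ H) => t Ht It; have [] := Ht It.
have /(ae01_mp2 kk) : ae01 (fun t => f t = k t) by apply: (ae01_mp2 fg gk) => t _ -> ->.
by apply=> t _ -> ->.
Qed.

End AlmostEverywhere.

(** * Lipschitz functions *)

Section LipschitzFTC.
Variable R : realType.
Local Notation mu := (@lebesgue_measure R).
Local Notation I := (@I01 R).

Definition lip (K : R) (F : R -> R) : Prop :=
  forall s t, I01c s -> I01c t -> `|F s - F t| <= K * `|s - t|.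

(** Retraction onto [0, 1]; it extends a Lipschitz function on the interval to the whole line with
    the same constant. *)
Definition clamp (x : R) : R := Num.min (Num.max x 0) 1.

Lemma clamp_I01c x : I01c (clamp x).
Proof.
rewrite /I01c /= in_itv/= /clamp le_min le_max lexx orbT ler01/=.
by rewrite ge_min lexx orbT.
Qed.

Lemma clamp_id x : I01c x -> clamp x = x.
Proof.
by rewrite /I01c /= in_itv/= /clamp => /andP[x0 x1]; rewrite max_l// min_l.
Qed.

Lemma clamp_cases x :
  [\/ x <= 0 /\ clamp x = 0, 0 <= x <= 1 /\ clamp x = x | 1 <= x /\ clamp x = 1].
Proof.
rewrite /clamp; case: (leP x 0) => [x0|/ltW x0].
  by apply: Or31; rewrite min_l.
by case: (leP x 1) => [x1|/ltW x1]; [apply: Or32; rewrite x0|apply: Or33].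
Qed.

Lemma clamp_lip x y : x <= y -> 0 <= clamp y - clamp x <= y - x.
Proof.
move=> xy.
by case: (clamp_cases x) => -[Hx ->]; case: (clamp_cases y) => -[Hy ->]; lra.
Qed.

Section Monotone.
Variable G : cumulative R R.
Hypothesis G_lip : exists C : R, forall x y, x <= y -> G y - G x <= C * (y - x).

Lemma lebesgue_stieltjes_itv (a b : R) : a <= b ->
  lebesgue_stieltjes_measure G `]a, b] = (G b - G a)%:E.
Proof.
move=> ab; rewrite /lebesgue_stieltjes_measure /measure_extension.
by rewrite measurable_mu_extE/= ?wlength_itv_bnd//; exact: is_ocitv.
Qed.

(** A cover of A by half-open intervals has total G-length at most C times its total length. The
    constant C + 1 is used in place of C because it is positive and can be divided by. *)
Lemma lebesgue_stieltjes_dominated (A : set R) : mu A = 0%E ->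
  lebesgue_stieltjes_measure G A = 0%E.
Proof.
have [C HC] := G_lip; have C0 : 0 <= C.
  have := HC 0 1 ler01; rewrite subr0 mulr1; apply: le_trans.
  by rewrite subr_ge0; apply: cumulative_is_nondecreasing.
move=> A0; apply/eqP; rewrite eq_le measure_ge0 andbT.
have -> : 0%E = ((C + 1)%:E * mu A)%E by rewrite A0 mule0.
rewrite -lee_pdivrMl ?ltr_pwDr//.
apply: le_ereal_inf_tmp => _ [B [mB AB] <-].
rewrite lee_pdivrMl ?ltr_pwDr// -nneseriesZl//.
apply: (@le_trans _ _ (\sum_(0 <= k <oo) wlength G (B k))%E).
  by apply: ereal_inf_lbound; exists B.
apply: lee_nneseries => [n _ _|n _]; first exact: wlength_ge0.
have /ocitvP[->|[[a b]/= ab ->]] := mB n; first by rewrite wlength0 mule_ge0 ?lee_fin ?addr_ge0 ?wlength_ge0.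
rewrite wlength_itv_bnd ?(ltW ab)//.
have -> : wlength idfun `]a, b] = (b - a)%:E by exact: (wlength_itv_bnd idfun _ _ (ltW ab)).
rewrite -EFinM lee_fin.
by apply: (le_trans (HC _ _ (ltW ab))); rewrite ler_wpM2r ?subr_ge0 ?(ltW ab)// lerDl.
Qed.

End Monotone.

(** The Lebesgue-Stieltjes measure of G, restricted to ]0, 1], is absolutely continuous; the density
    is its Radon-Nikodym derivative. *)
Lemma monotone_lip_density (G : R -> R) (C : R) :
  {homo G : x y / x <= y} -> (forall x y, x <= y -> G y - G x <= C * (y - x)) ->
  exists g : R -> R, [/\ measurable_fun setT g, mu.-integrable setT (EFin \o g) &
    forall x, 0 <= x <= 1 -> G x - G 0 = \int[mu]_(t in `]0, x]) g t].
Proof.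
move=> ndG G_lip.
have GN x y : `|G x - G y| <= (`|C| + 1) * `|x - y|.
  wlog xy : x y / y <= x.
    by move=> W; case: (leP y x) => [|/ltW] /W//; rewrite distrC [`|y - x|]distrC.
  rewrite [`|G x - G y|]ger0_norm ?subr_ge0 ?ndG// [`|x - y|]ger0_norm ?subr_ge0//.
  apply: (le_trans (G_lip _ _ xy)).
  by rewrite ler_wpM2r ?subr_ge0// (le_trans (ler_norm C))// lerDl.
have rcG : right_continuous G.
  apply: right_continuousW => x; apply/cvgrPdist_le => e e0.
  near=> y; apply: le_trans (GN _ _) _.
  rewrite -ler_pdivlMl ?ltr_pwDr//; near: y; apply: cvgr_dist_le => //.
  by rewrite mulr_gt0// invr_gt0 ltr_pwDr.
pose Gm := isCumulative.Build R _ R G ndG rcG.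
pose Gc : cumulative R R := HB.pack G Gm.
pose D : set (measurableTypeR R) := `]0, 1]%classic.
have mD : measurable D by exact: measurable_itv.
pose nu0 := lebesgue_stieltjes_measure Gc.
have nuD : (nu0 D < +oo)%E by rewrite /nu0 lebesgue_stieltjes_itv ?ltry.
pose nu : {finite_measure set _ -> \bar R} := mfrestr mD nuD.
have nuE A : nu A = nu0 (A `&` D) by [].
have numu : nu `<< mu.
  apply/null_content_dominatesP => A mA A0; rewrite nuE.
  apply: lebesgue_stieltjes_dominated; first by exists C.
  apply/eqP; rewrite -measure_le0 -[leRHS]A0 le_measure ?inE//.
  exact: measurableI.
have [f [f0 ffin fint fE]] := radon_nikodym_sigma_finite numu.
have fg : EFin \o (fine \o f) = f by apply/funext => x /=; rewrite fineK.
exists (fine \o f); rewrite fg; split => //.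
  by apply/measurable_EFinP; rewrite fg; exact: measurable_int fint.
move=> x /andP[x0 x1].
have m0x : measurable (`]0, x] : set (measurableTypeR R)) by exact: measurable_itv.
have := fE _ m0x; rewrite nuE (_ : _ `&` D = `]0, x]%classic); last first.
  apply/seteqP; split => y /=; rewrite /D /= !in_itv/=; first by case.
  by move=> /andP[y0 yx]; rewrite y0 yx (le_trans yx x1).
rewrite /nu0 lebesgue_stieltjes_itv// => H.
rewrite /Rintegral; under eq_integral do rewrite fineK//.
by rewrite -H.
Unshelve. all: by end_near. Qed.

Lemma near_is_derive (f g : R -> R) (x a : R) :
  (\forall y \near x, f y = g y) -> is_derive x 1 f a -> is_derive x 1 g a.
Proof. by move=> fg; exact: near_eq_is_derive. Qed.

Lemma near_I01 (P : R -> Prop) t : I t -> (forall s, I s -> P s) -> \forall s \near t, P s.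
Proof.
move=> It H; have : \forall s \near t, I s by apply: open_nbhs_nbhs; split => //; exact: interval_open.
exact: filterS.
Qed.

Lemma I01W (t : R) : I t -> I01c t.
Proof. by rewrite /I01 /I01c /= !in_itv/= => /andP[/ltW-> /ltW->]. Qed.

Lemma I01c0 : I01c (0 : R).
Proof. by rewrite /I01c /= in_itv/= lexx ler01. Qed.

Lemma I01c1 : I01c (1 : R).
Proof. by rewrite /I01c /= in_itv/= lexx ler01. Qed.

Lemma lip_near_continuous K (F : R -> R) t : lip K F -> I t -> {for t, continuous F}.
Proof.
move=> HF It; apply/cvgrPdist_le => e e0.
have K0 : 0 <= K.
  by have := HF 1 0 I01c1 I01c0; rewrite subr0 normr1 mulr1; apply: le_trans.
near=> s; apply: (@le_trans _ _ (K * `|t - s|)).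
  by apply: HF; apply: I01W => //; near: s; apply: near_I01.
apply: (@le_trans _ _ ((K + 1) * `|t - s|)); first by rewrite ler_wpM2r// lerDl.
rewrite -ler_pdivlMl ?ltr_pwDr//; near: s; apply: cvgr_dist_le => //.
by rewrite mulr_gt0// invr_gt0 ltr_pwDr.
Unshelve. all: by end_near. Qed.

Lemma lip_derive_le K (F : R -> R) t a : lip K F -> I t -> is_derive t 1 F a -> `|a| <= K.
Proof.
move=> HF It [dF <-].
apply: (@cvgr_to_le _ (dnbhs (0 : R)) _ _ (fun h => `|h^-1 *: (F (h *: 1 + t) - F t)|)).
  by apply: cvg_norm; exact: dF.
have nI : \forall h \near (0 : R), I (h *: (1 : R) + t).
  have : (h + t) @[h --> (0 : R)] --> (0 + t).
    by apply: cvgD; [exact: cvg_id|exact: cvg_cst].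
  under eq_fun do rewrite -[X in X + _]mulr1.
  by rewrite add0r; apply; apply: near_I01 It _.
near=> h.
have h0 : h != 0 by near: h; exact: nbhs_dnbhs_neq.
rewrite /= normrZ normfV ler_pdivrMl ?normr_gt0// mulrC.
have -> : `|h| = `|(h *: 1 + t) - t| by rewrite addrK [h *: _]mulr1.
apply: HF; apply: I01W => //; near: h; exact: nbhs_dnbhs.
Unshelve. all: by end_near. Qed.

(** Adding K x makes F nondecreasing with slopes at most 2 K, which reduces to the monotone case;
    the linear term is subtracted again. *)
Lemma lip_density K (F : R -> R) : lip K F -> exists g : R -> R,
  [/\ measurable_fun setT g, mu.-integrable setT (EFin \o g) &
    forall x, I01c x -> F x = F 0 + \int[mu]_(t in `]0, x]) g t - K * x].
Proof.
move=> HF; have K0 : 0 <= K.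
  by have := HF 1 0 I01c1 I01c0; rewrite subr0 normr1 mulr1; apply: le_trans.
pose G x := F (clamp x) + K * clamp x.
have GB x y : x <= y -> 0 <= G y - G x <= K *+ 2 * (y - x).
  move=> xy; have /andP[c0 c1] := clamp_lip xy.
  have := HF _ _ (clamp_I01c y) (clamp_I01c x); rewrite (ger0_norm c0) ler_norml /G.
  by move=> /andP[]; have := ler_wpM2l K0 c1; lra.
have [||g [mg ig Hg]] := @monotone_lip_density G (K *+ 2).
- by move=> x y /GB; rewrite -[G x <= G y]subr_ge0 => /andP[].
- by move=> x y /GB => /andP[].
exists g; split => // x Ix; rewrite -Hg; last by move: Ix; rewrite /I01c/= in_itv.
by rewrite /G !clamp_id//; [ring|exact: I01c0].
Qed.

(* Lebesgue differentiation applied to the density of a Lipschitz function *)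
Lemma lip_ftc K (F : R -> R) : lip K F -> exists g : R -> R,
  [/\ abounded g, Int01 g = F 1 - F 0 & ae01 (fun t => is_derive t 1 F (g t))].
Proof.
have I10 : I01c (0 : R) := I01c0; move=> HF.
have [g [mg ig Hg]] := lip_density HF.
pose H x := \int[mu]_(t in `]0, x]) g t.
have intg y : mu.-integrable [set` Interval (BRight 0) (BRight y)] (EFin \o g).
  exact: integrableS ig.
have locg : locally_integrable setT g by apply: open_integrable_locally ig; exact: openT.
have := FTC1 intg locg; rewrite -/H => aeH.
have FH : ae01 (fun t => is_derive t 1 F (g t - K)).
  apply: (@filterS _ _ (ae_filter_ringOfSetsType mu) _ _ _ aeH) => t Ht It.
  have t0 : 0 < t by move: It; rewrite /I01 /= in_itv/= => /andP[].
  have [|dH eH] := Ht; first by rewrite lte_fin.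
  apply: (@near_is_derive (fun x => F 0 + H x - K * x)).
    by apply: near_I01 It _ => s /I01W /Hg ->.
  apply: is_derive_eq; first by apply: is_deriveB; apply: is_deriveD; exact: DeriveDef dH erefl.
  by rewrite -derive1E eH add0r [K *: _]mulr1.
exists (fun t => g t - K); split => //.
- apply: (@abounded_measurable _ _ K); first by apply: measurable_funB => //; exact: measurable_funTS.
  by apply: (ae01_mp FH) => t It; exact: lip_derive_le HF It.
rewrite [F 1]Hg; last exact: I01c1.
have -> : Int01 (fun t => g t - K) = Int01 g - Int01 (fun=> K).
  rewrite /Int01; apply: RintegralB.
  - exact: measurable_I01.
  - by apply: integrableS ig => //; exact: measurable_I01.
  - exact: (@bounded_integrable _ (fun=> K) `|K|).
rewrite Int_cst mulr1.
rewrite addrAC [F 0 + _]addrC addrK; congr (_ - _).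
by rewrite /Int01 /I01 Rintegral_itv_bndo_bndc//; apply: integrableS ig.
Qed.

End LipschitzFTC.

(** * Derivatives of Lipschitz functions and primitives of bounded functions *)

Section Primitive.
Variable R : realType.
Local Notation mu := (@lebesgue_measure R).
Local Notation I := (@I01 R).

Lemma lip_derive1 K (F : R -> R) : lip K F ->
  [/\ abounded (derive1 F), Int01 (derive1 F) = F 1 - F 0 &
      ae01 (fun t => is_derive t 1 F (derive1 F t))].
Proof.
move=> HF; have [g [bg ig Fg]] := lip_ftc HF.
have E : ae01 (fun t => derive1 F t = g t).
  by apply: (ae01_mp Fg) => t _ Ft; rewrite derive1E; case: Ft.
split; first exact: abounded_ae E bg.
  by rewrite -ig; exact: Int_ae.
by apply: (ae01_mp2 E Fg) => t _ ->.
Qed.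

Lemma is_derive1_derive1 (F : R -> R) (t a : R) : is_derive t 1 F a -> derive1 F t = a.
Proof. by move=> H; rewrite derive1E; case: H. Qed.

Lemma is_derive1_unique (F : R -> R) (t a b : R) : is_derive t 1 F a -> is_derive t 1 F b -> a = b.
Proof. by move=> [_ <-] [_ <-]. Qed.

Lemma lip_stop K (F : R -> R) x : I01c x -> lip K F -> lip K (fun s => F (Num.min s x)).
Proof.
have K0 : lip K F -> 0 <= K.
  by move=> /(_ 1 0 (I01c1 R) (I01c0 R)); rewrite subr0 normr1 mulr1; apply: le_trans.
move=> Ix HF; have {}K0 := K0 HF => s t Is It.
have Im y : I01c y -> I01c (Num.min y x) by move=> Iy; case: leP.
apply: (le_trans (HF _ _ (Im _ Is) (Im _ It))); rewrite ler_wpM2l//.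
case: (leP s x) => sx; case: (leP t x) => tx //; last by rewrite subrr normr0.
  have st : s <= t by lra.
  by rewrite distrC [leRHS]distrC !ger0_norm; lra.
have ts : t <= s by lra.
by rewrite !ger0_norm; lra.
Qed.

(** Freezing F after x gives a Lipschitz function on the whole interval whose derivative is that of
    F before x and 0 after x, so that only integrals over ]0, 1[ occur. *)
Lemma lip_le_Int K (F : R -> R) x : lip K F -> I01c x ->
  `|F x - F 0| <= Int01 (fun t => `|derive1 F t|).
Proof.
move=> HF Ix; have [bF _ dF] := lip_derive1 HF.
pose G s := F (Num.min s x).
have [bG iG dG] := lip_derive1 (lip_stop Ix HF).
have /andP[x0 x1] : 0 <= x <= 1 by move: Ix; rewrite /I01c /= in_itv.
have -> : F x - F 0 = Int01 (derive1 G) by rewrite iG /G min_r// min_l.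
apply: Int_norm_le => //; first exact: abounded_norm.
have nx : ae01 (fun t => t != x).
  have /negligibleP/= H : mu [set x] = 0%E by exact: lebesgue_measure_set1.
  apply: (@negligibleS _ _ _ mu [set x] _ _ (H _)) => //.
  by move=> t /= /not_implyP[_ /negP]; rewrite negbK => /eqP.
apply: (ae01_mp2 dF nx) => t It dFt tx.
have [lt|gt|eq] := ltgtP t x; last by rewrite eq eqxx in tx.
  have : is_derive t 1 G (derive1 F t).
    apply: near_is_derive dFt; near=> s; rewrite /G min_l// ltW//.
    by near: s; apply: lt_nbhsl.
  by move=> /is_derive1_derive1 ->.
have : is_derive t 1 G 0.
  apply: near_is_derive (is_derive_cst (F x) t 1).
  near=> s; rewrite /G min_r// ltW//.
  by near: s; apply: lt_nbhsr.
by move=> /is_derive1_derive1 ->; rewrite normr0.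
Unshelve. all: by end_near. Qed.

Section BoundedIntegrand.
Variables (g : R -> R) (C : R).
Hypotheses (mg : measurable_fun setT g) (gC : forall t, `|g t| <= C).

Definition primitive (x : R) : R := \int[mu]_(t in `]0, x]) g t.

Let C0 : 0 <= C := le_trans (normr_ge0 _) (gC 0).

Lemma bounded_integrable_itv (a b : R) (x y : bool) :
  mu.-integrable [set` Interval (BSide x a) (BSide y b)] (EFin \o g).
Proof.
apply: measurable_bounded_integrable => //.
- by rewrite [X in (X < _)%E]lebesgue_measure_itv; case: ifP => _; rewrite -?EFinB ltry.
- exact: measurable_funTS.
- exists C; split; first exact: num_real.
  by move=> z Cz t _; apply: le_trans (gC t) (ltW Cz).
Qed.

Lemma primitiveB s t : 0 <= s -> s <= t ->
  primitive t - primitive s = \int[mu]_(u in `]s, t]) g u.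
Proof.
move=> s0 st; rewrite /primitive; apply: Rintegral_itvB => //.
exact: bounded_integrable_itv.
Qed.

Lemma primitive0 : primitive 0 = 0.
Proof. by rewrite /primitive set_itv_ge ?Rintegral_set0// bnd_simp ltxx. Qed.

Lemma primitive1 : primitive 1 = Int01 g.
Proof.
rewrite /primitive /Int01 /I01 Rintegral_itv_bndo_bndc//.
exact: bounded_integrable_itv.
Qed.

Lemma primitive_lip : lip C primitive.
Proof.
move=> s t; wlog st : s t / t <= s.
  by move=> W Is It; have [ts|/ltW st] := leP t s; [|rewrite distrC [`|s - t|]distrC]; exact: W.
move=> _; rewrite /I01c /= in_itv/= => /andP[t0 _]; rewrite primitiveB//.
have mi : measurable (`]t, s]%classic : set (measurableTypeR R)) by exact: measurable_itv.
have ii := bounded_integrable_itv t s false false.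
have := @le_normr_Rintegral _ _ _ mu _ g mi ii.
move/le_trans; apply.
have -> : C * `|s - t| = \int[mu]_(u in `]t, s]) C.
  rewrite Rintegral_cst// [X in fine X]lebesgue_measure_itv/= lte_fin.
  move: st; rewrite le_eqVlt => /predU1P[->|st]; first by rewrite ltxx subrr normr0.
  by rewrite st ger0_norm ?subr_ge0 ?(ltW st).
apply: le_Rintegral => //.
- by have := integrable_norm ii.
- apply: measurable_bounded_integrable => //.
    by rewrite [X in (X < _)%E]lebesgue_measure_itv; case: ifP => _; rewrite -?EFinB ltry.
  by exists C; split; [exact: num_real|move=> z Cz u _ /=; rewrite ger0_norm// ltW].
Qed.

Lemma primitive_nd s t : (forall u, 0 <= g u) -> 0 <= s -> s <= t ->
  primitive s <= primitive t.
Proof. by move=> g0 s0 st; rewrite -subr_ge0 primitiveB//; apply: Rintegral_ge0. Qed.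

Lemma primitive_derive_ae : ae01 (fun t => is_derive t 1 primitive (g t)).
Proof.
have intg y : mu.-integrable [set` Interval (BRight 0) (BRight y)] (EFin \o g).
  exact: bounded_integrable_itv.
have locg : locally_integrable setT g.
  split => //; first exact: openT.
  move=> K _ cK; have mK := compact_measurable cK.
  have /integrableP[_] : mu.-integrable K (EFin \o g).
    apply: measurable_bounded_integrable => //.
    - exact: compact_finite_measure.
    - exact: measurable_funTS.
    - exists C; split; first exact: num_real.
      by move=> z Cz t _; apply: le_trans (gC t) (ltW Cz).
  by [].
have aeH := FTC1 intg locg.
apply: (@filterS _ _ (ae_filter_ringOfSetsType mu) _ _ _ aeH) => t Ht It.
have t0 : 0 < t by move: It; rewrite /I01 /= in_itv/= => /andP[].
have [|dH eH] := Ht; first by rewrite lte_fin.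
by apply: DeriveDef; [exact: dH|rewrite -derive1E; exact: eH].
Qed.

Lemma primitive_derive_cont t : 0 < t -> {for t, continuous g} ->
  is_derive t 1 primitive (g t).
Proof.
move=> t0 ct.
have t1 : t < t + 1 by rewrite ltrDl.
have [|dH eH] := continuous_FTC1 t1 (bounded_integrable_itv 0 (t + 1) false false) _ ct.
  by rewrite lte_fin.
by apply: DeriveDef; [exact: dH|rewrite -derive1E; exact: eH].
Qed.

End BoundedIntegrand.

Lemma abounded_primitive (h : R -> R) : abounded h -> exists H K,
  [/\ lip K H, H 0 = 0, H 1 = Int01 h & ae01 (fun t => is_derive t 1 H (h t))].
Proof.
move=> [g [C [mg gC hg]]]; exists (primitive g), C; split.
- exact: primitive_lip.
- exact: primitive0.
- by rewrite (Int_ae hg) (primitive1 mg gC).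
- by apply: (ae01_mp2 hg (primitive_derive_ae mg gC)) => t _ ->.
Qed.

End Primitive.

(** * Reparametrization at constant speed *)

Section PlaneVectors.
Variable R : realType.
Implicit Types x y : R * R.

Lemma vdot_ge0 x : 0 <= vdot x x.
Proof. by rewrite /vdot -!expr2 addr_ge0 ?sqr_ge0. Qed.

Lemma vnorm_ge0 x : 0 <= vnorm x.
Proof. exact: sqrtr_ge0. Qed.

Lemma sqr_vnorm x : vnorm x ^+ 2 = vdot x x.
Proof. by rewrite sqr_sqrtr// vdot_ge0. Qed.

Lemma le_fst_vnorm x : `|x.1| <= vnorm x.
Proof.
rewrite -ler_sqr ?nnegrE ?vnorm_ge0// sqr_vnorm real_normK ?num_real// /vdot -!expr2.
by rewrite lerDl sqr_ge0.
Qed.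

Lemma le_snd_vnorm x : `|x.2| <= vnorm x.
Proof.
rewrite -ler_sqr ?nnegrE ?vnorm_ge0// sqr_vnorm real_normK ?num_real// /vdot -!expr2.
by rewrite lerDr sqr_ge0.
Qed.

Lemma vnorm_le_sum x : vnorm x <= `|x.1| + `|x.2|.
Proof.
rewrite -ler_sqr ?nnegrE ?vnorm_ge0 ?addr_ge0// sqr_vnorm /vdot -!expr2 sqrrD !real_normK ?num_real//.
by rewrite -addrA [_ *+ 2 + _]addrC addrA lerDl mulrn_wge0// mulr_ge0.
Qed.

Lemma vdotC x y : vdot x y = vdot y x.
Proof. by rewrite /vdot; ring. Qed.

Lemma le_vdot x y : `|vdot x y| <= vnorm x * vnorm y.
Proof.
rewrite -ler_sqr ?nnegrE ?mulr_ge0 ?vnorm_ge0// exprMn !sqr_vnorm real_normK ?num_real//.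
rewrite /vdot -subr_ge0.
by rewrite (_ : _ - _ = (x.1 * y.2 - x.2 * y.1) ^+ 2) ?sqr_ge0//; ring.
Qed.

Lemma vnorm_vadd x y : vnorm (vadd x y) <= vnorm x + vnorm y.
Proof.
rewrite -ler_sqr ?nnegrE ?addr_ge0 ?vnorm_ge0// sqrrD !sqr_vnorm.
have := le_trans (ler_norm _) (le_vdot x y).
by rewrite /vdot /vadd /=; lra.
Qed.

Lemma vnorm_vscale (k : R) x : vnorm (vscale k x) = `|k| * vnorm x.
Proof.
rewrite /vnorm (_ : vdot _ _ = k ^+ 2 * vdot x x); last by rewrite /vdot /vscale/=; ring.
by rewrite sqrtrM ?sqr_ge0// sqrtr_sqr.
Qed.


Lemma Lip01P (xi : R -> R * R) : Lip01 xi <->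
  exists K, lip K (fun t => (xi t).1) /\ lip K (fun t => (xi t).2).
Proof.
split=> [[K HK]|[K [H1 H2]]].
  exists K; split=> s t Is It; apply: le_trans (HK s t Is It).
    exact: (le_fst_vnorm (vsub (xi s) (xi t))).
  exact: (le_snd_vnorm (vsub (xi s) (xi t))).
exists (K + K) => s t Is It; apply: (le_trans (vnorm_le_sum _)).
by rewrite mulrDl lerD//; [exact: H1|exact: H2].
Qed.

End PlaneVectors.

Section Reparametrization.
Variable R : realType.
Local Notation mu := (@lebesgue_measure R).
Local Notation I := (@I01 R).

Lemma derive_ge (F : R -> R) (c s a : R) : I s ->
  (forall u v, I u -> I v -> u <= v -> c * (v - u) <= F v - F u) ->
  is_derive s 1 F a -> c <= a.
Proof.
move=> Is HF [dF <-].
apply: (@cvgr_to_ge _ (dnbhs (0 : R)) _ _ (fun h => h^-1 *: (F (h *: 1 + s) - F s))).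
  exact: dF.
have nI : \forall h \near (0 : R), I (h *: (1 : R) + s).
  have : (h + s) @[h --> (0 : R)] --> (0 + s).
    by apply: cvgD; [exact: cvg_id|exact: cvg_cst].
  under eq_fun do rewrite -[X in X + _]mulr1.
  by rewrite add0r; apply; apply: near_I01 Is _.
near=> h.
have h0 : h != 0 by near: h; exact: nbhs_dnbhs_neq.
have Ih : I (h *: (1 : R) + s) by near: h; exact: nbhs_dnbhs.
move: Ih; rewrite [h *: _]mulr1 => Ih.
have [hn|hp|/eqP] := ltgtP h 0; last by rewrite (negbTE h0).
  have hs : h + s <= s by lra.
  have := HF _ _ Ih Is hs; rewrite (_ : c * _ = - (c * h)); last by ring.
  by move=> H; rewrite /GRing.scale/= mulrC ler_ndivlMr//; lra.
have := HF _ _ Is Ih; rewrite lerDr addrK => /(_ (ltW hp)) H.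
by rewrite /GRing.scale/= mulrC ler_pdivlMr.
Unshelve. all: by end_near. Qed.

(* A null set N is covered by an open O of small measure; the primitive of the indicator of O, composed with phi, has derivative at least m on phi^-1(O), so that phi^-1(O) has small measure. *)
Lemma ae01_comp_expanding (K m : R) (phi : R -> R) (P : R -> Prop) :
  lip K phi -> 0 < m ->
  (forall s t, I01c s -> I01c t -> s <= t -> m * (t - s) <= phi t - phi s) ->
  phi 0 = 0 -> phi 1 = 1 -> ae01 P -> ae01 (fun s => P (phi s)).
Proof.
move=> lphi m0 ephi phi0 phi1 [N [mN N0 NP]].
have phiI s : I s -> I (phi s).
  move=> Is; have Ic := I01W Is; move: (Is); rewrite /I01 /= !in_itv/= => /andP[s0 s1].
  have := ephi _ _ (I01c0 R) Ic (ltW s0); have := ephi _ _ Ic (I01c1 R) (ltW s1).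
  rewrite phi0 phi1 subr0 => h1 h2; apply/andP; split.
    by rewrite -[phi s]subr0 (lt_le_trans _ h2) // mulr_gt0.
  by rewrite -subr_gt0 (lt_le_trans _ h1)// mulr_gt0// subr_gt0.
(* It suffices to cover the exceptional set by sets of measure at most e: the covers for e = 1 / (n
   + 1) intersect in a null set. *)
suff H e : 0 < e -> exists A : set R, [/\ measurable A, (mu A <= e%:E)%E &
    forall s, I s -> ~ P (phi s) -> A s].
  have HA n := cid (H n.+1%:R^-1 (eqbRL (invr_gt0 _) (ltr0Sn R n))).
  pose A n := sval (HA n).
  have mA n : measurable (A n) by rewrite /A; case: (HA n) => ? [].
  exists (\bigcap_n A n); split.
  - exact: bigcapT_measurable.
  - apply/eqP; rewrite eq_le measure_ge0 andbT; apply/lee_addgt0Pr => e e0.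
    rewrite add0e.
    have [n ne] : exists n, n.+1%:R^-1 < e.
      by have [n _ /(_ _ (leqnn n))] := near_infty_natSinv_lt (PosNum e0); exists n.
    apply: (@le_trans _ _ (mu (A n))).
      apply: le_measure; rewrite ?inE//; first exact: bigcapT_measurable.
        exact: mA.
      by move=> x Hx; exact: (Hx n Logic.I).
    apply: (@le_trans _ _ (n.+1%:R^-1)%:E); last by rewrite lee_fin ltW.
    by rewrite /A; case: (HA n) => ? [].
  - move=> s Hs n _; have [Is nP] : I s /\ ~ P (phi s) by exact/not_implyP.
    by rewrite /A; case: (HA n) => B [_ _ HB] /=; exact: HB.
(* The preimage of a set O will have measure at most that of O divided by m, hence the target m e
   for O. *)
move=> e0; have me0 : 0 < m * e by rewrite mulr_gt0.
have [|O [oO NO Oe]] := lebesgue_regularity_outer mN _ me0.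
  by rewrite [X in (X < _)%E]N0.
have mO : measurable O by exact: open_measurable.
pose g : R -> R := \1_O.
have mg : measurable_fun setT g by exact: measurable_indic.
have g01 u : 0 <= g u <= 1 by rewrite /g indicE; case: (_ \in _); rewrite ?lexx ?ler01.
have gC u : `|g u| <= 1 by have /andP[u0 u1] := g01 u; rewrite ger0_norm.
pose H := primitive g.
have lH : lip 1 H := primitive_lip mg gC.
have phic s : I01c s -> I01c (phi s).
  rewrite /I01c /= !in_itv/= => /andP[s0 s1].
  have Is : I01c s by rewrite /I01c /= in_itv/= s0.
  have := ephi _ _ (I01c0 R) Is s0; have := ephi _ _ Is (I01c1 R) s1.
  rewrite phi0 phi1 subr0 => h1 h2; apply/andP; split.
    by rewrite -[phi s]subr0 (le_trans _ h2)// mulr_ge0// ltW.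
  by rewrite -subr_ge0 (le_trans _ h1)// mulr_ge0 ?subr_ge0// ltW.
have lHphi : lip (1 * K) (H \o phi).
  move=> s t Is It; apply: (le_trans (lH _ _ (phic _ Is) (phic _ It))).
  by rewrite !mul1r; exact: lphi.
have [bk ik dk] := lip_derive1 lHphi.
have [_ _ dphi] := lip_derive1 lphi.
pose A : set R := I `&` phi @^-1` O.
have oA : open A.
  rewrite openE => s [Is Os]; rewrite /interior; apply: filterI.
    by apply: near_I01 Is _.
  by apply: (lip_near_continuous lphi Is); apply: open_nbhs_nbhs.
have mA : measurable A by exact: open_measurable.
exists A; split => //; last first.
  move=> s Is nP; split => //; apply: NO; apply: NP => /= /(_ (phiI _ Is)) //.
have low : ae01 (fun s => m * \1_A s <= derive1 (H \o phi) s).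
  apply: (ae01_mp2 dk dphi) => s Is dks dphis.
  have mono u v : I u -> I v -> u <= v -> phi u <= phi v.
    move=> Iu Iv uv; rewrite -subr_ge0 (le_trans _ (ephi _ _ (I01W Iu) (I01W Iv) uv))//.
    by rewrite mulr_ge0 ?subr_ge0// ltW.
  rewrite indicE; case: (boolP (s \in A)) => [/set_mem [_ Os]|_]; last first.
    rewrite mulr0; apply: (derive_ge Is _ dks) => u v Iu Iv uv; rewrite mul0r subr_ge0.
    apply: (primitive_nd mg gC) => [w| |]; first by have /andP[] := g01 w.
      by have := phiI _ Iu; rewrite /I01 /= in_itv/= => /andP[/ltW].
    exact: mono.
  rewrite mulr1.
  (* The chain rule is needed at every point of the preimage; an almost everywhere derivative of [H]
     would have to be pulled back through [phi], which is the claim itself. On the open set [O] the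
     indicator is locally constant, so [H] is differentiable at each point. *)
  have cg : {for phi s, continuous g}.
    apply/cvgrPdist_le => d d0; near=> y.
    have Oy : O y by near: y; exact: (open_nbhs_nbhs (conj oO Os)).
    by rewrite /g !indicE !mem_set// subrr normr0 ltW.
  have p0 : 0 < phi s by have := phiI _ Is; rewrite /I01 /= in_itv/= => /andP[].
  have dH := primitive_derive_cont mg gC p0 cg.
  have -> : derive1 (H \o phi) s = derive1 phi s.
    apply: is_derive1_derive1.
    apply: (is_derive_eq (is_derive1_comp dH dphis)).
    by rewrite /g indicE mem_set// mul1r.
  apply: (derive_ge Is _ dphis) => u v Iu Iv uv.
  by apply: ephi => //; exact: I01W.
have b1A : abounded (\1_A : R -> R).
  exists \1_A, 1; split; first exact: measurable_indic.
    by move=> t; rewrite indicE; case: (_ \in _); rewrite ?normr0 ?normr1.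
  exact: ae01_all.
have iA (B : set R) : measurable B -> Int01 (\1_B : R -> R) = fine (mu (B `&` I)).
  by move=> mB; rewrite /Int01 /Rintegral integral_indic//; exact: measurable_I01.
have fA (B : set R) : measurable B -> (mu (B `&` I) \is a fin_num).
  move=> mB; rewrite ge0_fin_numE//; apply: (@le_lt_trans _ _ (mu I)).
    have mBI : measurable (B `&` I) by apply: measurableI => //; exact: measurable_I01.
    apply: le_measure; rewrite ?inE//; do ?[exact: mBI|exact: measurable_I01].
  by rewrite [X in (X < _)%E]lebesgue_I01 ltry.
have := Int_le (aboundedZ m b1A) bk low.
rewrite IntZ// ik /= phi0 phi1 /H primitive0 subr0 (primitive1 mg gC) !iA// => le1.
have AI : A `&` I = A by apply/seteqP; split => [x []//|x Ax]; split => //; case: Ax.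
have muO : (mu (O `&` I) <= (m * e)%:E)%E.
  apply: (@le_trans _ _ (mu (O `\` N) + mu N)%E).
    apply: le_trans (measureU2 _ _ _) => //; last exact: measurableD.
    have mOI : measurable (O `&` I) by apply: measurableI => //; exact: measurable_I01.
    have mU : measurable ((O `\` N) `|` N) by apply: measurableU => //; exact: measurableD.
    apply: le_measure; rewrite ?inE//; do ?[exact: mOI|exact: mU].
    by move=> x [Ox _]; case: (pselect (N x)) => Nx; [right|left].
  by rewrite [X in (_ + X)%E]N0 adde0 ltW.
rewrite -[mu A]fineK ?lee_fin; last by rewrite -AI; exact: fA.
rewrite -AI -(ler_pM2l m0) (le_trans le1)//.
by rewrite -lee_fin fineK//; exact: fA.
Unshelve. all: by end_near. Qed.
End Reparametrization.

(** * Inversion and normalization of arc length *)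

Section ArcLength.
Variable R : realType.
Local Notation I := (@I01 R).

Definition expanding (m : R) (F : R -> R) : Prop :=
  forall s t, I01c s -> I01c t -> s <= t -> m * (t - s) <= F t - F s.

Lemma lip_ge0 K (F : R -> R) : lip K F -> 0 <= K.
Proof.
by move=> /(_ 1 0 (I01c1 R) (I01c0 R)); rewrite subr0 normr1 mulr1; apply: le_trans.
Qed.

Lemma primitive_ge (g : R -> R) (C m s t : R) : measurable_fun setT g ->
  (forall u, `|g u| <= C) -> (forall u, m <= g u) -> 0 <= s -> s <= t ->
  m * (t - s) <= primitive g t - primitive g s.
Proof.
move=> mg gC gm s0 st; rewrite (primitiveB mg gC)//.
have mC (u : R) : `|m| <= `|m| by [].
have -> : m * (t - s) = \int[lebesgue_measure]_(u in `]s, t]) m.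
  rewrite Rintegral_cst// [X in fine X]lebesgue_measure_itv/= lte_fin.
  move: st; rewrite le_eqVlt => /predU1P[->|st]; first by rewrite ltxx subrr.
  by rewrite st.
apply: le_Rintegral => //.
- exact: (bounded_integrable_itv (measurable_cst m) mC s t false false).
- exact: (bounded_integrable_itv mg gC s t false false).
Qed.

Lemma expanding_I01c m (F : R -> R) s : 0 < m -> expanding m F -> F 0 = 0 -> F 1 = 1 ->
  I01c s -> I01c (F s).
Proof.
move=> m0 eF F0 F1 Is; move: (Is); rewrite /I01c /= !in_itv/= => /andP[s0 s1].
have := eF _ _ (I01c0 R) Is s0; have := eF _ _ Is (I01c1 R) s1.
have := mulr_ge0 (ltW m0) s0.
have : 0 <= m * (1 - s) by rewrite mulr_ge0 ?subr_ge0// ltW.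
by rewrite F0 F1; move=> *; apply/andP; split; lra.
Qed.


(** Expansion gives injectivity and the intermediate value theorem surjectivity; the upper and lower
    slope bounds exchange roles for the inverse. *)
Lemma expanding_inverse K m (phi : R -> R) : lip K phi -> 0 < m -> expanding m phi ->
  phi 0 = 0 -> phi 1 = 1 -> exists psi : R -> R,
  [/\ [/\ lip m^-1 psi, expanding K^-1 psi, psi 0 = 0 & psi 1 = 1],
      forall s, I01c s -> psi (phi s) = s & forall t, I01c t -> phi (psi t) = t].
Proof.
move=> lphi m0 ephi phi0 phi1.
have K0 : 0 < K.
  have := lphi 1 0 (I01c1 R) (I01c0 R); rewrite phi0 phi1 subr0 normr1 mulr1.
  exact: lt_le_trans.
have cphi : {within `[0, 1], continuous phi}.
  pose Phi x := phi (clamp x).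
  have cPhi : continuous Phi.
    move=> x; apply/cvgrPdist_le => e e0; near=> y.
    apply: (le_trans (lphi _ _ (clamp_I01c _) (clamp_I01c _))).
    have xy : `|clamp x - clamp y| <= `|x - y|.
      case: (leP x y) => [xy|/ltW yx].
        by rewrite distrC [leRHS]distrC; have /andP[h1 h2] := clamp_lip xy; rewrite !ger0_norm//; lra.
      by have /andP[h1 h2] := clamp_lip yx; rewrite !ger0_norm//; lra.
    apply: (@le_trans _ _ (K * `|x - y|)); first by rewrite ler_wpM2l// ltW.
    by rewrite -ler_pdivlMl//; near: y; apply: cvgr_dist_le => //; rewrite mulr_gt0 ?invr_gt0.
  apply: (@subspace_eq_continuous _ _ _ Phi); last exact: continuous_subspaceT.
  by move=> x /set_mem xI; rewrite /Phi /from_subspace/= clamp_id.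
have ex t : exists s, I01c t -> I01c s /\ phi s = t.
  case: (pselect (I01c t)) => [It|nI]; last by exists 0.
  have [|s sI st] := @IVT R phi 0 1 t ler01 cphi.
    by move: It; rewrite /I01c /= in_itv/= phi0 phi1 min_l// max_r.
  by exists s => _; split => //; rewrite /I01c /=.
pose psi t := sval (cid (ex t)).
have psiP t : I01c t -> I01c (psi t) /\ phi (psi t) = t by rewrite /psi; case: cid.
have phic s := expanding_I01c (s := s) m0 ephi phi0 phi1.
have inj s t : I01c s -> I01c t -> phi s = phi t -> s = t.
  wlog st : s t / s <= t.
    by move=> W Is It E; case: (leP s t) => [|/ltW] h; [|apply/esym]; apply: W.
  move=> Is It E; have := ephi _ _ Is It st; rewrite E subrr pmulr_rle0// subr_le0 => ts.
  by apply/eqP; rewrite eq_le st.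
have psiK s : I01c s -> psi (phi s) = s.
  by move=> Is; have [h1 h2] := psiP _ (phic _ Is); apply: inj.
have mono s t : I01c s -> I01c t -> phi s <= phi t -> s <= t.
  move=> Is It h; rewrite leNgt; apply/negP => ts.
  have := ephi _ _ It Is (ltW ts); have : 0 < m * (s - t) by rewrite mulr_gt0 ?subr_gt0.
  lra.
have base s t : I01c s -> I01c t -> s <= t ->
   [/\ psi s <= psi t, m * (psi t - psi s) <= t - s & t - s <= K * (psi t - psi s)].
  move=> Is It st; have [Ips Es] := psiP _ Is; have [Ipt Et] := psiP _ It.
  have pst : psi s <= psi t by apply: mono => //; rewrite Es Et.
  split => //; first by have := ephi _ _ Ips Ipt pst; rewrite Es Et.
  have := lphi _ _ Ipt Ips; rewrite Es Et !ger0_norm ?subr_ge0//.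
exists psi; split.
- split.
  + move=> s t Is It; wlog st : s t Is It / t <= s.
      by move=> W; case: (leP t s) => [|/ltW] h; [|rewrite distrC [`|s - t|]distrC]; apply: W.
    have [p1 p2 _] := base _ _ It Is st.
    by rewrite !ger0_norm ?subr_ge0// mulrC ler_pdivlMr// mulrC.
  + move=> s t Is It st; have [p1 _ p2] := base _ _ Is It st.
    by rewrite mulrC ler_pdivrMr// mulrC.
  + by rewrite -[X in psi X]phi0 psiK//; exact: I01c0.
  + by rewrite -[X in psi X]phi1 psiK//; exact: I01c1.
- exact: psiK.
- by move=> t /psiP[].
Unshelve. all: by end_near. Qed.

Lemma Lip01_dpath (xi : R -> R * R) : Lip01 xi ->
  [/\ abounded (fun t => (dpath xi t).1), abounded (fun t => (dpath xi t).2) &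
   ae01 (fun t => is_derive t 1 (fun s => (xi s).1) (dpath xi t).1 /\
                  is_derive t 1 (fun s => (xi s).2) (dpath xi t).2)].
Proof.
move=> /Lip01P[K [l1 l2]].
have [b1 _ d1] := lip_derive1 l1; have [b2 _ d2] := lip_derive1 l2.
by split => //; exact: ae01_and.
Qed.

Lemma abounded_vdot (x y : R -> R * R) :
  abounded (fun t => (x t).1) -> abounded (fun t => (x t).2) ->
  abounded (fun t => (y t).1) -> abounded (fun t => (y t).2) ->
  abounded (fun t => vdot (x t) (y t)).
Proof. by move=> x1 x2 y1 y2; apply: aboundedD; exact: aboundedM. Qed.

Lemma lip_scaled_primitive (sigma : R -> R) (m C : R) : abounded sigma ->
  0 < m -> ae01 (fun t => m <= sigma t) -> 0 < C ->
  exists phi K, [/\ lip K phi, expanding (m / C) phi, phi 0 = 0, phi 1 = Int01 sigma / C &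
    ae01 (fun t => is_derive t 1 phi (sigma t / C))].
Proof.
move=> bs m0 ms C0.
have [g [D [mg gD sg]]] := bs.
(* Raising the representative to m changes it on a null set only and makes its primitive expanding
   everywhere. *)
pose g' u := Num.max (g u) m.
have mg' : measurable_fun setT g' by apply: measurable_maxr.
have g'D u : `|g' u| <= D + m.
  have := gD u; rewrite /g' !ler_norml => /andP[h1 h2].
  have D0 : 0 <= D by apply: le_trans (gD u).
  by case: (leP (g u) m) => ?; apply/andP; split; lra.
have sg' : ae01 (fun t => sigma t = g' t).
  by apply: (ae01_mp2 sg ms) => t _ -> h; rewrite /g' max_l.
have g'm u : m <= g' u by rewrite /g' le_max lexx orbT.
exists (fun t => primitive g' t / C), ((D + m) / C); split.
- move=> s t Is It; rewrite -mulrBl normrM normfV (gtr0_norm C0) mulrAC ler_pM2r ?invr_gt0//.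
  exact: (primitive_lip mg' g'D).
- move=> s t Is It st; rewrite -mulrBl mulrAC ler_pM2r ?invr_gt0//.
  by apply: (primitive_ge mg' g'D) => //; move: Is; rewrite /I01c /= in_itv/= => /andP[].
- by rewrite primitive0 mul0r.
- by rewrite (primitive1 mg' g'D) (Int_ae sg').
apply: (ae01_mp2 (primitive_derive_ae mg' g'D) sg') => t _ dt ->.
have -> : (fun t => primitive g' t / C) = (C^-1 \*: (primitive g')).
  by apply/funext => x; rewrite mulrC.
by rewrite mulrC; exact: is_deriveZ.
Qed.

(** Preimages of null sets under the expanding map [psi] are null, and [phi] after [psi] is the
    identity. *)
Lemma ae01_comp_inverse (phi psi : R -> R) (K m : R) (P : R -> Prop) :
  lip K psi -> 0 < m -> expanding m psi -> psi 0 = 0 -> psi 1 = 1 ->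
  (forall t, I01c t -> phi (psi t) = t) ->
  ae01 (fun s => P (phi s)) -> ae01 P.
Proof.
move=> lpsi m0 epsi psi0 psi1 phiK aP.
apply: (ae01_mp (ae01_comp_expanding lpsi m0 epsi psi0 psi1 aP)) => t It.
by rewrite phiK//; exact: I01W.
Qed.

(** In the proof [phi] is normalized arc length, [psi] its inverse, and [zeta] is [xi] after [psi].
    The lower bound on the speed makes [phi] expanding, so that null sets can be carried in both
    directions. Positive homogeneity of F in the velocity makes its integral independent of the
    parametrization. *)
Lemma constant_speed (xi : R -> R * R) (m : R) : Lip01 xi -> 0 < m ->
  ae01 (fun t => m <= vnorm (dpath xi t)) ->
  exists (zeta : R -> R * R) (l : R),
  [/\ Lip01 zeta, zeta 0 = xi 0, zeta 1 = xi 1, 0 < l &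
    ae01 (fun t => vdot (dpath zeta t) (dpath zeta t) = l ^+ 2)] /\
   ((forall P : R * R -> Prop, (forall t, I01c t -> P (xi t)) -> forall t, I01c t -> P (zeta t))
    /\ forall F : R * R -> R * R -> R,
      (forall x p k, 0 < k -> F x (vscale k p) = k * F x p) ->
      abounded (fun t => F (zeta t) (dpath zeta t)) ->
      Int01 (fun t => F (zeta t) (dpath zeta t)) = Int01 (fun t => F (xi t) (dpath xi t))).
Proof.
move=> Lxi m0 xim.
have [b1 b2 dxi] := Lip01_dpath Lxi.
pose sigma t := vnorm (dpath xi t).
have bs : abounded sigma by apply: abounded_sqrt; apply: abounded_vdot.
pose l := Int01 sigma.
have ml : m <= l by rewrite -(Int_cst m); apply: Int_le => //; exact: abounded_cst.
have l0 : 0 < l by apply: lt_le_trans ml.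
have [phi [K [lphi ephi phi0 phi1 dphi]]] := lip_scaled_primitive bs m0 xim l0.
have {}phi1 : phi 1 = 1 by rewrite phi1 divff// gt_eqF.
have c0 : 0 < m / l by rewrite divr_gt0.
have [psi [[lpsi epsi psi0 psi1] psiK phiK]] := expanding_inverse lphi c0 ephi phi0 phi1.
have K0 : 0 < K.
  have := lphi 1 0 (I01c1 R) (I01c0 R); rewrite phi0 phi1 subr0 normr1 mulr1.
  exact: lt_le_trans.
have Kv0 : 0 < K^-1 by rewrite invr_gt0.
have psiI t : I01c t -> I01c (psi t) by exact: (expanding_I01c Kv0 epsi psi0 psi1).
pose zeta t := xi (psi t).
have Lzeta : Lip01 zeta.
  move: Lxi => [C HC]; exists (C * (m / l)^-1) => s t Is It.
  have C0 : 0 <= C.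
    have := HC 1 0 (I01c1 R) (I01c0 R); rewrite subr0 normr1 mulr1.
    exact: le_trans (vnorm_ge0 _).
  apply: (le_trans (HC _ _ (psiI _ Is) (psiI _ It))).
  by rewrite -mulrA ler_wpM2l//; exact: lpsi.
have dzeta : ae01 (fun s => [/\ 0 < sigma s, is_derive s 1 phi (sigma s / l) &
    dpath zeta (phi s) = vscale (l / sigma s) (dpath xi s)]).
  apply: (ae01_mp2 (ae01_and dxi dphi) xim) => s Is [[d1 d2] dp] ms.
  have s0 : 0 < sigma s by apply: lt_le_trans ms.
  split => //.
  have dpsi : is_derive (phi s) 1 psi (sigma s / l)^-1.
    apply: (is_derive_inverse _ _ dp); last by rewrite mulf_neq0 ?invr_eq0 ?gt_eqF.
      by apply: near_I01 Is _ => u /I01W; exact: psiK.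
    by apply: near_I01 Is _ => u Iu; exact: lip_near_continuous lphi Iu.
  rewrite invf_div in dpsi.
  have psis : psi (phi s) = s by rewrite psiK//; exact: I01W.
  rewrite -psis in d1 d2.
  have e1 := is_derive1_derive1 (is_derive1_comp d1 dpsi).
  have e2 := is_derive1_derive1 (is_derive1_comp d2 dpsi).
  rewrite psis in e1 e2.
  rewrite /dpath /vscale /=; congr (_, _); rewrite mulrC; [exact: e1|exact: e2].
exists zeta, l; split; first split => //.
- by rewrite /zeta psi0.
- by rewrite /zeta psi1.
- apply: (ae01_comp_inverse lpsi Kv0 epsi psi0 psi1 phiK).
  apply: (ae01_mp dzeta) => s _ [s0 _ ->].
  rewrite -sqr_vnorm vnorm_vscale -/(sigma s) ger0_norm ?divr_ge0 ?(ltW l0) ?(ltW s0)//.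
  by rewrite divfK// gt_eqF.
split; first by move=> P HP t It; apply: HP; exact: psiI.
move=> F homF bF.
(* Change of variables: a primitive [H] of the integrand along [zeta], composed with [phi], is
   Lipschitz, has the integrand along [xi] as derivative, and has the same total increment. *)
have [H [C [lH H0 H1 dH]]] := abounded_primitive bF.
have dHphi := ae01_comp_expanding lphi c0 ephi phi0 phi1 dH.
have phiI s : I01c s -> I01c (phi s) by exact: (expanding_I01c c0 ephi phi0 phi1).
have lHphi : lip (C * K) (H \o phi).
  move=> s t Is It; apply: (le_trans (lH _ _ (phiI _ Is) (phiI _ It))).
  rewrite -mulrA ler_wpM2l ?lphi//; exact: lip_ge0 lH.
have [_ iHphi _] := lip_derive1 lHphi.
have -> : Int01 (fun t => F (zeta t) (dpath zeta t)) = Int01 (derive1 (H \o phi)).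
  by rewrite iHphi /= phi1 phi0 H0 H1 subr0.
apply: Int_ae; apply: (ae01_mp2 dHphi dzeta) => s Is dHs [s0 dps dzs].
rewrite (is_derive1_derive1 (is_derive1_comp dHs dps)) dzs homF ?divr_gt0//.
rewrite /zeta psiK; last exact: I01W.
by field; rewrite !gt_eqF.
Qed.

End ArcLength.

(** * Smooth functions and Taylor expansions *)

Lemma measurable_inv (R : realType) : measurable_fun setT (fun x : R => x^-1).
Proof.
rewrite -(setUv [set 0]); apply/measurable_funU.
- exact: measurable_set1.
- by apply: measurableC; exact: measurable_set1.
split; first exact: measurable_fun_set1.
apply: open_continuous_measurable_fun.
  rewrite openC; exact: (accessible_closed_set1 (hausdorff_accessible (@Rhausdorff R))).
by move=> x /set_mem/= /eqP x0; exact: inv_continuous.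
Qed.

Section SmoothFunctions.
Variables (R : realType) (n : nat).
Local Notation V := 'rV[R]_n.+1.
Local Notation I := (@I01 R).
Variable U : set V.

(** Coordinates 0 and 1 will hold the position and are continuous; the others, such as velocity and
    multiplier, are only measurable. *)
Definition tame_path (z : R -> V) : Prop :=
  (forall i : 'I_n.+1, (i < 2)%N -> forall t, I t -> {for t, continuous (fun t => z t 0 i)}) /\
  (forall i : 'I_n.+1, measurable_fun I (fun t => z t 0 i)).

(** Measurability is required along tame paths only: this is what integrands need, and it passes
    through sums, products, inverses and roots without a measurable structure on the state space. *)
Definition tame (g : V -> R) : Prop :=
  (forall y, U y -> {for y, continuous g}) /\
  (forall z, tame_path z -> measurable_fun I (g \o z)).

(** The directional derivative is required to be the linear form with coefficients [G], so that the
    calculus rules reduce to one-variable rules along lines. *)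
Fixpoint smooth (k : nat) (g : V -> R) : Prop :=
  tame g /\
  match k with
  | 0 => True
  | k'.+1 => exists G : 'I_n.+1 -> V -> R, (forall i, smooth k' (G i)) /\
      forall y, U y -> forall h, is_derive y h g (\sum_i h 0 i * G i y)
  end.

Lemma is_derive_line (g : V -> R) (y h : V) (a : R) :
  is_derive y h g a <-> is_derive (0 : R) 1 (fun s => g (y + s *: h)) a.
Proof.
have E : (fun s : R => s^-1 *: (((fun s => g (y + s *: h)) \o shift 0) (s *: (1 : R)) -
     (fun s => g (y + s *: h)) 0)) = (fun s => s^-1 *: ((g \o shift y) (s *: h) - g y)).
  by apply/funext => s /=; rewrite scale0r !addr0 [y + _]addrC [s *: (1 : R)]mulr1.
split=> -[d <-]; split.
- by rewrite /derivable E.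
- by rewrite /derive E.
- by rewrite /derivable -E.
- by rewrite /derive -E.
Qed.


Lemma smooth_tame k g : smooth k g -> tame g.
Proof. by case: k => [|k] []. Qed.

Lemma smoothS k g : smooth k.+1 g -> smooth k g.
Proof.
elim: k g => [|k IH] g [tg [G [sG dG]]]; split => //.
by exists G; split => // i; exact: IH.
Qed.

Lemma eq_smooth k f g : f =1 g -> smooth k f -> smooth k g.
Proof. by move=> /funext ->. Qed.

Lemma tame_cst c : tame (fun=> c).
Proof. by split => [y _|z _]; [exact: cst_continuous|exact: measurable_cst]. Qed.

Lemma tameD f g : tame f -> tame g -> tame (fun y => f y + g y).
Proof.
move=> [cf mf] [cg mg]; split => [y Uy|z tz].
  exact: (cvgD (cf y Uy) (cg y Uy)).
by apply: (measurable_funD (f := f \o z) (g := g \o z)); [exact: mf|exact: mg].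
Qed.

Lemma tameM f g : tame f -> tame g -> tame (fun y => f y * g y).
Proof.
move=> [cf mf] [cg mg]; split => [y Uy|z tz].
  exact: (cvgM (cf y Uy) (cg y Uy)).
by apply: (measurable_funM (f := f \o z) (g := g \o z)); [exact: mf|exact: mg].
Qed.

Lemma tame_inv g : tame g -> (forall y, U y -> g y != 0) -> tame (fun y => (g y)^-1).
Proof.
move=> [cg mg] g0; split => [y Uy|z tz]; first exact: (cvgV (g0 y Uy) (cg y Uy)).
exact: (measurableT_comp (@measurable_inv R) (mg z tz)).
Qed.

Lemma tame_sqrt g : tame g -> tame (fun y => Num.sqrt (g y)).
Proof.
move=> [cg mg]; split => [y Uy|z tz].
  by apply: (continuous_comp (cg y Uy)); exact: sqrt_continuous.
apply: (measurableT_comp (f := @Num.sqrt R)); last exact: mg.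
by apply: continuous_measurable_fun; exact: sqrt_continuous.
Qed.

Lemma smooth_cst k c : smooth k (fun=> c).
Proof.
elim: k c => [|k IH] c; split => //; try exact: tame_cst.
exists (fun _ _ => 0); split => // y _ h.
by rewrite big1 => [|i _]; [exact: is_derive_cst|rewrite mulr0].
Qed.

Lemma smooth_coord k i : smooth k (fun y => y 0 i).
Proof.
have tc : tame (fun y => y 0 i).
  by split => [y _|z [_ mz]]; [exact: coord_continuous|exact: mz].
case: k => [|k]; split => //.
exists (fun j _ => (j == i)%:R); split => [j|y _ h]; first exact: smooth_cst.
apply/is_derive_line.
have -> : (fun s => (y + s *: h) 0 i) = cst (y 0 i) + (h 0 i \*: (@id R)).
  by apply/funext => s; rewrite !mxE mulrC.
apply: is_derive_eq.
rewrite add0r (bigD1 i)//= eqxx mulr1 big1 ?addr0; first exact: mulr1.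
by move=> j /negbTE ->; rewrite mulr0.
Qed.

Lemma smoothD k f g : smooth k f -> smooth k g -> smooth k (fun y => f y + g y).
Proof.
elim: k f g => [|k IH] f g [tf sf] [tg sg]; split => //; try exact: tameD.
move: sf sg => [F [sF dF]] [G [sG dG]].
exists (fun i y => F i y + G i y); split => [i|y Uy h].
  by apply: IH; [exact: sF|exact: sG].
under eq_bigr do rewrite mulrDr.
by rewrite big_split /=; apply: is_deriveD; [exact: dF|exact: dG].
Qed.

Lemma smoothM k f g : smooth k f -> smooth k g -> smooth k (fun y => f y * g y).
Proof.
elim: k f g => [|k IH] f g sf sg.
  by split => //; apply: tameM; [exact: smooth_tame sf|exact: smooth_tame sg].
have sf' := smoothS sf; have sg' := smoothS sg.
move: sf sg => [tf [F [sF dF]]] [tg [G [sG dG]]].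
split; first exact: tameM.
exists (fun i y => f y * G i y + F i y * g y); split => [i|y Uy h].
  by apply: smoothD; apply: IH => //; [exact: sG|exact: sF].
apply: (is_derive_eq (is_deriveM (dF _ Uy h) (dG _ Uy h))).
rewrite /GRing.scale/= !mulr_sumr -big_split/=; apply: eq_bigr => i _.
by rewrite mulrDr; congr (_ + _); ring.
Qed.

Lemma smoothN k f : smooth k f -> smooth k (fun y => - f y).
Proof.
move=> sf; apply: (eq_smooth _ (smoothM (smooth_cst k (-1)) sf)) => y.
by rewrite mulN1r.
Qed.

Lemma smoothB k f g : smooth k f -> smooth k g -> smooth k (fun y => f y - g y).
Proof. by move=> sf /smoothN; exact: smoothD. Qed.

Lemma is_derive_compose (phi : R -> R) (g : V -> R) (y h : V) (a b : R) :
  is_derive y h g a -> is_derive (g y) 1 phi b -> is_derive y h (phi \o g) (b * a).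
Proof.
move=> /is_derive_line dg dphi; apply/is_derive_line.
rewrite -[g y](_ : g (y + 0 *: h) = _) in dphi; last by rewrite scale0r addr0.
exact: (is_derive1_comp dphi dg).
Qed.

Lemma smooth_inv k g : smooth k g -> (forall y, U y -> g y != 0) -> smooth k (fun y => (g y)^-1).
Proof.
move=> sg g0; elim: k sg => [|k IH] sg.
  by split => //; apply: tame_inv => //; exact: smooth_tame sg.
have siv := IH (smoothS sg).
move: sg => [tg [G [sG dG]]]; split; first exact: tame_inv.
exists (fun i y => - (G i y * ((g y)^-1 * (g y)^-1))); split => [i|y Uy h].
  by apply: smoothN; apply: smoothM; [exact: sG|exact: smoothM].
have dinv : is_derive (g y) 1 (fun x : R => x^-1) (- (g y) ^- 2).
  apply: (is_derive_eq (is_deriveV (g0 _ Uy) (is_derive_id (g y) 1))).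
  exact: mulr1.
apply: (is_derive_eq (is_derive_compose (dG _ Uy h) dinv)).
rewrite mulr_sumr; apply: eq_bigr => i _.
by rewrite expr2 invfM; ring.
Qed.

Lemma smooth_sqrt k g : smooth k g -> (forall y, U y -> 0 < g y) ->
  smooth k (fun y => Num.sqrt (g y)).
Proof.
move=> sg g0; elim: k sg => [|k IH] sg.
  by split => //; apply: tame_sqrt => //; exact: smooth_tame sg.
have sq := IH (smoothS sg).
move: sg => [tg [G [sG dG]]]; split; first exact: tame_sqrt.
exists (fun i y => G i y * (2 * Num.sqrt (g y))^-1); split => [i|y Uy h].
  apply: smoothM; first exact: sG.
  apply: smooth_inv.
    by apply: smoothM => //; exact: smooth_cst.
  by move=> y Uy; rewrite mulf_neq0 ?pnatr_eq0// gt_eqF// sqrtr_gt0 g0.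
apply: (is_derive_eq (is_derive_compose (dG _ Uy h) (is_derive1_sqrt (g0 _ Uy)))).
by rewrite mulr_sumr; apply: eq_bigr => i _; ring.
Qed.

End SmoothFunctions.

(** * Linearity of directional derivatives *)

Section DirectionalDerivatives.
Variable R : realType.
Implicit Types (x h : R * R).

Lemma mvt0 (F F' : R -> R) (b : R) : (forall r : R, is_derive r 1 F (F' r)) ->
  exists2 c, `|c| <= `|b| & F b - F 0 = F' c * b.
Proof.
move=> dF.
have cF : continuous F.
  by move=> r; apply: differentiable_continuous; apply/derivable1_diffP; case: (dF r).
have [b0|b0|->] := ltgtP b 0; last by exists 0; rewrite ?subrr ?mulr0.
  have [c] := MVT b0 (fun r _ => dF r) (continuous_subspaceT cF).
  rewrite in_itv/= => /andP[bc c0] E; exists c; first by rewrite !ltr0_norm// lerN2 ltW.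
  by rewrite -opprB E; ring.
have [c] := MVT b0 (fun r _ => dF r) (continuous_subspaceT cF).
rewrite in_itv/= => /andP[c0 cb] E; exists c; first by rewrite !gtr0_norm// ltW.
by rewrite E subr0.
Qed.

Definition ddirR (g : R * R -> R) x h : R := derive1 (fun s => g (vadd x (vscale s h))) 0.

Definition ddirR_ex (g : R * R -> R) : Prop :=
  forall x h, derivable (fun s : R => g (vadd x (vscale s h))) 0 1.

Lemma is_derive_ddirR g x h (r : R) : ddirR_ex g ->
  is_derive r 1 (fun s => g (vadd x (vscale s h))) (ddirR g (vadd x (vscale r h)) h).
Proof.
move=> dg.
have D0 : is_derive (r - r) 1 (fun s => g (vadd (vadd x (vscale r h)) (vscale s h)))
    (ddirR g (vadd x (vscale r h)) h).
  by rewrite subrr; apply: DeriveDef; [exact: dg|rewrite /ddirR derive1E].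
have -> : (fun s => g (vadd x (vscale s h))) =
  (fun s => g (vadd (vadd x (vscale r h)) (vscale s h))) \o (fun s => s - r).
  by apply/funext => s /=; congr g; rewrite /vadd /vscale /=; congr pair; ring.
have Ds : is_derive r 1 (fun s : R => s - r) 1 by apply: is_derive_eq; rewrite subr0.
exact: (is_derive_eq (@is_derive1_comp R _ (fun s => s - r) r _ _ D0 Ds) (mulr1 _)).
Qed.

(** [Ck] provides directional derivatives without linearity in the direction. The increment along h
    is split into a move along each axis; each part is a partial derivative at a nearby point times
    its step, and the partials are continuous. *)
Lemma ddirR_linear g x h : ddirR_ex g ->
  continuous (fun x => ddirR g x (1, 0)) -> continuous (fun x => ddirR g x (0, 1)) ->
  ddirR g x h = h.1 * ddirR g x (1, 0) + h.2 * ddirR g x (0, 1).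
Proof.
move=> dg c1 c2; rewrite /ddirR derive1E; apply: cvg_lim; first exact: Rhausdorff.
apply/cvgrPdist_le => e e0.
pose e' := e / (`|h.1| + `|h.2| + 1).
have e'0 : 0 < e' by rewrite divr_gt0// ltr_wpDl// addr_ge0.
have /cvgrPdist_le/(_ _ e'0)/nbhs_ballP[d1 /= d10 H1] := c1 x.
have /cvgrPdist_le/(_ _ e'0)/nbhs_ballP[d2 /= d20 H2] := c2 x.
near=> s.
have s0 : s != 0 by near: s; exact: nbhs_dnbhs_neq.
have sd1 : `|s| * (`|h.1| + `|h.2| + 1) < d1.
  rewrite -ltr_pdivlMr; last by rewrite ltr_wpDl// addr_ge0.
  near: s; apply: dnbhs0_lt; rewrite divr_gt0// ltr_wpDl// addr_ge0//.
have sd2 : `|s| * (`|h.1| + `|h.2| + 1) < d2.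
  rewrite -ltr_pdivlMr; last by rewrite ltr_wpDl// addr_ge0.
  near: s; apply: dnbhs0_lt; rewrite divr_gt0// ltr_wpDl// addr_ge0//.
have [a ha Ea] := mvt0 (s * h.1) (fun r => is_derive_ddirR (x.1, x.2 + s * h.2) (1, 0) r dg).
have [b hb Eb] := mvt0 (s * h.2) (fun r => is_derive_ddirR x (0, 1) r dg).
move: ha hb; rewrite !normrM => ha hb.
pose A := ddirR g (vadd (x.1, x.2 + s * h.2) (vscale a (1, 0))) (1, 0).
pose B := ddirR g (vadd x (vscale b (0, 1))) (0, 1).
have AE : `|ddirR g x (1, 0) - A| <= e'.
  apply: H1; split; rewrite /ball/= /vadd/vscale/= ?mulr1 ?mulr0 ?addr0 opprD addNKr normrN.
    apply: le_lt_trans sd1; apply: (le_trans ha); rewrite ler_wpM2l//.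
    by rewrite -addrA lerDl addr_ge0.
  rewrite normrM; apply: le_lt_trans sd1; rewrite ler_wpM2l//.
  by rewrite addrAC lerDr addr_ge0.
have BE : `|ddirR g x (0, 1) - B| <= e'.
  apply: H2; split; rewrite /ball/= /vadd/vscale/= ?mulr1 ?mulr0 ?addr0 ?subrr ?normr0//.
  rewrite opprD addNKr normrN.
  apply: le_lt_trans sd2; apply: (le_trans hb); rewrite ler_wpM2l//.
  by rewrite addrAC lerDr addr_ge0.
rewrite /= addr0.
have -> : g (vadd x (vscale (s *: (1 : R)) h)) - g (vadd x (vscale 0 h)) =
   A * (s * h.1) + B * (s * h.2).
  rewrite -Ea -Eb [s *: _]mulr1 /vadd /vscale /= !mulr0 !mul0r !mulr1 !addr0.
  by ring.
have -> : h.1 * ddirR g x (1, 0) + h.2 * ddirR g x (0, 1) -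
    s^-1 *: (A * (s * h.1) + B * (s * h.2)) =
  h.1 * (ddirR g x (1, 0) - A) + h.2 * (ddirR g x (0, 1) - B).
  by rewrite /GRing.scale/=; field.
apply: (le_trans (ler_normD _ _)); rewrite !normrM.
have -> : e = (`|h.1| + `|h.2| + 1) * e'.
  by rewrite /e' mulrC divfK// gt_eqF// ltr_wpDl// addr_ge0.
rewrite mulrDl mulrDl mul1r; apply: ler_wpDr; first exact: ltW.
by rewrite lerD// ler_wpM2l.
Unshelve. all: by end_near. Qed.

End DirectionalDerivatives.

(** * Travel time and Lagrangian density as functions of the state *)

Section StateSpace.
Variable R : realType.
Local Notation V := 'rV[R]_6.
Local Notation I := (@I01 R).

Definition i0 : 'I_6 := @Ordinal 6 0 isT.
Definition i1 : 'I_6 := @Ordinal 6 1 isT.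
Definition i2 : 'I_6 := @Ordinal 6 2 isT.
Definition i3 : 'I_6 := @Ordinal 6 3 isT.
Definition i4 : 'I_6 := @Ordinal 6 4 isT.
Definition i5 : 'I_6 := @Ordinal 6 5 isT.

Lemma big_ord6 (F : 'I_6 -> R) : \sum_i F i = F i0 + F i1 + F i2 + F i3 + F i4 + F i5.
Proof.
rewrite !big_ord_recl big_ord0 addr0 !addrA.
by do ![congr (_ + _)]; congr F; exact: val_inj.
Qed.

Lemma ord6_ind (P : 'I_6 -> Prop) : P i0 -> P i1 -> P i2 -> P i3 -> P i4 -> P i5 ->
  forall i, P i.
Proof.
move=> H0 H1 H2 H3 H4 H5 [[|[|[|[|[|[|m]]]]]] Hm] //.
- by rewrite (_ : Ordinal Hm = i0) //; exact: val_inj.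
- by rewrite (_ : Ordinal Hm = i1) //; exact: val_inj.
- by rewrite (_ : Ordinal Hm = i2) //; exact: val_inj.
- by rewrite (_ : Ordinal Hm = i3) //; exact: val_inj.
- by rewrite (_ : Ordinal Hm = i4) //; exact: val_inj.
- by rewrite (_ : Ordinal Hm = i5) //; exact: val_inj.
Qed.

(* A state y = (x, p, lambda, L) collects position, velocity, multiplier and length. *)
Definition pos (y : V) : R * R := (y 0 i0, y 0 i1).
Definition vel (y : V) : R * R := (y 0 i2, y 0 i3).
Definition moving : set V := [set y | vel y != vzero R].

Lemma continuous_pos : continuous pos.
Proof.
move=> y; have c i : (fun z : V => z 0 i) @ y --> y 0 i by exact: coord_continuous.
exact: (cvg_pair (c i0) (c i1)).
Qed.

Lemma smooth_pos_Ck (k : nat) (g : R * R -> R * R) : Ck k g ->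
  smooth moving k (fun y => (g (pos y)).1) /\ smooth moving k (fun y => (g (pos y)).2).
Proof.
have T (f : R * R -> R) : continuous f -> tame moving (f \o pos).
  move=> cf; split => [y _|z [cz _]].
    have cy : {for y, continuous pos} by exact: continuous_pos.
    by apply: (continuous_comp cy); exact: cf.
  apply: open_continuous_measurable_fun; first exact: interval_open.
  move=> t /set_mem It; have ct : {for t, continuous (pos \o z)}.
    exact: (cvg_pair (cz i0 isT t It) (cz i1 isT t It)).
  by apply: (continuous_comp ct); exact: cf.
have cfst (g' : R * R -> R * R) : continuous g' -> continuous (fun x => (g' x).1).
  move=> cg x; have cgx : {for x, continuous g'} by exact: cg.
  by apply: (continuous_comp cgx); exact: cvg_fst.
have csnd (g' : R * R -> R * R) : continuous g' -> continuous (fun x => (g' x).2).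
  move=> cg x; have cgx : {for x, continuous g'} by exact: cg.
  by apply: (continuous_comp cgx); exact: cvg_snd.
elim: k g => [|k IH] g; first by move=> cg; split; (split; last exact: Logic.I); [exact: (T _ (cfst _ cg))|exact: (T _ (csnd _ cg))].
move=> [cg [dg Cg]].
have cd h : continuous (fun x => ddir g x h) by have := Cg h; case: (k) => [|k'] /=; [|case].
have [sa1 sa2] := IH _ (Cg (1, 0)); have [sb1 sb2] := IH _ (Cg (0, 1)).
have line (f : R * R -> R) : ddirR_ex f -> continuous (fun x => ddirR f x (1, 0)) ->
    continuous (fun x => ddirR f x (0, 1)) -> forall y h, is_derive y h (f \o pos)
      (h 0 i0 * ddirR f (pos y) (1, 0) + h 0 i1 * ddirR f (pos y) (0, 1)).
  move=> df ca cb y h; apply/is_derive_line.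
  rewrite -(ddirR_linear (pos y) (pos h) df ca cb).
  have -> : (fun s => (f \o pos) (y + s *: h)) =
      (fun s => f (vadd (pos y) (vscale s (pos h)))).
    by apply/funext => s; rewrite /pos /vadd /vscale /= !mxE.
  by apply: DeriveDef; [exact: df|rewrite /ddirR derive1E].
split; split; [exact: (T _ (cfst _ cg))| |exact: (T _ (csnd _ cg))|].
- exists (fun i y => if i == i0 then (ddir g (pos y) (1, 0)).1 else
            if i == i1 then (ddir g (pos y) (0, 1)).1 else 0); split.
    by apply: ord6_ind => //=; exact: smooth_cst.
  move=> y _ h; rewrite big_ord6 /= !mulr0 !addr0.
  apply: (line (fun x => (g x).1)); first by move=> x h'; have [] := dg x h'.
    exact: (cfst _ (cd (1, 0))).
  exact: (cfst _ (cd (0, 1))).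
- exists (fun i y => if i == i0 then (ddir g (pos y) (1, 0)).2 else
            if i == i1 then (ddir g (pos y) (0, 1)).2 else 0); split.
    by apply: ord6_ind => //=; exact: smooth_cst.
  move=> y _ h; rewrite big_ord6 /= !mulr0 !addr0.
  apply: (line (fun x => (g x).2)); first by move=> x h'; have [] := dg x h'.
    exact: (csnd _ (cd (1, 0))).
  exact: (csnd _ (cd (0, 1))).
Qed.

Section TravelTime.
Variables (vbar : R) (w : R * R -> R * R).
Hypotheses (v0 : 0 < vbar) (Cw : Ck 3 w) (wv : forall x, vnorm (w x) < vbar).

Lemma vdot_w_lt x : 0 < vbar ^+ 2 - vdot (w x) (w x).
Proof. by rewrite subr_gt0 -sqr_vnorm ltr_pXn2r// ?nnegrE ?vnorm_ge0// ltW. Qed.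

Lemma vdot_gt0 (p : R * R) : p != vzero R -> 0 < vdot p p.
Proof.
move=> p0; rewrite lt_def vdot_ge0 andbT; apply: contra p0.
rewrite /vdot -!expr2 paddr_eq0 ?sqr_ge0// !sqrf_eq0.
by case: p => a b /= /andP[/eqP-> /eqP->].
Qed.

Definition tau (y : V) : R := ff vbar w (pos y) (vel y).

(** The denominator is positive since the wind is slower than the aircraft; the radicand is positive
    as long as the velocity is nonzero, hence the domain [moving]. *)
Lemma smooth_tau : smooth moving 3 tau.
Proof.
have [s1 s2] := smooth_pos_Ck Cw.
have sp := smooth_coord (R := R) moving 3.
pose D (y : V) := (y 0 i2 * (w (pos y)).1 + y 0 i3 * (w (pos y)).2) ^+ 2 +
  (vbar ^+ 2 - vdot (w (pos y)) (w (pos y))) * (y 0 i2 * y 0 i2 + y 0 i3 * y 0 i3).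
have sa : smooth moving 3 (fun y => vbar ^+ 2 -
    ((w (pos y)).1 * (w (pos y)).1 + (w (pos y)).2 * (w (pos y)).2)).
  by apply: smoothB; [exact: smooth_cst|apply: smoothD; exact: smoothM].
have sd : smooth moving 3 (fun y => y 0 i2 * (w (pos y)).1 + y 0 i3 * (w (pos y)).2).
  by apply: smoothD; apply: smoothM => //; exact: sp.
have sD : smooth moving 3 (fun y => Num.sqrt (D y)).
  apply: smooth_sqrt; last first.
    move=> y My; apply: ltr_wpDl; first exact: sqr_ge0.
    by apply: mulr_gt0; [exact: vdot_w_lt|exact: (vdot_gt0 My)].
  apply: smoothD.
    apply: (eq_smooth _ (smoothM sd sd)) => y; exact: expr2.
  apply: smoothM; first exact: sa.
  by apply: smoothD; apply: smoothM; exact: sp.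
apply: (@eq_smooth _ _ _ _ (fun y => (- (y 0 i2 * (w (pos y)).1 + y 0 i3 * (w (pos y)).2) +
   Num.sqrt (D y)) * (vbar ^+ 2 - ((w (pos y)).1 * (w (pos y)).1 +
   (w (pos y)).2 * (w (pos y)).2))^-1)) => //.
apply: smoothM; first by apply: smoothD => //; exact: smoothN.
by apply: smooth_inv => // y _; rewrite gt_eqF// vdot_w_lt.
Qed.

(** Density of the Lagrangian: F is the integral of its first differential and F' of its second. *)
Definition lagr (y : V) : R := tau y +
  y 0 i4 * (y 0 i2 * y 0 i2 + y 0 i3 * y 0 i3 - y 0 i5 * y 0 i5).

Lemma smooth_lagr : smooth moving 3 lagr.
Proof.
have sp := smooth_coord (R := R) moving 3.
apply: smoothD; first exact: smooth_tau.
apply: smoothM; first exact: sp.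
by apply: smoothB; [apply: smoothD|]; apply: smoothM; exact: sp.
Qed.

End TravelTime.
End StateSpace.

(** * Third order jets, compact tubes and Taylor estimates *)

Section Jets.
Variables (R : realType) (n : nat).
Local Notation V := 'rV[R]_n.+1.
Local Notation J := 'I_n.+1.
Implicit Types (y z h d : V).

(** In this norm a multilinear form is bounded by its largest coefficient. *)
Definition snorm h : R := \sum_i `|h 0 i|.

Lemma snorm_ge0 h : 0 <= snorm h.
Proof. by apply: sumr_ge0. Qed.

Lemma le_snorm h i : `|h 0 i| <= snorm h.
Proof. by rewrite /snorm (bigD1 i)//= lerDl sumr_ge0. Qed.

Lemma snormD h d : snorm (h + d) <= snorm h + snorm d.
Proof. by rewrite /snorm -big_split/=; apply: ler_sum => i _; rewrite mxE ler_normD. Qed.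

Lemma snormZ (s : R) h : snorm (s *: h) = `|s| * snorm h.
Proof. by rewrite /snorm mulr_sumr; apply: eq_bigr => i _; rewrite mxE normrM. Qed.


Lemma near_snorm y (P : V -> Prop) : (\forall z \near y, P z) ->
  exists2 e : R, 0 < e & forall z, snorm (z - y) < e -> P z.
Proof.
move=> /nbhs_ballP[e /= e0 H]; exists e => // z zy; apply: H; split => // i j.
rewrite [i]ord1; rewrite /ball/= distrC.
by have := le_snorm (z - y) j; rewrite !mxE => /le_lt_trans; apply.
Qed.

Lemma near_of_snorm y (e : R) : 0 < e -> \forall z \near y, snorm (z - y) < e.
Proof.
move=> e0; apply/nbhs_ballP.
exists (e / n.+2%:R); first by rewrite /= divr_gt0.
move=> z yz; rewrite /snorm.
apply: (@le_lt_trans _ _ (\sum_(i < n.+1) (e / n.+2%:R))).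
  apply: ler_sum => i _; rewrite !mxE distrC; apply: ltW.
  by have := yz.2 0 i.
rewrite sumr_const card_ord -[X in X < _]mulr_natr mulrAC ltr_pdivrMr// ltr_pM2l//.
by rewrite ltr_nat.
Qed.

(** Near-covering form of compactness: a radius valid at one center serves, halved, all nearby
    centers. *)
Lemma compact_uniform (K U : set V) (G : V -> R) (e : R) : compact K -> open U -> K `<=` U ->
  (forall y, U y -> {for y, continuous G}) -> 0 < e ->
  exists2 r : R, 0 < r & forall y, K y -> forall z, snorm (z - y) < r ->
    U z /\ `|G z - G y| <= e.
Proof.
move=> cK oU KU cG e0.
have e20 : 0 < e / 2 by rewrite divr_gt0.
pose P (r : R) y := forall z, snorm (z - y) < r -> U z /\ `|G z - G y| <= e.
have := (compact_near_coveringP K).1 cK _ (0^'+ : set_system R) P _.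
case.
  move=> y Ky.
  have : \forall z \near y, U z /\ `|G y - G z| <= e / 2.
    apply: filterI; first by apply: open_nbhs_nbhs; split => //; exact: KU.
    by have /cvgrPdist_le/(_ _ e20) := cG _ (KU _ Ky).
  move=> /near_snorm[r r0 Hr].
  exists ([set z | snorm (z - y) < r / 2], [set s : R | s < r / 2]).
    split; first by apply: near_of_snorm; rewrite divr_gt0.
    by apply: nbhs_right_lt; rewrite divr_gt0.
  move=> [x s] /= [xy sr] z zx.
  have zy : snorm (z - y) < r.
    have -> : z - y = (z - x) + (x - y) by rewrite addrA subrK.
    apply: (le_lt_trans (snormD _ _)); rewrite (splitr r) ltrD//.
    exact: lt_trans sr.
  have xy' : snorm (x - y) < r by rewrite (lt_trans xy)// ltr_pdivrMr// ltr_pMr// ltr1n.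
  have [Uz Gz] := Hr _ zy; have [_ Gx] := Hr _ xy'; split => //.
  have -> : G z - G x = (G y - G x) - (G y - G z) by ring.
  by rewrite (splitr e) (le_trans (ler_normB _ _))// lerD.
move=> r /= r0 Hr; have r20 : 0 < r / 2 by rewrite divr_gt0.
have rr : `|0 - r / 2| < r.
  by rewrite sub0r normrN gtr0_norm// ltr_pdivrMr// ltr_pMr// ltr1n.
by exists (r / 2) => //; exact: (Hr (r / 2) rr r20).
Qed.

Lemma compact_bounded_fun (K U : set V) (G : V -> R) : compact K -> open U -> K `<=` U ->
  (forall y, U y -> {for y, continuous G}) ->
  exists2 C : R, 0 < C & forall y, K y -> `|G y| <= C.
Proof.
move=> cK oU KU cG; case: (pselect (K !=set0)) => [|K0]; last first.
  by exists 1 => // y Ky; exfalso; apply: K0; exists y.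
move=> K0.
pose P (r : R) y := `|G y| <= r^-1.
have := (compact_near_coveringP K).1 cK _ (0^'+ : set_system R) P _.
case.
  move=> y Ky.
  have : \forall z \near y, `|G y - G z| <= 1.
    by have /cvgrPdist_le/(_ _ ltr01) := cG _ (KU _ Ky).
  move=> Hy.
  exists ([set z | `|G y - G z| <= 1], [set s : R | 0 < s /\ s < (`|G y| + 1)^-1]).
    split; first exact: Hy.
    apply: filterI; first exact: nbhs_right_gt.
    by apply: nbhs_right_lt; rewrite invr_gt0 ltr_wpDl.
  move=> [x s] /= [xy [s0 sr]]; rewrite /P /=.
  have -> : G x = G y - (G y - G x) by ring.
  apply: (le_trans (ler_normB _ _)); apply: (@le_trans _ _ (`|G y| + 1)); first by rewrite lerD2l.
  by rewrite -[leLHS]invrK lef_pV2 ?posrE ?invr_gt0 ?ltr_wpDl// ltW.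
move=> r /= r0 Hr; have r20 : 0 < r / 2 by rewrite divr_gt0.
have rr : `|0 - r / 2| < r.
  by rewrite sub0r normrN gtr0_norm// ltr_pdivrMr// ltr_pMr// ltr1n.
by exists (r / 2)^-1; [rewrite invr_gt0|exact: (Hr (r / 2) rr r20)].
Qed.


Section MeanValue.

Lemma mvt_ball (F F' : R -> R) (b : R) : `|b| <= 1 ->
  (forall s : R, `|s| <= 1 -> is_derive s 1 F (F' s)) ->
  exists2 c, `|c| <= `|b| & F b - F 0 = F' c * b.
Proof.
move=> b1 dF.
have cF (x y : R) : -1 <= x -> y <= 1 -> {within `[x, y], continuous F}.
  move=> x1 y1; apply: continuous_in_subspaceT => s; rewrite inE/= in_itv/= => /andP[xs sy].
  apply: differentiable_continuous; apply/derivable1_diffP.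
  by have [] := dF s; first by rewrite ler_norml; apply/andP; split; lra.
have [b0|b0|->] := ltgtP b 0; last by exists 0; rewrite ?subrr ?mulr0.
  have dF' s : s \in `]b, 0[ -> is_derive s 1 F (F' s).
    rewrite in_itv/= => /andP[bs s0]; apply: dF.
    by move: b1; rewrite !ltr0_norm//; lra.
  have cF' : {within `[b, 0], continuous F}.
    by apply: cF => //; move: b1; rewrite ltr0_norm//; lra.
  have [c] := MVT b0 dF' cF'.
  rewrite in_itv/= => /andP[bc c0] E; exists c; first by rewrite !ltr0_norm// lerN2 ltW.
  by rewrite -opprB E; ring.
have dF' s : s \in `]0, b[ -> is_derive s 1 F (F' s).
  rewrite in_itv/= => /andP[s0 sb]; apply: dF.
  by move: b1; rewrite !gtr0_norm//; lra.
have cF' : {within `[0, b], continuous F}.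
  by apply: cF => //; move: b1; rewrite gtr0_norm//; lra.
have [c] := MVT b0 dF' cF'.
rewrite in_itv/= => /andP[c0 cb] E; exists c; first by rewrite !gtr0_norm// ltW.
by rewrite E subr0.
Qed.

End MeanValue.

Section Forms.
Variables (U : set V) (g : V -> R).
Hypothesis oU : open U.

(** [smooth] hides the derivatives behind existential quantifiers; the record fixes one choice of
    them, so that they can be integrated and compared. *)
Record jets := Jets {
  G1 : J -> V -> R; G2 : J -> J -> V -> R; G3 : J -> J -> J -> V -> R;
  G0_tame : tame U g; G1_tame : forall i, tame U (G1 i);
  G2_tame : forall i j, tame U (G2 i j); G3_tame : forall i j k, tame U (G3 i j k);
  G0_derive : forall y h, U y -> is_derive y h g (\sum_i h 0 i * G1 i y);
  G1_derive : forall i y h, U y -> is_derive y h (G1 i) (\sum_j h 0 j * G2 i j y);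
  G2_derive : forall i j y h, U y -> is_derive y h (G2 i j) (\sum_k h 0 k * G3 i j k y)
}.

Lemma smooth_jets : smooth U 3 g -> {j : jets | True}.
Proof.
move=> [tg /cid[A [sA dA]]].
have /(_ _)/cid HB i : exists B : J -> V -> R, (forall j, smooth U 1 (B j)) /\
    forall y, U y -> forall h, is_derive y h (A i) (\sum_j h 0 j * B j y).
  by have [_] := sA i.
pose B i := sval (HB i).
have sB i : forall j, smooth U 1 (B i j) by rewrite /B; case: (HB i) => ? [].
have dB i : forall y, U y -> forall h, is_derive y h (A i) (\sum_j h 0 j * B i j y).
  by rewrite /B; case: (HB i) => ? [].
have /(_ _ _)/cid HC i j : exists C : J -> V -> R, (forall k, smooth U 0 (C k)) /\
    forall y, U y -> forall h, is_derive y h (B i j) (\sum_k h 0 k * C k y).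
  by have [_] := sB i j.
pose C i j := sval (HC i j).
have sC i j : forall k, smooth U 0 (C i j k) by rewrite /C; case: (HC i j) => ? [].
have dC i j : forall y, U y -> forall h, is_derive y h (B i j) (\sum_k h 0 k * C i j k y).
  by rewrite /C; case: (HC i j) => ? [].
by exists (@Jets A B C tg (fun i => (sA i).1) (fun i j => (sB i j).1)
  (fun i j k => (sC i j k).1) (fun y h Uy => dA y Uy h)
  (fun i y h Uy => dB i y Uy h) (fun i j y h Uy => dC i j y Uy h)).
Qed.

Variable jt : jets.

(** In these forms the rightmost argument is the direction of the first differentiation, usually the
    test direction; the symmetry of [D2] is a separate fact. *)
Definition D1 y d : R := \sum_i d 0 i * G1 jt i y.
Definition D2 y h d : R := \sum_i d 0 i * \sum_j h 0 j * G2 jt i j y.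
Definition D3 y (e : V) h d : R :=
  \sum_i d 0 i * \sum_j h 0 j * \sum_k e 0 k * G3 jt i j k y.

Lemma is_derive_sum_coef (m : nat) (c : 'I_m -> R) (F : 'I_m -> R -> R) (F' : 'I_m -> R) (s : R) :
  (forall i, is_derive s 1 (F i) (F' i)) ->
  is_derive s 1 (fun s => \sum_i c i * F i s) (\sum_i c i * F' i).
Proof.
move=> dF.
have -> : (fun s => \sum_i c i * F i s) = \sum_i (c i \*: F i).
  by apply/funext => x; rewrite fct_sumE.
apply: is_derive_sum => i; exact: (is_deriveZ (c i) (dF i)).
Qed.

Lemma is_derive_shift_line (f : V -> R) y h (s a : R) :
  is_derive (y + s *: h) h f a -> is_derive s 1 (fun r => f (y + r *: h)) a.
Proof.
move=> /is_derive_line df.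
have -> : (fun r => f (y + r *: h)) =
   (fun r => f (y + s *: h + r *: h)) \o (fun r => r - s).
  by apply/funext => r /=; rewrite scalerBl -addrA [s *: h + _]addrC subrK.
have Ds : is_derive s 1 (fun r : R => r - s) 1 by apply: is_derive_eq; rewrite subr0.
rewrite -[X in is_derive X _ _ _](subrr s) in df.
exact: (is_derive_eq (@is_derive1_comp R _ (fun r => r - s) s _ _ df Ds) (mulr1 _)).
Qed.

Lemma is_derive_G0_line y h (s : R) : U (y + s *: h) ->
  is_derive s 1 (fun r => g (y + r *: h)) (D1 (y + s *: h) h).
Proof. by move=> Uy; apply: is_derive_shift_line; exact: G0_derive. Qed.

Lemma is_derive_D1_line y h d (s : R) : U (y + s *: h) ->
  is_derive s 1 (fun r => D1 (y + r *: h) d) (D2 (y + s *: h) h d).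
Proof.
move=> Uy; apply: is_derive_sum_coef => i.
by apply: is_derive_shift_line; exact: G1_derive.
Qed.

Lemma is_derive_D2_line y (e : V) h d (s : R) : U (y + s *: e) ->
  is_derive s 1 (fun r => D2 (y + r *: e) h d) (D3 (y + s *: e) e h d).
Proof.
move=> Uy; apply: is_derive_sum_coef => i; apply: is_derive_sum_coef => j.
by apply: is_derive_shift_line; exact: G2_derive.
Qed.

Lemma D2Zl y (s : R) h d : D2 y (s *: h) d = s * D2 y h d.
Proof.
rewrite /D2 mulr_sumr; apply: eq_bigr => i _; rewrite [RHS]mulrCA.
by congr (_ * _); rewrite mulr_sumr; apply: eq_bigr => j _; rewrite mxE mulrA.
Qed.

Lemma D2Dl y h h' d : D2 y (h + h') d = D2 y h d + D2 y h' d.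
Proof.
rewrite /D2 -big_split/=; apply: eq_bigr => i _; rewrite -mulrDr -big_split/=.
by congr (_ * _); apply: eq_bigr => j _; rewrite mxE mulrDl.
Qed.

Lemma D2Zr y (s : R) h d : D2 y h (s *: d) = s * D2 y h d.
Proof. by rewrite /D2 mulr_sumr; apply: eq_bigr => i _; rewrite mxE mulrA. Qed.


Lemma le_form (c : J -> R) d (C : R) : (forall i, `|c i| <= C) ->
  `|\sum_i d 0 i * c i| <= C * snorm d.
Proof.
move=> cC; apply: (le_trans (ler_norm_sum _ _ _)); rewrite mulr_sumr.
by apply: ler_sum => i _; rewrite normrM mulrC ler_wpM2r.
Qed.


Lemma le_D2 y h d (C : R) : (forall i j, `|G2 jt i j y| <= C) ->
  `|D2 y h d| <= C * snorm h * snorm d.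
Proof. by move=> HC; apply: le_form => i; exact: le_form. Qed.

Lemma le_D3 y (e : V) h d (C : R) : (forall i j k, `|G3 jt i j k y| <= C) ->
  `|D3 y e h d| <= C * snorm e * snorm h * snorm d.
Proof. by move=> HC; apply: le_form => i; apply: le_form => j; exact: le_form. Qed.

Lemma le_D3B y z (e : V) h d (C : R) : (forall i j k, `|G3 jt i j k z - G3 jt i j k y| <= C) ->
  `|D3 z e h d - D3 y e h d| <= C * snorm e * snorm h * snorm d.
Proof.
move=> HC.
have -> : D3 z e h d - D3 y e h d = \sum_i d 0 i * \sum_j h 0 j * \sum_k e 0 k *
   (G3 jt i j k z - G3 jt i j k y).
  rewrite /D3 -sumrB; apply: eq_bigr => i _; rewrite -mulrBr; congr (_ * _).
  rewrite -sumrB; apply: eq_bigr => j _; rewrite -mulrBr; congr (_ * _).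
  by rewrite -sumrB; apply: eq_bigr => k _; rewrite -mulrBr.
by apply: le_form => i; apply: le_form => j; exact: le_form.
Qed.

Lemma common_radius (T : finType) (P : T -> R -> Prop) :
  (forall i r r', r' <= r -> P i r -> P i r') ->
  (forall i, exists2 r : R, 0 < r & P i r) -> exists2 r : R, 0 < r & forall i, P i r.
Proof.
move=> mP eP.
have [r r0 Hr] : exists2 r : R, 0 < r & forall i, i \in enum T -> P i r.
  elim: (enum T) => [|i s [r r0 Hr]]; first by exists 1.
  have [r' r'0 Hr'] := eP i; exists (Num.min r r'); first by rewrite lt_min r0.
  move=> j; rewrite inE => /predU1P[->|js].
    by apply: mP Hr'; rewrite ge_min lexx orbT.
  by apply: mP (Hr j js); rewrite ge_min lexx.
by exists r => // i; apply: Hr; rewrite mem_enum.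
Qed.

Lemma common_bound (T : finType) (P : T -> R -> Prop) :
  (forall i r r', r <= r' -> P i r -> P i r') ->
  (forall i, exists2 r : R, 0 < r & P i r) -> exists2 r : R, 0 < r & forall i, P i r.
Proof.
move=> mP eP.
pose Q i r := 0 < r -> P i r^-1.
have mQ i r r' : r' <= r -> Q i r -> Q i r'.
  move=> r'r H r'0; apply: (mP i r^-1); last by apply: H; exact: lt_le_trans r'r.
  by rewrite lef_pV2 ?posrE//; exact: lt_le_trans r'r.
have eQ i : exists2 r, 0 < r & Q i r.
  by have [r r0 Hr] := eP i; exists r^-1; rewrite /Q ?invr_gt0// invrK.
have [r r0 Hr] := common_radius mQ eQ.
by exists r^-1; [rewrite invr_gt0|move=> i; exact: Hr].
Qed.

Section Tube.
Variable K : set V.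
Hypotheses (cK : compact K) (KU : K `<=` U).

Lemma tame_tube (T : finType) (F : T -> V -> R) : (forall i, tame U (F i)) ->
  exists r C : R, [/\ 0 < r, 0 < C & forall y, K y -> forall z, snorm (z - y) < r ->
    U z /\ forall i, `|F i z| <= C].
Proof.
move=> tF.
have [C C0 HC] := @common_bound T (fun i C => forall y, K y -> `|F i y| <= C)
  (fun i r r' rr' H y Ky => le_trans (H y Ky) rr')
  (fun i => compact_bounded_fun cK oU KU (tF i).1).
have [r r0 Hr] := @common_radius T (fun i r => forall y, K y -> forall z, snorm (z - y) < r ->
    U z /\ `|F i z - F i y| <= 1)
  (fun i r r' rr' H y Ky z zr => H y Ky z (lt_le_trans zr rr'))
  (fun i => compact_uniform cK oU KU (tF i).1 ltr01).
have [r' r'0 Hr'] := compact_uniform cK oU KU (G0_tame jt).1 ltr01.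
exists (Num.min r r'), (C + 1); split; [by rewrite lt_min r0|by rewrite addr_gt0|].
move=> y Ky z; rewrite lt_min => /andP[zr zr']; split; first by have [] := Hr' y Ky z zr'.
move=> i; have [_ Fi] := Hr i y Ky z zr.
have -> : F i z = F i y + (F i z - F i y) by ring.
by apply: (le_trans (ler_normD _ _)); rewrite lerD// HC.
Qed.

Lemma jets_tube : exists r C : R, [/\ 0 < r, 0 < C & forall y, K y -> forall z, snorm (z - y) < r ->
  [/\ U z, `|g z| <= C, forall i, `|G1 jt i z| <= C, forall i j, `|G2 jt i j z| <= C &
     forall i j k, `|G3 jt i j k z| <= C]].
Proof.
have [r0 [C0 [r00 C00 H0]]] := @tame_tube unit (fun=> g) (fun=> G0_tame jt).
have [r1 [C1 [r10 C10 H1]]] := @tame_tube _ (G1 jt) (G1_tame jt).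
have [r2 [C2 [r20 C20 H2]]] := @tame_tube _ (fun p : J * J => G2 jt p.1 p.2)
  (fun p => G2_tame jt p.1 p.2).
have [r3 [C3 [r30 C30 H3]]] := @tame_tube _ (fun p : J * J * J => G3 jt p.1.1 p.1.2 p.2)
  (fun p => G3_tame jt p.1.1 p.1.2 p.2).
exists (Num.min (Num.min r0 r1) (Num.min r2 r3)), (C0 + C1 + C2 + C3); split.
- by rewrite !lt_min r00 r10 r20.
- by rewrite !addr_gt0.
move=> y Ky z; rewrite !lt_min => /andP[/andP[z0 z1] /andP[z2 z3]].
have [Uz g0] := H0 y Ky z z0; have [_ g1] := H1 y Ky z z1.
have [_ g2] := H2 y Ky z z2; have [_ g3] := H3 y Ky z z3.
have [L0 L1 L2 L3] : [/\ C0 <= C0 + C1 + C2 + C3, C1 <= C0 + C1 + C2 + C3,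
  C2 <= C0 + C1 + C2 + C3 & C3 <= C0 + C1 + C2 + C3] by clear -C00 C10 C20 C30; split; lra.
split => //.
- exact: le_trans (g0 tt) L0.
- by move=> i; exact: le_trans (g1 i) L1.
- by move=> i j; exact: le_trans (g2 (i, j)) L2.
- by move=> i j k; exact: le_trans (g3 (i, j, k)) L3.
Qed.

Lemma D3_uniform (e : R) : 0 < e -> exists2 r : R, 0 < r & forall y, K y ->
  forall z, snorm (z - y) < r -> U z /\
  forall (f : V) h d, `|D3 z f h d - D3 y f h d| <= e * snorm f * snorm h * snorm d.
Proof.
move=> e0.
have [r r0 Hr] := @common_radius (J * J * J)%type
  (fun p r => forall y, K y -> forall z, snorm (z - y) < r ->
    U z /\ `|G3 jt p.1.1 p.1.2 p.2 z - G3 jt p.1.1 p.1.2 p.2 y| <= e)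
  (fun i r r' rr' H y Ky z zr => H y Ky z (lt_le_trans zr rr'))
  (fun p => compact_uniform cK oU KU (G3_tame jt p.1.1 p.1.2 p.2).1 e0).
exists r => // y Ky z zr; split; first by have [] := Hr (0, 0, 0) y Ky z zr.
by move=> f h d; apply: le_D3B => i j k; have [] := Hr (i, j, k) y Ky z zr.
Qed.

End Tube.

Section Taylor.
Variables (C : R) (y : V) (r : R).
Hypothesis HC : forall z, snorm (z - y) < r ->
  [/\ U z, `|g z| <= C, forall i, `|G1 jt i z| <= C, forall i j, `|G2 jt i j z| <= C &
     forall i j k, `|G3 jt i j k z| <= C].

Lemma snorm_segment z h (s : R) : snorm (z - y) + snorm h < r -> `|s| <= 1 ->
  snorm (z + s *: h - y) < r.
Proof.
move=> zhr s1; apply: le_lt_trans zhr; rewrite addrAC; apply: (le_trans (snormD _ _)).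
by rewrite lerD2l snormZ ler_piMl// snorm_ge0.
Qed.

Lemma taylor_D2 z h f d : snorm (z - y) + snorm h < r ->
  `|D2 (z + h) f d - D2 z f d| <= C * snorm h * snorm f * snorm d.
Proof.
move=> zhr.
have dF (s : R) : `|s| <= 1 -> is_derive s 1 (fun s => D2 (z + s *: h) f d) (D3 (z + s *: h) h f d).
  by move=> s1; apply: is_derive_D2_line; have [] := HC (snorm_segment zhr s1).
have n1 : `|1 : R| <= 1 by rewrite normr1.
have [c c1] := mvt_ball n1 dF.
rewrite normr1 in c1; rewrite scale1r scale0r addr0 mulr1 => ->.
by apply: le_D3; have [] := HC (snorm_segment zhr c1).
Qed.

Lemma taylor_D1 z h d : snorm (z - y) + snorm h < r ->
  `|D1 (z + h) d - D1 z d - D2 z h d| <= C * snorm h ^+ 2 * snorm d.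
Proof.
move=> zhr.
have C0 : 0 <= C.
  have zr : snorm (z - y) < r by apply: le_lt_trans zhr; rewrite lerDl snorm_ge0.
  have [_ g0 _ _ _] := HC zr.
  exact: le_trans (normr_ge0 _) g0.
have dF (s : R) : `|s| <= 1 -> is_derive s 1 (fun s => D1 (z + s *: h) d) (D2 (z + s *: h) h d).
  by move=> s1; apply: is_derive_D1_line; have [] := HC (snorm_segment zhr s1).
have n1 : `|1 : R| <= 1 by rewrite normr1.
have [c c1] := mvt_ball n1 dF.
rewrite normr1 in c1; rewrite scale1r scale0r addr0 mulr1 => ->.
have ch : snorm (c *: h) <= snorm h by rewrite snormZ ler_piMl// snorm_ge0.
have zch : snorm (z - y) + snorm (c *: h) < r by apply: le_lt_trans zhr; rewrite lerD2l.
apply: (le_trans (taylor_D2 h d zch)).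
rewrite expr2 mulrA ler_wpM2r ?snorm_ge0// ler_wpM2r ?snorm_ge0//.
by rewrite ler_wpM2l.
Qed.

Lemma taylor_D0 z h : snorm (z - y) + snorm h < r ->
  `|g (z + h) - g z - D1 z h| <= C * snorm h ^+ 2.
Proof.
move=> zhr.
have C0 : 0 <= C.
  have zr : snorm (z - y) < r by apply: le_lt_trans zhr; rewrite lerDl snorm_ge0.
  have [_ g0 _ _ _] := HC zr.
  exact: le_trans (normr_ge0 _) g0.
have dF (s : R) : `|s| <= 1 -> is_derive s 1 (fun s => g (z + s *: h)) (D1 (z + s *: h) h).
  by move=> s1; apply: is_derive_G0_line; have [] := HC (snorm_segment zhr s1).
have n1 : `|1 : R| <= 1 by rewrite normr1.
have [c c1] := mvt_ball n1 dF.
rewrite normr1 in c1; rewrite scale1r scale0r addr0 mulr1 => ->.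
have dF1 (s : R) : `|s| <= 1 -> is_derive s 1 (fun s => D1 (z + s *: h) h) (D2 (z + s *: h) h h).
  by move=> s1; apply: is_derive_D1_line; have [] := HC (snorm_segment zhr s1).
have cle : `|c| <= 1 by [].
have [c' c'1] := mvt_ball cle dF1.
rewrite scale0r addr0 => ->; rewrite normrM.
have c'1' : `|c'| <= 1 by apply: le_trans c1.
apply: (@le_trans _ _ (`|D2 (z + c' *: h) h h|)); first by rewrite ler_piMr.
rewrite expr2 mulrA; apply: le_D2; have [] := HC (snorm_segment zhr c'1') => //.
Qed.

End Taylor.

(** Third derivatives are continuous but need not be Lipschitz, so the remainder is not cubic in h;
    it is quadratic with a constant e as small as desired, uniformly over K. *)
Lemma taylor_D2_uniform (K : set V) (e : R) : compact K -> K `<=` U -> 0 < e ->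
  exists2 r : R, 0 < r & forall y, K y -> forall h d (s : R), snorm h < r -> `|s| <= 1 ->
    `|D2 (y + s *: h) h d - D2 y h d - s * D3 y h h d| <= e * snorm h ^+ 2 * snorm d.
Proof.
move=> cK KU e0; have [r r0 Hr] := D3_uniform cK KU e0.
have [r' [C [r'0 _ HC]]] := jets_tube cK KU.
exists (Num.min (Num.min r r') 1); first by rewrite !lt_min r0 r'0 ltr01.
move=> y Ky h d s; rewrite !lt_min => /andP[/andP[hr hr'] h1] s1.
have tr (c : R) (q : R) : `|c| <= 1 -> snorm h < q -> snorm (y + c *: h - y) < q.
  by move=> c1 hq; rewrite addrAC subrr add0r snormZ (le_lt_trans _ hq)// ler_piMl// snorm_ge0.
have dF (c : R) : `|c| <= 1 -> is_derive c 1 (fun s => D2 (y + s *: h) h d) (D3 (y + c *: h) h h d).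
  by move=> c1; apply: is_derive_D2_line; have [] := Hr y Ky _ (tr c r c1 hr).
have [c cs] := mvt_ball s1 dF; rewrite scale0r addr0 => ->.
have c1 : `|c| <= 1 by apply: le_trans s1.
rewrite mulrC -mulrBr normrM.
have [_ /(_ h h d) H] := Hr y Ky _ (tr c r c1 hr).
apply: (@le_trans _ _ (`|D3 (y + c *: h) h h d - D3 y h h d|)); first by rewrite ler_piMl.
by rewrite expr2 mulrA.
Qed.

End Forms.

End Jets.

Section Schwarz.
Variables (R : realType) (n : nat).
Local Notation V := 'rV[R]_n.+1.
Variables (U : set V) (g : V -> R) (oU : open U) (jt : jets U g).
Implicit Types (y h d : V).

(* Both mixed second differences over a small parallelogram are values of D2 nearby. *)
Lemma D2_exchange y h d : (forall s t : R, `|s| <= 1 -> `|t| <= 1 -> U (y + s *: h + t *: d)) ->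
  exists s t : R, [/\ `|s| <= 1, `|t| <= 1 &
   g (y + h + d) - g (y + h) - g (y + d) + g y = D2 jt (y + s *: h + t *: d) d h].
Proof.
move=> HU.
have n1 : `|1 : R| <= 1 by rewrite normr1.
have n0 : `|0 : R| <= 1 by rewrite normr0.
pose F r := g (y + d + r *: h) - g (y + r *: h).
have dF (r : R) : `|r| <= 1 -> is_derive r 1 F (D1 jt (y + d + r *: h) h - D1 jt (y + r *: h) h).
  move=> r1; apply: is_deriveB; apply: is_derive_G0_line.
    by have := HU r 1 r1 n1; rewrite scale1r addrAC.
  by have := HU r 0 r1 n0; rewrite scale0r addr0.
have [s s1] := mvt_ball n1 dF; rewrite normr1 in s1; rewrite mulr1 => E1.
have dG (r : R) : `|r| <= 1 -> is_derive r 1 (fun r => D1 jt (y + s *: h + r *: d) h)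
    (D2 jt (y + s *: h + r *: d) d h).
  by move=> r1; apply: is_derive_D1_line; exact: HU.
have [t t1] := mvt_ball n1 dG; rewrite normr1 in t1; rewrite mulr1 => E2.
exists s, t; split => //; rewrite -E2 scale0r addr0 scale1r.
rewrite [y + s *: h + d]addrAC -E1 /F !scale1r !scale0r !addr0 [y + d + h]addrAC.
by ring.
Qed.

Lemma D2_sym y h d : U y -> D2 jt y h d = D2 jt y d h.
Proof.
move=> Uy; apply/eqP; rewrite -subr_eq0 -normr_le0; apply/ler_addgt0Pr => e e0.
rewrite add0r.
have sU : [set y] `<=` U by move=> _ ->.
have [r [C [r0 C0 HC]]] := jets_tube oU jt (@compact_set1 _ y) sU.
have {}HC := HC y erefl.
pose M := snorm h + snorm d; have M0 : 0 <= M by rewrite addr_ge0// snorm_ge0.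
(* The first bound keeps the parallelogram in the ball of radius r, the second makes the two
   variations of [D2] over it add up to at most e; the summands 1 keep the denominators positive. *)
pose s := Num.min (r / (M + 1)) (e / (2 * C * M * snorm h * snorm d + 1)).
have D0 : 0 < 2 * C * M * snorm h * snorm d + 1.
  by rewrite ltr_wpDl// !mulr_ge0// ?snorm_ge0// ltW.
have s0 : 0 < s by rewrite lt_min !divr_gt0// ltr_wpDl.
have sr : s * M < r.
  apply: (@le_lt_trans _ _ (r / (M + 1) * M)); first by rewrite ler_wpM2r// ge_min lexx.
  by rewrite mulrAC ltr_pdivrMr ?ltr_wpDl// ltr_pM2l// ltrDl.
have se : s * (2 * C * M * snorm h * snorm d) <= e.
  apply: (@le_trans _ _ (e / (2 * C * M * snorm h * snorm d + 1) * (2 * C * M * snorm h * snorm d))).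
    rewrite ler_wpM2r ?ge_min ?lexx ?orbT// !mulr_ge0// ?snorm_ge0//; exact: ltW.
  by rewrite mulrAC ler_pdivrMr// ler_pM2l// lerDl.
have small (a b : R) : `|a| <= 1 -> `|b| <= 1 -> snorm (a *: (s *: h) + b *: (s *: d)) <= s * M.
  move=> a1 b1; apply: (le_trans (snormD _ _)); rewrite !snormZ (gtr0_norm s0) /M mulrDr.
  by rewrite lerD// ler_piMl// mulr_ge0 ?snorm_ge0 ?(ltW s0).
have HU (a b : R) : `|a| <= 1 -> `|b| <= 1 -> U (y + a *: (s *: h) + b *: (s *: d)).
  move=> a1 b1; have [] // := HC (y + a *: (s *: h) + b *: (s *: d)).
  by rewrite -[X in snorm (X - _)]addrA [y + _]addrC addrK (le_lt_trans (small _ _ a1 b1)).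
have HU' (a b : R) : `|a| <= 1 -> `|b| <= 1 -> U (y + a *: (s *: d) + b *: (s *: h)).
  by move=> a1 b1; rewrite addrAC; exact: HU.
have [a [b [a1 b1 E1]]] := D2_exchange HU.
have [b' [a' [b'1 a'1 E2]]] := D2_exchange HU'.
have E : D2 jt (y + a *: (s *: h) + b *: (s *: d)) d h =
         D2 jt (y + b' *: (s *: d) + a' *: (s *: h)) h d.
  have : s * (s * D2 jt (y + a *: (s *: h) + b *: (s *: d)) d h) =
         s * (s * D2 jt (y + b' *: (s *: d) + a' *: (s *: h)) h d).
    move: E1 E2; rewrite !D2Zl !D2Zr => <- <-.
    by rewrite [y + s *: d + s *: h]addrAC; ring.
  by do 2!move/(mulfI (lt0r_neq0 s0)).
have near_D2 (p q : R) (f k : V) : `|p| <= 1 -> `|q| <= 1 ->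
  `|D2 jt (y + p *: (s *: h) + q *: (s *: d)) f k - D2 jt y f k| <= C * (s * M) * snorm f * snorm k.
  move=> an bn; rewrite -addrA.
  have := @taylor_D2 _ _ _ _ jt C y r HC y (p *: (s *: h) + q *: (s *: d)) f k.
  rewrite subrr (_ : snorm 0 = 0) ?add0r; last first.
    by rewrite -(scale0r (0 : V)) snormZ normr0 mul0r.
  move=> /(_ (le_lt_trans (small _ _ an bn) sr)) /le_trans; apply.
  by rewrite !ler_wpM2r ?snorm_ge0// ler_wpM2l ?small// ltW.
have N1 := near_D2 a b d h a1 b1.
have N2 := near_D2 a' b' h d a'1 b'1.
rewrite E in N1; rewrite addrAC in N2.
have -> : D2 jt y h d - D2 jt y d h =
   (D2 jt (y + b' *: (s *: d) + a' *: (s *: h)) h d - D2 jt y d h) -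
   (D2 jt (y + b' *: (s *: d) + a' *: (s *: h)) h d - D2 jt y h d) by ring.
apply: (le_trans (ler_normB _ _)); apply: le_trans se.
apply: (le_trans (lerD N1 N2)); rewrite le_eqVlt; apply/orP; left; apply/eqP; ring.
Qed.

End Schwarz.

(** * Directional derivatives of the KKT functional *)

Section Quadratic.
Variable R : realType.

Lemma quadratic_derive (q : R -> R) (b s0 M : R) : 0 < s0 ->
  (forall s, `|s| < s0 -> `|q s - q 0 - s * b| <= M * s ^+ 2) -> is_derive (0 : R) 1 q b.
Proof.
move=> s00 Hq.
have M0 : 0 <= M + 1.
  have s2 : `|s0 / 2| < s0 by rewrite gtr0_norm ?divr_gt0// ltr_pdivrMr// ltr_pMr// ltr1n.
  have := le_trans (normr_ge0 _) (Hq _ s2).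
  by rewrite pmulr_lge0 ?exprn_gt0 ?divr_gt0// => /le_trans; apply; rewrite lerDl.
have cv : (h^-1 *: ((q \o shift 0) (h *: (1 : R)) - q 0)) @[h --> 0^'] --> b.
  apply/cvgrPdist_le => e e0; near=> h.
  have h0 : h != 0 by near: h; exact: nbhs_dnbhs_neq.
  have hs : `|h| < s0 by near: h; exact: dnbhs0_lt.
  have he : `|h| * (M + 1 + 1) <= e.
    rewrite -ler_pdivlMr ?ltr_wpDl//; near: h; apply: dnbhs0_le.
    by rewrite divr_gt0// ltr_wpDl.
  rewrite /= addr0 [h *: (1 : R)]mulr1.
  have -> : b - h^-1 *: (q h - q 0) = - (h^-1 * (q h - q 0 - h * b)).
    by rewrite /GRing.scale/=; field.
  rewrite normrN normrM normfV ler_pdivrMl ?normr_gt0//.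
  apply: (le_trans (Hq _ hs)).
  rewrite -real_normK ?num_real// expr2 mulrCA ler_wpM2l//.
  apply: le_trans he; rewrite mulrC ler_wpM2l// -addrA lerDl; lra.
apply: DeriveDef; first by apply/cvg_ex; exists b.
by apply: cvg_lim => //; exact: Rhausdorff.
Unshelve. all: by end_near. Qed.

Lemma derive_Int (g : R -> R -> R) (g' : R -> R) (s0 C : R) : 0 < s0 ->
  (forall s, `|s| < s0 -> abounded (g s)) -> abounded g' ->
  (forall s, `|s| < s0 -> ae01 (fun t => `|g s t - g 0 t - s * g' t| <= C * s ^+ 2)) ->
  is_derive (0 : R) 1 (fun s => Int01 (g s)) (Int01 g').
Proof.
move=> s00 bg bg' Hg; apply: (@quadratic_derive _ _ s0 C) => // s ss.
have b0 : abounded (g 0) by apply: bg; rewrite normr0.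
rewrite -IntZ// -IntB//; last exact: bg.
rewrite -IntB//; [|exact: aboundedB (bg s ss) b0|exact: aboundedZ].
rewrite -[leRHS](Int_cst (C * s ^+ 2)); apply: Int_norm_le; last exact: Hg.
  by apply: aboundedB; [exact: aboundedB (bg s ss) b0|exact: aboundedZ].
exact: abounded_cst.
Qed.

Lemma derive1_shift (G : R -> R) (s : R) : derive1 G s = derive1 (fun r => G (r + s)) 0.
Proof. by rewrite /derive1; under [in RHS]eq_fun do rewrite addr0 add0r. Qed.

Lemma near0_norm (s0 : R) (P : R -> Prop) : 0 < s0 -> (forall s, `|s| < s0 -> P s) ->
  \forall s \near (0 : R), P s.
Proof.
move=> s00 H; apply/nbhs_ballP; exists s0 => // s; rewrite /ball/= sub0r normrN.
exact: H.
Qed.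

End Quadratic.


Section StateOfPath.
Variable R : realType.
Local Notation V := 'rV[R]_6.
Local Notation I := (@I01 R).

Definition mk6 (a b c d e f : R) : V := \row_(i < 6) nth 0 [:: a; b; c; d; e; f] i.

Definition state (a : chi R) (t : R) : V :=
  mk6 (cxi a t).1 (cxi a t).2 (dpath (cxi a) t).1 (dpath (cxi a) t).2 (clam a t) (cL a).

(** Common to iterates and to directions: no boundary values, and a multiplier that is bounded up to
    a null set. *)
Definition regular (a : chi R) : Prop := Lip01 (cxi a) /\ abounded (clam a).

Lemma row6P (y z : V) : y 0 i0 = z 0 i0 -> y 0 i1 = z 0 i1 -> y 0 i2 = z 0 i2 ->
  y 0 i3 = z 0 i3 -> y 0 i4 = z 0 i4 -> y 0 i5 = z 0 i5 -> y = z.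
Proof. by move=> *; apply/rowP; apply: ord6_ind. Qed.

Lemma Lip01D (x y : R -> R * R) : Lip01 x -> Lip01 y -> Lip01 (fun t => vadd (x t) (y t)).
Proof.
move=> /Lip01P[K [x1 x2]] /Lip01P[M [y1 y2]]; apply/Lip01P; exists (K + M).
by split=> s t Is It /=; rewrite mulrDl opprD addrACA (le_trans (ler_normD _ _))// lerD//;
  [exact: x1|exact: y1|exact: x2|exact: y2].
Qed.

Lemma Lip01Z (k : R) (x : R -> R * R) : Lip01 x -> Lip01 (fun t => vscale k (x t)).
Proof.
move=> /Lip01P[K [x1 x2]]; apply/Lip01P; exists (`|k| * K).
by split=> s t Is It /=; rewrite -mulrBr normrM -mulrA ler_wpM2l//; [exact: x1|exact: x2].
Qed.

Lemma regular_add (s : R) a d : regular a -> regular d -> regular (cadd a (cscale s d)).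
Proof.
move=> [La ba] [Ld bd]; split; first by apply: Lip01D => //; exact: Lip01Z.
by apply: aboundedD => //; exact: aboundedZ.
Qed.

Lemma csubE (a b : chi R) : csub a b = cadd a (cscale (-1) b).
Proof.
rewrite /csub /cadd /cscale /=; congr mkChi; first by rewrite mulN1r.
  by apply/funext => t; rewrite /vsub /vadd /vscale/= !mulN1r.
by apply/funext => t; rewrite mulN1r.
Qed.

Lemma regular_sub a b : regular a -> regular b -> regular (csub a b).
Proof. by rewrite csubE; exact: regular_add. Qed.

Lemma state_add (s : R) a d : regular a -> regular d ->
  ae01 (fun t => state (cadd a (cscale s d)) t = state a t + s *: state d t).
Proof.
move=> [La _] [Ld _]; have [_ _ da] := Lip01_dpath La; have [_ _ dd] := Lip01_dpath Ld.
apply: (ae01_mp2 da dd) => t It [a1 a2] [d1 d2].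
have e1 : is_derive t 1 (fun u => (cxi a u).1 + s * (cxi d u).1)
    ((dpath (cxi a) t).1 + s * (dpath (cxi d) t).1).
  exact: (is_deriveD a1 (is_deriveZ s d1)).
have e2 : is_derive t 1 (fun u => (cxi a u).2 + s * (cxi d u).2)
    ((dpath (cxi a) t).2 + s * (dpath (cxi d) t).2).
  exact: (is_deriveD a2 (is_deriveZ s d2)).
have E1 : (dpath (cxi (cadd a (cscale s d))) t).1 = _ := is_derive1_derive1 e1.
have E2 : (dpath (cxi (cadd a (cscale s d))) t).2 = _ := is_derive1_derive1 e2.
by apply: row6P; rewrite !mxE /= ?E1 ?E2.
Qed.

Lemma state_sub a b : regular a -> regular b ->
  ae01 (fun t => state (csub a b) t = state a t - state b t).
Proof.
move=> ra rb; rewrite csubE; apply: (ae01_mp (state_add (-1) ra rb)) => t _ ->.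
by rewrite scaleN1r.
Qed.

Lemma abounded_state a i : regular a -> abounded (fun t => state a t 0 i).
Proof.
move=> [La ba]; have [b1 b2 _] := Lip01_dpath La.
have lipb K (F : R -> R) : lip K F -> abounded F.
  move=> HF; apply: (@abounded_measurable _ _ (K + `|F 0|)).
    apply: open_continuous_measurable_fun; first exact: interval_open.
    by move=> t /set_mem It; exact: lip_near_continuous HF It.
  apply: ae01_all => t /I01W It; have := HF t 0 It (I01c0 R); rewrite subr0.
  have K0 := lip_ge0 HF.
  have t1 : `|t| <= 1 by move: It; rewrite /I01c/= in_itv/= => /andP[? ?]; rewrite ger0_norm.
  move=> H; rewrite -[F t](subrK (F 0)); apply: (le_trans (ler_normD _ _)); rewrite lerD2r.
  by apply: (le_trans H); rewrite ler_piMr.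
have [K [l1 l2]] := (Lip01P _).1 La.
move: i; apply: ord6_ind.
- by under eq_fun do rewrite mxE /=; exact: lipb l1.
- by under eq_fun do rewrite mxE /=; exact: lipb l2.
- by under eq_fun do rewrite mxE /=; exact: b1.
- by under eq_fun do rewrite mxE /=; exact: b2.
- by under eq_fun do rewrite mxE /=; exact: ba.
- by under eq_fun do rewrite mxE /=; exact: abounded_cst.
Qed.

Lemma abounded_snorm a : regular a -> abounded (fun t => snorm (state a t)).
Proof.
by move=> ra; apply: abounded_sum => i; apply: abounded_norm; exact: abounded_state.
Qed.

(** Replacing velocity and multiplier by measurable representatives gives a tame path that equals
    the state almost everywhere. *)
Lemma abounded_tame (U : set V) (G : V -> R) (a : chi R) (C : R) : tame U G -> regular a ->
  ae01 (fun t => `|G (state a t)| <= C) -> abounded (fun t => G (state a t)).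
Proof.
move=> [_ mG] ra GC; have [La ba] := ra; have [b1 b2 _] := Lip01_dpath La.
have [g1 [_ [m1 _ e1]]] := b1; have [g2 [_ [m2 _ e2]]] := b2.
have [gl [_ [ml _ el]]] := ba.
pose z t : V := mk6 (cxi a t).1 (cxi a t).2 (g1 t) (g2 t) (gl t) (cL a).
have ez : ae01 (fun t => G (state a t) = G (z t)).
  by apply: (ae01_mp2 (ae01_and e1 e2) el) => t _ [h1 h2] h3; rewrite /state /z h1 h2 h3.
apply: (abounded_ae ez); apply: (abounded_measurable (C := C)); last first.
  by apply: (ae01_mp2 ez GC) => t _ ->.
have [K [l1 l2]] := (Lip01P _).1 La.
have mlip (F : R -> R) : lip K F -> measurable_fun I F.
  move=> HF; apply: open_continuous_measurable_fun; first exact: interval_open.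
  by move=> t /set_mem It; exact: lip_near_continuous HF It.
apply: (mG z); split.
  apply: ord6_ind => // _ t It.
    have -> : (fun t => z t 0 i0) = (fun t => (cxi a t).1) by apply/funext => u; rewrite mxE.
    exact: lip_near_continuous l1 It.
  have -> : (fun t => z t 0 i1) = (fun t => (cxi a t).2) by apply/funext => u; rewrite mxE.
  exact: lip_near_continuous l2 It.
apply: ord6_ind.
- by under eq_fun do rewrite mxE /=; exact: mlip l1.
- by under eq_fun do rewrite mxE /=; exact: mlip l2.
- by under eq_fun do rewrite mxE /=; exact: measurable_funTS.
- by under eq_fun do rewrite mxE /=; exact: measurable_funTS.
- by under eq_fun do rewrite mxE /=; exact: measurable_funTS.
- by under eq_fun do rewrite mxE /=; exact: measurable_cst.
Qed.

End StateOfPath.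

(** * [Fop] and [Fd] as integrals of differentials of the Lagrangian density *)

Section Functionals.
Variable R : realType.
Local Notation V := 'rV[R]_6.
Local Notation I := (@I01 R).
Local Notation M := (@moving R).
Variables (vbar : R) (w : R * R -> R * R).
Local Notation l := (lagr vbar w).
Variable jt : jets M l.

Lemma open_moving : open M.
Proof.
rewrite openE => y My; rewrite /interior.
have [c0|c0] : y 0 i2 != 0 \/ y 0 i3 != 0.
- case: (eqVneq (y 0 i2) 0) => [e2|]; last by left.
  case: (eqVneq (y 0 i3) 0) => [e3|]; last by right.
  by move: My; rewrite /moving/= /vel e2 e3 /vzero eqxx.
- have cy : {for y, continuous (fun y : V => y 0 i2)} by exact: coord_continuous.
  near=> z; have z0 : z 0 i2 != 0 by near: z; exact: (cvgr_neq0 _ cy).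
  by apply: contra z0 => /eqP[-> _].
- have cy : {for y, continuous (fun y : V => y 0 i3)} by exact: coord_continuous.
  near=> z; have z0 : z 0 i3 != 0 by near: z; exact: (cvgr_neq0 _ cy).
  by apply: contra z0 => /eqP[_ ->].
Unshelve. all: by end_near. Qed.

(** With zero multiplier the Lagrangian density is the travel time density. *)
Definition cut (z : V) : V := mk6 (z 0 i0) (z 0 i1) (z 0 i2) (z 0 i3) 0 (z 0 i5).

(** [Q1] and [Q2] are the first and second differentials of the constraint term lambda (|p|^2 -
    L^2). *)
Definition Q1 (z d : V) : R :=
  2 * z 0 i4 * (z 0 i2 * d 0 i2 + z 0 i3 * d 0 i3 - z 0 i5 * d 0 i5) +
  d 0 i4 * (z 0 i2 * z 0 i2 + z 0 i3 * z 0 i3 - z 0 i5 * z 0 i5).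
Definition Q2 (z e d : V) : R :=
  2 * d 0 i4 * (z 0 i2 * e 0 i2 + z 0 i3 * e 0 i3 - z 0 i5 * e 0 i5) +
  2 * e 0 i4 * (z 0 i2 * d 0 i2 + z 0 i3 * d 0 i3 - z 0 i5 * d 0 i5) +
  2 * z 0 i4 * (e 0 i2 * d 0 i2 + e 0 i3 * d 0 i3 - e 0 i5 * d 0 i5).

Lemma cubic_derive (b c d : R) : is_derive (0 : R) 1 (fun s => b * s + c * s ^+ 2 + d * s ^+ 3) b.
Proof.
apply: (@quadratic_derive _ _ _ 1 (`|c| + `|d|)) => // s s1.
have -> : b * s + c * s ^+ 2 + d * s ^+ 3 - (b * 0 + c * 0 ^+ 2 + d * 0 ^+ 3) - s * b =
  (c + d * s) * s ^+ 2 by ring.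
rewrite normrM [`|s ^+ 2|]ger0_norm ?sqr_ge0// ler_wpM2r ?sqr_ge0//.
apply: (le_trans (ler_normD _ _)); rewrite lerD2l normrM ler_piMr//; exact: ltW.
Qed.

Lemma cut_moving z : M z -> M (cut z).
Proof. by rewrite /moving /= /vel /cut !mxE. Qed.

Lemma lagr_cut z d (s : R) : l (z + s *: d) = l (cut z + s *: cut d) +
  (z 0 i4 + s * d 0 i4) * ((z 0 i2 + s * d 0 i2) ^+ 2 + (z 0 i3 + s * d 0 i3) ^+ 2 -
     (z 0 i5 + s * d 0 i5) ^+ 2).
Proof.
rewrite /lagr (_ : tau vbar w (cut z + _) = tau vbar w (z + s *: d)).
  by rewrite !mxE /=; ring.
by rewrite /tau /pos /vel /cut !mxE.
Qed.

(** Along a line the constraint term is an explicit cubic polynomial; splitting it off leaves the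
    differential of the travel time alone. *)
Lemma D1_cut z d : M z -> D1 jt z d = D1 jt (cut z) (cut d) + Q1 z d.
Proof.
move=> Mz.
have d1 : is_derive (0 : R) 1 (fun s => l (z + s *: d)) (D1 jt z d).
  by apply/is_derive_line; exact: G0_derive.
have d2 : is_derive (0 : R) 1 (fun s => l (cut z + s *: cut d)) (D1 jt (cut z) (cut d)).
  by apply/is_derive_line; apply: G0_derive; exact: cut_moving.
apply: is_derive1_unique d1 _.
pose a0 := z 0 i4 * (z 0 i2 ^+ 2 + z 0 i3 ^+ 2 - z 0 i5 ^+ 2).
pose a2 := z 0 i4 * (d 0 i2 ^+ 2 + d 0 i3 ^+ 2 - d 0 i5 ^+ 2) +
  2 * d 0 i4 * (z 0 i2 * d 0 i2 + z 0 i3 * d 0 i3 - z 0 i5 * d 0 i5).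
pose a3 := d 0 i4 * (d 0 i2 ^+ 2 + d 0 i3 ^+ 2 - d 0 i5 ^+ 2).
have -> : (fun s => l (z + s *: d)) = (fun s => l (cut z + s *: cut d) +
    (a0 + (Q1 z d * s + a2 * s ^+ 2 + a3 * s ^+ 3))).
  by apply/funext => s; rewrite lagr_cut /a0 /a2 /a3 /Q1; ring.
apply: (is_deriveD d2); rewrite -[Q1 z d in X in is_derive _ _ _ X]add0r.
exact: (is_deriveD (is_derive_cst a0 (0 : R) 1) (cubic_derive (Q1 z d) a2 a3)).
Qed.

Lemma D2_cut z e d : M z -> D2 jt z e d = D2 jt (cut z) (cut e) (cut d) + Q2 z e d.
Proof.
move=> Mz.
have d1 : is_derive (0 : R) 1 (fun s => D1 jt (z + s *: e) d) (D2 jt z e d).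
  have := @is_derive_D1_line _ _ _ _ jt z e d 0; rewrite scale0r addr0; exact.
have d2 : is_derive (0 : R) 1 (fun s => D1 jt (cut z + s *: cut e) (cut d))
    (D2 jt (cut z) (cut e) (cut d)).
  have := @is_derive_D1_line _ _ _ _ jt (cut z) (cut e) (cut d) 0.
  by rewrite scale0r addr0; apply; exact: cut_moving.
apply: is_derive1_unique d1 _.
pose a2 := 2 * e 0 i4 * (e 0 i2 * d 0 i2 + e 0 i3 * d 0 i3 - e 0 i5 * d 0 i5) +
  d 0 i4 * (e 0 i2 * e 0 i2 + e 0 i3 * e 0 i3 - e 0 i5 * e 0 i5).
have d3 : is_derive (0 : R) 1 (fun s => D1 jt (cut z + s *: cut e) (cut d) +
    (Q1 z d + (Q2 z e d * s + a2 * s ^+ 2 + 0 * s ^+ 3)))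
    (D2 jt (cut z) (cut e) (cut d) + Q2 z e d).
  apply: (is_deriveD d2); rewrite -[Q2 z e d in X in is_derive _ _ _ X]add0r.
  exact: (is_deriveD (is_derive_cst (Q1 z d) (0 : R) 1) (cubic_derive (Q2 z e d) a2 0)).
apply: near_is_derive d3.
have [r r0 Hr] : exists2 r : R, 0 < r & forall y, snorm (y - z) < r -> M y.
  by apply: near_snorm; apply: open_nbhs_nbhs; split => //; exact: open_moving.
near=> s.
have Ms : M (z + s *: e).
  apply: Hr; rewrite addrAC subrr add0r snormZ.
  have : `|s| * (snorm e + 1) < r.
    rewrite -ltr_pdivlMr ?ltr_wpDl ?snorm_ge0//; near: s.
    by apply: (@near0_norm _ (r / (snorm e + 1))) => //; rewrite divr_gt0 ?ltr_wpDl ?snorm_ge0.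
  by apply: le_lt_trans; rewrite ler_wpM2l// lerDl.
rewrite (D1_cut d Ms).
have -> : cut (z + s *: e) = cut z + s *: cut e.
  by apply: row6P; rewrite !mxE//= mulr0 addr0.
by congr (_ + _); rewrite /Q1 /Q2 /a2 !mxE; ring.
Unshelve. all: by end_near. Qed.

Section Near.
Variables (K : set V) (r C : R).
Hypotheses (K4 : forall y, K y -> y 0 i4 = 0) (r0 : 0 < r) (C0 : 0 < C).
Hypothesis HC : forall y, K y -> forall z, snorm (z - y) < r ->
  [/\ M z, `|l z| <= C, forall i, `|G1 jt i z| <= C, forall i j, `|G2 jt i j z| <= C &
     forall i j k, `|G3 jt i j k z| <= C].

Definition close (rho : R) (a : chi R) : Prop :=
  regular a /\ ae01 (fun t => exists2 y, K y & snorm (state a t - y) < rho).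

Lemma close_abounded rho a (G : V -> R) (B : R) : close rho a -> rho <= r -> tame M G ->
  (forall y, K y -> forall z, snorm (z - y) < r -> `|G z| <= B) ->
  abounded (fun t => G (state a t)).
Proof.
move=> [ra ca] rr tG GB; apply: (abounded_tame tG ra (C := B)).
by apply: (ae01_mp ca) => t It [y Ky zy]; apply: (GB y Ky); exact: lt_le_trans rr.
Qed.

Lemma close_D1_abounded rho a d : close rho a -> rho <= r -> regular d ->
  abounded (fun t => D1 jt (state a t) (state d t)).
Proof.
move=> ca rr rd; apply: abounded_sum => i; apply: aboundedM; first exact: abounded_state.
apply: (close_abounded (B := C) ca rr (G1_tame jt i)) => y Ky z zy.
by have [_ _ ->] := HC Ky zy.
Qed.

Lemma close_D2_abounded rho a e d : close rho a -> rho <= r -> regular e -> regular d ->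
  abounded (fun t => D2 jt (state a t) (state e t) (state d t)).
Proof.
move=> ca rr re rd; apply: abounded_sum => i; apply: aboundedM; first exact: abounded_state.
apply: abounded_sum => j; apply: aboundedM; first exact: abounded_state.
apply: (close_abounded (B := C) ca rr (G2_tame jt i j)) => y Ky z zy.
by have [_ _ _ -> _] := HC Ky zy.
Qed.

Lemma snorm_bound (d : chi R) : regular d -> exists2 m, 0 < m & ae01 (fun t => snorm (state d t) <= m).
Proof.
move=> /abounded_snorm/abounded_bound[m m0 dm]; exists (m + 1); first by rewrite ltr_wpDl.
by apply: (ae01_mp dm) => t _ h; rewrite (le_trans (ler_norm _))// (le_trans h)// lerDl.
Qed.

Lemma close_perturb rho a d : close rho a -> rho < r -> regular d ->
  exists s0 m, [/\ 0 < s0, ae01 (fun t => snorm (state d t) <= m),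
    s0 * m <= (r - rho) / 2 &
    forall s, `|s| < s0 -> close ((rho + r) / 2) (cadd a (cscale s d))].
Proof.
move=> [ra ca] rr rd; have [m m0 dm] := snorm_bound rd.
exists ((r - rho) / 2 / m), m; split => //.
- by rewrite !divr_gt0// subr_gt0.
- by rewrite divfK// gt_eqF.
move=> s ss; split; first exact: regular_add.
apply: (ae01_mp2 (ae01_and ca dm) (state_add s ra rd)) => t It [[y Ky zy] dt] ->.
exists y => //; rewrite addrAC; apply: (le_lt_trans (snormD _ _)).
have -> : (rho + r) / 2 = rho + (r - rho) / 2 by field.
rewrite ltr_leD// snormZ; apply: (@le_trans _ _ (`|s| * m)); first by rewrite ler_wpM2l.
by rewrite -ler_pdivlMr// ltW.
Qed.

(** Removing the multiplier turns the integral of the Lagrangian density into the travel time, see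
    [Tt_state]. *)
Definition bare (a : chi R) : chi R := mkChi (cL a) (cxi a) (fun=> 0).

Lemma state_bare (a : chi R) t : state (bare a) t = cut (state a t).
Proof. by apply: row6P; rewrite !mxE. Qed.

Lemma regular_bare (a : chi R) : regular a -> regular (bare a).
Proof. by move=> [La _]; split => //; exact: abounded_cst. Qed.

Lemma close_bare rho a : close rho a -> close rho (bare a).
Proof.
move=> [ra ca]; split; first exact: regular_bare.
apply: (ae01_mp ca) => t It [y Ky zy]; exists y => //; apply: le_lt_trans zy.
rewrite state_bare /snorm !big_ord6 /cut !mxE /= (K4 Ky) !subr0 normr0 addr0.
by rewrite -!addrA !lerD2l lerDr.
Qed.

Lemma Tt_state (a : chi R) : Tt vbar w (cxi a) = Int01 (fun t => l (state (bare a) t)).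
Proof.
apply: Int_ae; apply: ae01_all => t _.
rewrite /lagr state_bare /cut !mxE /= mul0r addr0 /tau /pos /vel !mxE /=.
by rewrite -!surjective_pairing.
Qed.

Lemma derive_lagr_Int rho a d : close rho a -> rho < r -> regular d ->
  is_derive (0 : R) 1 (fun s => Int01 (fun t => l (state (cadd a (cscale s d)) t)))
    (Int01 (fun t => D1 jt (state a t) (state d t))).
Proof.
move=> ca rr rd; have [s0 [m [s00 dm s0m cl]]] := close_perturb ca rr rd.
have rr2 : (rho + r) / 2 <= r by rewrite ler_pdivrMr//; lra.
have [ra aa] := ca.
apply: (@derive_Int _ _ _ s0 (C * m ^+ 2)) => //.
- move=> s ss; apply: (close_abounded (B := C) (cl s ss) rr2 (G0_tame jt)) => y Ky z zy.
  by have [] := HC Ky zy.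
- exact: close_D1_abounded ca (ltW rr) rd.
move=> s ss; have E := state_add s ra rd; have E0 := state_add 0 ra rd.
apply: (ae01_mp2 (ae01_and E E0) (ae01_and aa dm)) => t It [-> ->] [[y Ky zy] dt].
rewrite scale0r addr0.
have hs : snorm (s *: state d t) <= `|s| * m by rewrite snormZ ler_wpM2l.
have zhr : snorm (state a t - y) + snorm (s *: state d t) < r.
  have h1 : snorm (s *: state d t) <= (r - rho) / 2.
    apply: (le_trans hs); apply: le_trans s0m; rewrite ler_wpM2r ?(ltW ss)//.
    exact: le_trans (snorm_ge0 _) dt.
  lra.
have := taylor_D0 (HC Ky) zhr.
have -> : D1 jt (state a t) (s *: state d t) = s * D1 jt (state a t) (state d t).
  by rewrite /D1 mulr_sumr; apply: eq_bigr => i _; rewrite mxE mulrA.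
move=> H; apply: (le_trans H); rewrite -mulrA ler_wpM2l ?(ltW C0)//.
rewrite -exprMn_comm; last exact: mulrC.
rewrite [leRHS](_ : _ = (`|s| * m) ^+ 2); last by rewrite !exprMn real_normK ?num_real// mulrC.
by rewrite ler_sqr ?nnegrE ?snorm_ge0// (le_trans (snorm_ge0 _) hs).
Qed.

Lemma Td1_state rho a d : close rho a -> rho < r -> regular d ->
  is_derive (0 : R) 1 (fun s => Tt vbar w (pathpert (cxi a) (cxi d) s))
    (Int01 (fun t => D1 jt (cut (state a t)) (cut (state d t)))).
Proof.
move=> ca rr rd.
have := derive_lagr_Int (close_bare ca) rr (regular_bare rd).
rewrite (_ : (fun t => D1 jt (state (bare a) t) (state (bare d) t)) =
  (fun t => D1 jt (cut (state a t)) (cut (state d t)))); last first.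
  by apply/funext => t; rewrite !state_bare.
have -> // : (fun s => Int01 (fun t => l (state (cadd (bare a) (cscale s (bare d))) t))) =
  (fun s => Tt vbar w (pathpert (cxi a) (cxi d) s)).
apply/funext => s.
have -> : pathpert (cxi a) (cxi d) s = cxi (cadd (bare a) (cscale s (bare d))) by [].
rewrite Tt_state; congr Int01; apply/funext => t; rewrite /bare /=.
by apply: congr1; apply: row6P; rewrite !mxE //= mulr0 addr0.
Qed.

(** The travel time contributes [D1] at the cut states, and the two constraint integrals of [Fop]
    add up to the integral of [Q1]. *)
Lemma Fop_state rho a d : close rho a -> rho < r -> regular d ->
  Fop vbar w a d = Int01 (fun t => D1 jt (state a t) (state d t)).
Proof.
move=> ca rr rd; have [ra aa] := ca.
rewrite /Fop /Td1 (is_derive1_derive1 (Td1_state ca rr rd)).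
have [ba1 ba2 _] := Lip01_dpath ra.1; have [bd1 bd2 _] := Lip01_dpath rd.1.
have b1 : abounded (fun t => clam a t * (vdot (dpath (cxi a) t) (dpath (cxi d) t) - cL a * cL d)).
  apply: aboundedM; first exact: ra.2.
  by apply: aboundedB; [exact: abounded_vdot|exact: abounded_cst].
have b2 : abounded (fun t => clam d t * (vdot (dpath (cxi a) t) (dpath (cxi a) t) - cL a ^+ 2)).
  apply: aboundedM; first exact: rd.2.
  by apply: aboundedB; [exact: abounded_vdot|exact: abounded_cst].
have b0 : abounded (fun t => D1 jt (cut (state a t)) (cut (state d t))).
  have := close_D1_abounded (close_bare ca) (ltW rr) (regular_bare rd).
  by under eq_fun do rewrite !state_bare.
rewrite -IntZ// -IntD//; last exact: aboundedZ.
rewrite -IntD//; last by apply: aboundedD => //; exact: aboundedZ.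
apply: Int_ae; apply: (ae01_mp aa) => t It [y Ky zy].
have [Mz _ _ _ _] := HC Ky (lt_trans zy rr).
rewrite (D1_cut _ Mz) /Q1 !mxE /= -addrA; congr (_ + _).
by rewrite /vdot /dpath /=; ring.
Qed.

Lemma Fd_state rho a e d : close rho a -> rho < r -> regular e -> regular d ->
  is_derive (0 : R) 1 (fun s => Fop vbar w (cadd a (cscale s e)) d)
    (Int01 (fun t => D2 jt (state a t) (state e t) (state d t))).
Proof.
move=> ca rr re rd; have [s0 [m [s00 em s0m cl]]] := close_perturb ca rr re.
have rr2 : (rho + r) / 2 < r by rewrite ltr_pdivrMr//; lra.
have [ra aa] := ca; have [m' m'0 dm] := snorm_bound rd.
apply: (@near_is_derive _ (fun s => Int01 (fun t => D1 jt (state (cadd a (cscale s e)) t) (state d t)))).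
  apply: (near0_norm s00) => s ss; rewrite (Fop_state (cl s ss) rr2 rd)//.
apply: (@derive_Int _ _ _ s0 (C * m ^+ 2 * m')) => //.
- by move=> s ss; exact: close_D1_abounded (cl s ss) (ltW rr2) rd.
- exact: close_D2_abounded ca (ltW rr) re rd.
move=> s ss; have E := state_add s ra re; have E0 := state_add 0 ra re.
apply: (ae01_mp2 (ae01_and (ae01_and E E0) dm) (ae01_and aa em)) => t It [[-> ->] dt] [[y Ky zy] et].
rewrite scale0r addr0.
have hs : snorm (s *: state e t) <= `|s| * m by rewrite snormZ ler_wpM2l.
have zhr : snorm (state a t - y) + snorm (s *: state e t) < r.
  have h1 : snorm (s *: state e t) <= (r - rho) / 2.
    apply: (le_trans hs); apply: le_trans s0m; rewrite ler_wpM2r ?(ltW ss)//.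
    exact: le_trans (snorm_ge0 _) et.
  lra.
have := taylor_D1 (HC Ky) (state d t) zhr; rewrite D2Zl.
move=> H; apply: (le_trans H); rewrite mulrAC -mulrA [leRHS]mulrAC.
have hq : snorm (s *: state e t) ^+ 2 <= m ^+ 2 * s ^+ 2.
  rewrite [leRHS](_ : _ = (`|s| * m) ^+ 2); last by rewrite !exprMn real_normK ?num_real// mulrC.
  by rewrite ler_sqr ?nnegrE ?snorm_ge0// (le_trans (snorm_ge0 _) hs).
rewrite -!mulrA ler_wpM2l ?(ltW C0)//.
rewrite [leRHS](_ : _ = m' * (m ^+ 2 * s ^+ 2)); last by ring.
by rewrite ler_pM ?snorm_ge0 ?sqr_ge0.
Qed.

End Near.
End Functionals.

(** * Norms *)

Section Norms.
Variable R : realType.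
Local Notation I := (@I01 R).

Lemma discriminant (A B C : R) : 0 <= B -> (forall s, 0 <= A - 2 * s * C + s ^+ 2 * B) ->
  C ^+ 2 <= A * B.
Proof.
rewrite le_eqVlt => /predU1P[B0|B0] H; last first.
  have := H (C / B); rewrite (_ : _ + _ = A - C ^+ 2 / B); last by field; rewrite gt_eqF.
  by rewrite subr_ge0 ler_pdivrMr.
have [->|C0] := eqVneq C 0; first by rewrite -B0 expr0n mulr0.
(* For B = 0 the hypothesis is affine in s, and this s gives the value -1 unless C = 0. *)
have := H ((A + 1) / (2 * C)); rewrite -B0 mulr0 addr0.
rewrite (_ : _ - _ = - 1); last by field.
by rewrite oppr_ge0 ler10.
Qed.

Lemma sqr_L2N (f : R -> R) : L2N f ^+ 2 = Int01 (fun t => f t ^+ 2).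
Proof.
by rewrite sqr_sqrtr//; apply: Int_ge0; apply: ae01_all => t _; exact: sqr_ge0.
Qed.

Lemma L2N_ge0 (f : R -> R) : 0 <= L2N f.
Proof. exact: sqrtr_ge0. Qed.

Lemma le_sqrD (a b c : R) : 0 <= b -> 0 <= c -> a ^+ 2 <= b ^+ 2 * c ^+ 2 -> a <= b * c.
Proof.
move=> b0 c0; rewrite -exprMn => H; apply: le_trans (ler_norm a) _.
by rewrite -ler_sqr ?nnegrE ?mulr_ge0// real_normK ?num_real.
Qed.

Lemma Int_cauchy_schwarz (f g : R -> R) : abounded f -> abounded g ->
  Int01 (fun t => f t * g t) <= L2N f * L2N g.
Proof.
move=> bf bg; apply: le_sqrD; rewrite ?L2N_ge0// !sqr_L2N; apply: discriminant => [|s].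
  by apply: Int_ge0; apply: ae01_all => t _; exact: sqr_ge0.
have bff := abounded_sqr bf; have bgg := abounded_sqr bg; have bfg := aboundedM bf bg.
have -> : Int01 (fun t => f t ^+ 2) - 2 * s * Int01 (fun t => f t * g t) +
    s ^+ 2 * Int01 (fun t => g t ^+ 2) = Int01 (fun t => (f t - s * g t) ^+ 2).
  rewrite -IntZ// -[in LHS]IntZ// -IntB//; last exact: aboundedZ.
  rewrite -IntD; [|by apply: aboundedB => //; exact: aboundedZ|exact: aboundedZ].
  by congr Int01; apply/funext => t; ring.
by apply: Int_ge0; apply: ae01_all => t _; exact: sqr_ge0.
Qed.

Lemma L2N_triangle (f g : R -> R) : abounded f -> abounded g ->
  L2N (fun t => f t + g t) <= L2N f + L2N g.
Proof.
move=> bf bg; rewrite -ler_sqr ?nnegrE ?addr_ge0 ?L2N_ge0// sqrrD !sqr_L2N.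
have bff := abounded_sqr bf; have bgg := abounded_sqr bg; have bfg := aboundedM bf bg.
have -> : Int01 (fun t => (f t + g t) ^+ 2) = Int01 (fun t => f t ^+ 2) +
   2 * Int01 (fun t => f t * g t) + Int01 (fun t => g t ^+ 2).
  rewrite -IntZ// -IntD//; last exact: aboundedZ.
  rewrite -IntD//; last by apply: aboundedD => //; exact: aboundedZ.
  by congr Int01; apply/funext => t; ring.
have := Int_cauchy_schwarz bf bg.
by rewrite lerD2r lerD2l mulr_natl ler_pMn2r.
Qed.

Lemma L2N_Z (k : R) (f : R -> R) : abounded f -> 0 <= k -> L2N (fun t => k * f t) = k * L2N f.
Proof.
move=> bf k0; have bff := abounded_sqr bf; rewrite /L2N.
have -> : (fun t => (k * f t) ^+ 2) = (fun t => k ^+ 2 * f t ^+ 2).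
  by apply/funext => t; rewrite exprMn.
by rewrite IntZ// sqrtrM ?sqr_ge0// sqrtr_sqr ger0_norm.
Qed.

Lemma L2N_cst (k : R) : 0 <= k -> L2N (fun=> k) = k.
Proof. by move=> k0; rewrite /L2N Int_cst sqrtr_sqr ger0_norm. Qed.

Lemma L2N_le (f g : R -> R) : abounded f -> abounded g ->
  ae01 (fun t => 0 <= f t <= g t) -> L2N f <= L2N g.
Proof.
move=> bf bg fg; rewrite ler_wsqrtr//; apply: Int_le; [exact: abounded_sqr..|].
apply: (ae01_mp fg) => t _ /andP[f0 fg']; rewrite ler_sqr ?nnegrE//.
exact: le_trans fg'.
Qed.

Lemma L2N_ae (f g : R -> R) : ae01 (fun t => f t = g t) -> L2N f = L2N g.
Proof. by move=> fg; rewrite /L2N; congr Num.sqrt; apply: Int_ae; apply: (ae01_mp fg) => t _ ->. Qed.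

Lemma L2N_eq0 (f : R -> R) : abounded f -> L2N f = 0 -> ae01 (fun t => f t = 0).
Proof.
move=> bf f0.
have : ae01 (fun t => f t ^+ 2 = 0).
  apply: Int_eq0; [exact: abounded_sqr|by apply: ae01_all => t _; exact: sqr_ge0|].
  by rewrite -sqr_L2N f0 expr0n.
by move/ae01_mp; apply=> t _ /eqP; rewrite sqrf_eq0 => /eqP.
Qed.

Lemma LinfN_ge0 (f : R -> R) : 0 <= LinfN f.
Proof.
rewrite /LinfN.
set S := [set _ | _]; case: (pselect (S !=set0)) => [S0|/set0P/negP]; last first.
  by rewrite negbK => /eqP ->; rewrite inf0.
by apply: lb_le_inf => // x [].
Qed.

(** The essential supremum is itself an essential bound, by a countable intersection over the bounds
    [LinfN f + 1 / (n + 1)]. The hypothesis matters because the infimum of an empty set of bounds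
    would be 0. *)
Lemma LinfN_ae (f : R -> R) (C : R) : ae01 (fun t => f t <= C) -> ae01 (fun t => f t <= LinfN f).
Proof.
move=> fC; pose S := [set C : R | 0 <= C /\ ae01 (fun t => f t <= C)].
have S0 : S !=set0.
  exists `|C|; split => //; apply: (ae01_mp fC) => t _ /le_trans; apply; exact: ler_norm.
have hS : has_inf S by split => //; exists 0 => x [].
have : ae01 (fun t => forall n : nat, f t <= LinfN f + n.+1%:R^-1).
  apply: ae01_forall_nat => n.
  have [x [x0 fx] xS] := @inf_adherent _ S n.+1%:R^-1 (eqbRL (invr_gt0 _) (ltr0Sn R n)) hS.
  by apply: (ae01_mp fx) => t _ /le_trans; apply; exact: ltW.
move/ae01_mp; apply => t _ H; apply/ler_addgt0Pr => e e0.
have [n _ /(_ _ (leqnn n)) ne] := near_infty_natSinv_lt (PosNum e0).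
by apply: (le_trans (H n)); rewrite lerD2l ltW.
Qed.

Lemma abounded_vnorm (x : R -> R * R) : abounded (fun t => (x t).1) ->
  abounded (fun t => (x t).2) -> abounded (fun t => vnorm (x t)).
Proof. by move=> x1 x2; apply: abounded_sqrt; exact: abounded_vdot. Qed.

Lemma regular_vnorms (e : chi R) : regular e ->
  [/\ abounded (fun t => vnorm (cxi e t)), abounded (fun t => vnorm (dpath (cxi e) t)) &
      abounded (fun t => `|clam e t|)].
Proof.
move=> re; have [b1 b2 _] := Lip01_dpath re.1; split.
- apply: abounded_vnorm.
    by have := abounded_state i0 re; under eq_fun do rewrite mxE /=.
  by have := abounded_state i1 re; under eq_fun do rewrite mxE /=.
- exact: abounded_vnorm.
- exact: abounded_norm re.2.
Qed.

(** The factors 2 are the price of passing from Euclidean norms in the plane to sums of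
    coordinates. *)
Lemma snorm_state_le (e : chi R) t : snorm (state e t) <=
  2 * vnorm (cxi e t) + 2 * vnorm (dpath (cxi e) t) + `|clam e t| + `|cL e|.
Proof.
rewrite /snorm big_ord6 !mxE /= -/(dpath (cxi e) t).
have := le_fst_vnorm (cxi e t); have := le_snd_vnorm (cxi e t).
have := le_fst_vnorm (dpath (cxi e) t); have := le_snd_vnorm (dpath (cxi e) t).
by rewrite /dpath /=; lra.
Qed.

Lemma nYinf_snorm (e : chi R) (Rad : R) : regular e -> nYinf e <= Rad ->
  ae01 (fun t => snorm (state e t) <= 2 * Rad).
Proof.
move=> re; rewrite /nYinf => H; have [bx bp bl] := regular_vnorms re.
have [Cx _ hx] := abounded_bound bx; have [Cp _ hp] := abounded_bound bp.
have [Cl _ hl] := abounded_bound bl.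
have nn (f : R -> R) C : ae01 (fun t => `|f t| <= C) -> ae01 (fun t => f t <= C).
  by move=> hf; apply: (ae01_mp hf) => t _; apply: le_trans (ler_norm _).
have gx := LinfN_ae (nn _ _ hx); have gp := LinfN_ae (nn _ _ hp); have gl := LinfN_ae (nn _ _ hl).
apply: (ae01_mp2 (ae01_and gx gp) gl) => t _ [hx' hp'] hl'.
apply: (le_trans (snorm_state_le e t)).
have := normr_ge0 (cL e); have := normr_ge0 (clam e t); lra.
Qed.

Lemma nY2_ge0 (e : chi R) : 0 <= nY2 e.
Proof. by rewrite /nY2 !addr_ge0// L2N_ge0. Qed.

Lemma L2N_snorm (e : chi R) : regular e -> L2N (fun t => snorm (state e t)) <= 2 * nY2 e.
Proof.
move=> re; have [bx bp bl] := regular_vnorms re.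
pose F t := 2 * vnorm (cxi e t) + 2 * vnorm (dpath (cxi e) t) + `|clam e t| + `|cL e|.
have b1 := aboundedZ 2 bx; have b2 := aboundedZ 2 bp.
have b12 := aboundedD b1 b2; have b123 := aboundedD b12 bl.
have bF : abounded F by apply: aboundedD => //; exact: abounded_cst.
apply: (@le_trans _ _ (L2N F)).
  apply: L2N_le => //; first exact: abounded_snorm.
  by apply: ae01_all => t _; rewrite snorm_ge0 snorm_state_le.
apply: (le_trans (L2N_triangle b123 (abounded_cst `|cL e|))).
have h1 := L2N_triangle b12 bl; have h2 := L2N_triangle b1 b2.
rewrite L2N_cst// /nY2; rewrite !L2N_Z// in h2.
have := L2N_ge0 (fun t => `|clam e t|); have := normr_ge0 (cL e).
by move: h1 h2; rewrite /=; lra.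
Qed.

(** Turns pointwise bilinear bounds into bounds in [nY2] by Cauchy-Schwarz; 4 is the product of the
    comparison factors 2 of [L2N_snorm]. *)
Lemma Int_bilinear_le (h : R -> R) (e d : chi R) (k : R) : regular e -> regular d -> 0 <= k ->
  abounded h -> ae01 (fun t => `|h t| <= k * snorm (state e t) * snorm (state d t)) ->
  `|Int01 h| <= 4 * k * nY2 e * nY2 d.
Proof.
move=> re rd k0 bh hh; have be := abounded_snorm re; have bd := abounded_snorm rd.
have bed := aboundedM be bd.
apply: (@le_trans _ _ (Int01 (fun t => k * (snorm (state e t) * snorm (state d t))))).
  apply: Int_norm_le => //; first exact: aboundedZ.
  by apply: (ae01_mp hh) => t _; rewrite mulrA.
rewrite IntZ//.
apply: (@le_trans _ _ (k * ((2 * nY2 e) * (2 * nY2 d)))).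
  rewrite ler_wpM2l//; apply: (le_trans (Int_cauchy_schwarz be bd)).
  by rewrite ler_pM ?L2N_ge0 ?L2N_snorm.
by rewrite le_eqVlt; apply/orP; left; apply/eqP; ring.
Qed.

End Norms.

(** * Second derivative of the travel time *)

Section ImplicitSecondDerivative.
Variable R : realType.

Lemma is_derive_affine (a b s : R) : is_derive s 1 (fun r : R => a + r * b) b.
Proof.
have -> : (fun r : R => a + r * b) = cst a + (b \*: (@id R)).
  by apply/funext => r; rewrite mulrC.
apply: (is_derive_eq (is_deriveD (is_derive_cst a s 1) (is_deriveZ b (is_derive_id s 1)))).
by rewrite add0r; exact: mulr1.
Qed.

(** Here A and B are the wind components along a line of states, p + s P is the velocity and f the
    travel time density. The conclusion is half the derivative of the hypothesis. *)
Lemma implicit_first (f A B : R -> R) (v p1 p2 P1 P2 s f1 A1 B1 : R) :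
  (forall s : R, (p1 + s * P1 - f s * A s) ^+ 2 + (p2 + s * P2 - f s * B s) ^+ 2 =
     v ^+ 2 * f s ^+ 2) ->
  is_derive s 1 f f1 -> is_derive s 1 A A1 -> is_derive s 1 B B1 ->
  (p1 + s * P1 - f s * A s) * (P1 - f1 * A s - f s * A1) +
  (p2 + s * P2 - f s * B s) * (P2 - f1 * B s - f s * B1) = v ^+ 2 * f s * f1.
Proof.
move=> E df dA dB; have sc (a b : R) : a *: b = a * b by [].
pose l1 r := p1 + r * P1; pose l2 r := p2 + r * P2.
have dl1 : is_derive s 1 l1 P1 := is_derive_affine p1 P1 _.
have dl2 : is_derive s 1 l2 P2 := is_derive_affine p2 P2 _.
have d1 := is_deriveB dl1 (is_deriveM df dA); have d2 := is_deriveB dl2 (is_deriveM df dB).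
have dL := is_deriveD (is_deriveM d1 d1) (is_deriveM d2 d2).
have dR := is_deriveZ (v ^+ 2) (is_deriveM df df).
have EF : (l1 - f * A) * (l1 - f * A) + (l2 - f * B) * (l2 - f * B) = v ^+ 2 \*: (f * f).
  apply/funext => r; have := E r.
  rewrite !fctE /l1 /l2 /= => Er.
  rewrite -[RHS](_ : v ^+ 2 * f r ^+ 2 = _); last by rewrite expr2.
  by rewrite -Er; ring.
rewrite EF in dL; have := is_derive1_unique dL dR.
have e1 : (l1 - f * A) s = p1 + s * P1 - f s * A s by [].
have e2 : (l2 - f * B) s = p2 + s * P2 - f s * B s by [].
rewrite e1 e2 /GRing.scale/= => H.
apply: (mulfI (_ : 2 != 0 :> R)); first by rewrite pnatr_eq0.
by apply: etrans (etrans _ H) _; ring.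
Qed.

Lemma implicit_second (f f1 A A1 B B1 : R -> R) (v p1 p2 P1 P2 f2 A2 B2 : R) :
  (forall s : R, (p1 + s * P1 - f s * A s) ^+ 2 + (p2 + s * P2 - f s * B s) ^+ 2 =
     v ^+ 2 * f s ^+ 2) ->
  (\forall s \near (0 : R), is_derive (s : R) 1 f (f1 s)) ->
  (forall s : R, is_derive s 1 A (A1 s)) -> (forall s : R, is_derive s 1 B (B1 s)) ->
  is_derive (0 : R) 1 f1 f2 -> is_derive (0 : R) 1 A1 A2 -> is_derive (0 : R) 1 B1 B2 ->
  (P1 - f1 0 * A 0 - f 0 * A1 0) ^+ 2 + (P2 - f1 0 * B 0 - f 0 * B1 0) ^+ 2 -
  ((p1 - f 0 * A 0) * (f2 * A 0 + 2 * f1 0 * A1 0 + f 0 * A2) +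
   (p2 - f 0 * B 0) * (f2 * B 0 + 2 * f1 0 * B1 0 + f 0 * B2)) =
  v ^+ 2 * f1 0 ^+ 2 + v ^+ 2 * f 0 * f2.
Proof.
move=> E nf dA dB df1 dA1 dB1.
have df : is_derive (0 : R) 1 f (f1 0) by exact: nbhs_singleton nf.
pose l1 r := p1 + r * P1; pose l2 r := p2 + r * P2.
have dl1 : is_derive (0 : R) 1 l1 P1 := is_derive_affine p1 P1 _.
have dl2 : is_derive (0 : R) 1 l2 P2 := is_derive_affine p2 P2 _.
have dA0 := dA 0; have dB0 := dB 0.
have dq1 := is_deriveB dl1 (is_deriveM df dA0).
have dq2 := is_deriveB dl2 (is_deriveM df dB0).
have dr1 := is_deriveB (is_deriveB (is_derive_cst P1 (0 : R) 1) (is_deriveM df1 dA0)) (is_deriveM df dA1).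
have dr2 := is_deriveB (is_deriveB (is_derive_cst P2 (0 : R) 1) (is_deriveM df1 dB0)) (is_deriveM df dB1).
have dL := is_deriveD (is_deriveM dq1 dr1) (is_deriveM dq2 dr2).
have dR := is_deriveZ (v ^+ 2) (is_deriveM df df1).
have EN : \forall s \near (0 : R),
  ((l1 - f * A) * (cst P1 - f1 * A - f * A1) + (l2 - f * B) * (cst P2 - f1 * B - f * B1)) s =
  (v ^+ 2 \*: (f * f1)) s.
  apply: filterS nf => s dfs; have := implicit_first E dfs (dA s) (dB s).
  by rewrite -mulrA.
have := is_derive1_unique (near_is_derive EN dL) dR.
have e1 : (l1 - f * A) 0 = p1 + 0 * P1 - f 0 * A 0 by [].
have e2 : (l2 - f * B) 0 = p2 + 0 * P2 - f 0 * B 0 by [].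
have e3 : (cst P1 - f1 * A - f * A1) 0 = P1 - f1 0 * A 0 - f 0 * A1 0 by [].
have e4 : (cst P2 - f1 * B - f * B1) 0 = P2 - f1 0 * B 0 - f 0 * B1 0 by [].
rewrite e1 e2 e3 e4 /GRing.scale/= => H.
rewrite [RHS](_ : _ = v ^+ 2 * (f 0 * f2 + f1 0 * f1 0)); last by ring.
by rewrite -H; ring.
Qed.

(* In the orthonormal frame (n, m) with n the direction of q = p - f w, one has f' = (n.y)/b with
   y = p' - f w' and b = v + n.w, and the bound c0 <= v/sqrt 5 gives |m.w| <= b/2. *)
Lemma transversal_le (v a b ya yb : R) : 0 < v -> 5 * (a ^+ 2 + b ^+ 2) <= v ^+ 2 -> 0 < v + a ->
  4 * (yb - ya * b / (v + a)) ^+ 2 <= 5 * (ya ^+ 2 + yb ^+ 2).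
Proof.
move=> v0 ab b0; set k := b / (v + a).
have k2 : 4 * k ^+ 2 <= 1.
  rewrite /k expr_div_n mulrA ler_pdivrMr ?exprn_gt0// mul1r.
  rewrite -subr_ge0 (_ : _ - _ = 4 / 5 * (v ^+ 2 - 5 * (a ^+ 2 + b ^+ 2)) + (v + 5 * a) ^+ 2 / 5).
    by apply: addr_ge0; apply: mulr_ge0; rewrite ?sqr_ge0 ?subr_ge0 ?invr_ge0 ?divr_ge0.
  by field.
rewrite -mulrA -/k.
rewrite -subr_ge0 (_ : _ - _ = (1 - 4 * k ^+ 2) * (ya ^+ 2 + yb ^+ 2) + 4 * (k * yb + ya) ^+ 2).
  by apply: addr_ge0; apply: mulr_ge0; rewrite ?subr_ge0 ?addr_ge0 ?sqr_ge0.
by ring.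
Qed.

Lemma abs_dot_le (n1 n2 x1 x2 d : R) : n1 ^+ 2 + n2 ^+ 2 = 1 -> 0 <= d ->
  x1 ^+ 2 + x2 ^+ 2 <= d ^+ 2 -> `|n1 * x1 + n2 * x2| <= d.
Proof.
move=> n1n d0 xd; rewrite -ler_sqr ?nnegrE// real_normK ?num_real//; apply: le_trans xd.
rewrite -subr_ge0 (_ : _ - _ = (n1 ^+ 2 + n2 ^+ 2 - 1) * - (x1 ^+ 2 + x2 ^+ 2) + (n1 * x2 - n2 * x1) ^+ 2).
  by rewrite n1n subrr mul0r add0r sqr_ge0.
by ring.
Qed.

Section SecondDerivativeBound.
(** Roles: n is the unit direction of p - f w; a and b are the first and second derivatives of the
    wind w along the direction, P is the variation of the velocity, f1 and f2 are the derivatives of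
    f. The numbers b0 and e0 bound v + n.w and v f (v + n.w) from below. *)
Variables (v c0 f f1 f2 n1 n2 w1 w2 a1 a2 b1 b2 P1 P2 S d1 d2 e0 b0 : R).
Hypotheses (v0 : 0 < v) (f0 : 0 < f) (n1n : n1 ^+ 2 + n2 ^+ 2 = 1).
Hypotheses (wc : w1 ^+ 2 + w2 ^+ 2 <= c0 ^+ 2) (c0v : 5 * c0 ^+ 2 <= v ^+ 2).
Hypotheses (PS : P1 ^+ 2 + P2 ^+ 2 <= S ^+ 2) (S0 : 0 <= S).
Hypotheses (ad : a1 ^+ 2 + a2 ^+ 2 <= d1 ^+ 2) (d10 : 0 <= d1).
Hypotheses (bd : b1 ^+ 2 + b2 ^+ 2 <= d2 ^+ 2) (d20 : 0 <= d2).
Local Notation nw := (n1 * w1 + n2 * w2).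
Local Notation mw := (n1 * w2 - n2 * w1).
Hypotheses (e00 : 0 < e0) (eE : e0 <= v * f * (v + nw)) (b00 : 0 < b0) (bb : b0 <= v + nw).
Hypothesis first_order : v * f * n1 * (P1 - f1 * w1 - f * a1) +
  v * f * n2 * (P2 - f1 * w2 - f * a2) = v ^+ 2 * f * f1.
Hypothesis second_order :
  (P1 - f1 * w1 - f * a1) ^+ 2 + (P2 - f1 * w2 - f * a2) ^+ 2 -
  (v * f * n1 * (f2 * w1 + 2 * f1 * a1 + f * b1) + v * f * n2 * (f2 * w2 + 2 * f1 * a2 + f * b2)) =
  v ^+ 2 * f1 ^+ 2 + v ^+ 2 * f * f2.

Lemma second_derivative_le :
  f2 <= 5 / 4 * (S + f * d1) ^+ 2 / e0 + 2 * (S + f * d1) * d1 / b0 ^+ 2 + f * d2 / b0.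
Proof.
pose y1 := P1 - f * a1; pose y2 := P2 - f * a2.
pose ya := n1 * y1 + n2 * y2; pose yb := n1 * y2 - n2 * y1.
pose b := v + nw.
have bpos : 0 < b by apply: lt_le_trans bb.
have vf0 : 0 < v * f by rewrite mulr_gt0.
have f1b : f1 * b = ya.
  apply: (mulfI (lt0r_neq0 vf0)).
  rewrite [LHS](_ : _ = v ^+ 2 * f * f1 + v * f * f1 * nw); last by rewrite /b; ring.
  by rewrite -first_order /ya /y1 /y2; ring.
have f1E : f1 = ya / b by rewrite -f1b mulfK// gt_eqF.
have Ef2 : v * f * b * f2 = (yb - f1 * mw) ^+ 2 -
    v * f * (2 * f1 * (n1 * a1 + n2 * a2) + f * (n1 * b1 + n2 * b2)).
  (* By the first order identity the component of y - f1 w along n is v f1, so subtracting v^2 f1^2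
     from the squared length leaves the transversal component alone. *)
  have sq : (P1 - f1 * w1 - f * a1) ^+ 2 + (P2 - f1 * w2 - f * a2) ^+ 2 =
     v ^+ 2 * f1 ^+ 2 + (yb - f1 * mw) ^+ 2.
    have -> : v ^+ 2 * f1 ^+ 2 = (ya - f1 * nw) ^+ 2 by rewrite -f1b /b; ring.
    rewrite -[LHS]mul1r -n1n /ya /yb /y1 /y2; ring.
  rewrite [LHS](_ : _ = v ^+ 2 * f * f2 + v * f * f2 * nw); last by rewrite /b; ring.
  have -> : v ^+ 2 * f * f2 = (v ^+ 2 * f1 ^+ 2 + (yb - f1 * mw) ^+ 2) -
    (v * f * n1 * (f2 * w1 + 2 * f1 * a1 + f * b1) + v * f * n2 * (f2 * w2 + 2 * f1 * a2 + f * b2)) -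
    v ^+ 2 * f1 ^+ 2 by rewrite -sq second_order; ring.
  by ring.
have ynorm : y1 ^+ 2 + y2 ^+ 2 <= (S + f * d1) ^+ 2.
  have cross : - (P1 * a1 + P2 * a2) <= S * d1.
    apply: le_trans (ler_norm _) _; rewrite normrN.
    rewrite -ler_sqr ?nnegrE ?mulr_ge0// real_normK ?num_real// exprMn.
    apply: (@le_trans _ _ ((P1 ^+ 2 + P2 ^+ 2) * (a1 ^+ 2 + a2 ^+ 2))).
      by rewrite -subr_ge0 (_ : _ - _ = (P1 * a2 - P2 * a1) ^+ 2) ?sqr_ge0//; ring.
    by rewrite ler_pM ?addr_ge0 ?sqr_ge0.
  have h1 : f * (- (P1 * a1 + P2 * a2)) <= f * (S * d1) by rewrite ler_wpM2l// ltW.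
  have h2 : f ^+ 2 * (a1 ^+ 2 + a2 ^+ 2) <= f ^+ 2 * d1 ^+ 2 by rewrite ler_wpM2l ?sqr_ge0.
  have -> : y1 ^+ 2 + y2 ^+ 2 = (P1 ^+ 2 + P2 ^+ 2) + 2 * (f * (- (P1 * a1 + P2 * a2))) +
     f ^+ 2 * (a1 ^+ 2 + a2 ^+ 2) by rewrite /y1 /y2; ring.
  have -> : (S + f * d1) ^+ 2 = S ^+ 2 + 2 * (f * (S * d1)) + f ^+ 2 * d1 ^+ 2 by ring.
  by rewrite !lerD// ler_wpM2l.
have T0 : 0 <= S + f * d1 by rewrite addr_ge0// mulr_ge0// ltW.
have yaT : `|ya| <= S + f * d1 by exact: abs_dot_le.
have ysum : ya ^+ 2 + yb ^+ 2 = y1 ^+ 2 + y2 ^+ 2.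
  by rewrite -[RHS]mul1r -n1n /ya /yb; ring.
have main : (yb - f1 * mw) ^+ 2 <= 5 / 4 * (S + f * d1) ^+ 2.
  have wsum : 5 * (nw ^+ 2 + mw ^+ 2) <= v ^+ 2.
    have -> : nw ^+ 2 + mw ^+ 2 = w1 ^+ 2 + w2 ^+ 2 by rewrite -[RHS]mul1r -n1n; ring.
    by apply: le_trans c0v; rewrite ler_wpM2l.
  have := transversal_le ya yb v0 wsum bpos.
  rewrite -/b -mulrAC -f1E => H; rewrite ysum in H.
  have H2 := le_trans H (ler_wpM2l (ler0n _ 5) ynorm).
  by rewrite mulrAC ler_pdivlMr// mulrC.
have f1le : `|f1| <= (S + f * d1) / b0.
  rewrite f1E normrM normfV (gtr0_norm bpos) ler_pM ?invr_ge0 ?(ltW bpos)//.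
  by rewrite lef_pV2 ?posrE.
have dota : `|n1 * a1 + n2 * a2| <= d1 by exact: abs_dot_le.
have dotb : `|n1 * b1 + n2 * b2| <= d2 by exact: abs_dot_le.
have f2E : f2 = (yb - f1 * mw) ^+ 2 / (v * f * b) -
   (2 * f1 * (n1 * a1 + n2 * a2) + f * (n1 * b1 + n2 * b2)) / b.
  apply: (mulfI (lt0r_neq0 (mulr_gt0 vf0 bpos))); rewrite Ef2; field.
  by rewrite !gt_eqF.
rewrite f2E -[leRHS]addrA lerD//.
  rewrite ler_pM ?sqr_ge0 ?invr_ge0 ?(ltW (mulr_gt0 vf0 bpos))//.
  by rewrite lef_pV2 ?posrE// mulr_gt0.
rewrite -mulNr.
apply: (@le_trans _ _ ((2 * (S + f * d1) / b0 * d1 + f * d2) / b0)); last first.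
  by rewrite le_eqVlt; apply/orP; left; apply/eqP; field; rewrite gt_eqF.
apply: (@le_trans _ _ ((2 * (S + f * d1) / b0 * d1 + f * d2) / b)); last first.
  rewrite ler_wpM2l ?lef_pV2 ?posrE// addr_ge0 ?mulr_ge0 ?invr_ge0 ?(ltW b00) ?(ltW f0)//.
rewrite ler_pM2r ?invr_gt0// opprD lerD//.
  apply: le_trans (ler_norm _) _; rewrite normrN normrM normrM ger0_norm// -mulrA.
  by rewrite -!mulrA ler_wpM2l// mulrA ler_pM.
apply: le_trans (ler_norm _) _; rewrite normrN normrM (gtr0_norm f0).
by rewrite ler_wpM2l// ltW.
Qed.

End SecondDerivativeBound.
End ImplicitSecondDerivative.

(** * Travel time density: defining equation, bounds and second derivative *)

Section TravelTimeBounds.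
Variable R : realType.
Local Notation V := 'rV[R]_6.
Local Notation M := (@moving R).
Variables (v : R) (w : R * R -> R * R).
Hypotheses (v0 : 0 < v) (wv : forall x, vnorm (w x) < v).
Implicit Types (x p : R * R).

Lemma ff_root x p : (v ^+ 2 - vdot (w x) (w x)) * ff v w x p + vdot p (w x) =
  Num.sqrt (vdot p (w x) ^+ 2 + (v ^+ 2 - vdot (w x) (w x)) * vdot p p).
Proof.
have a0 := vdot_w_lt v0 wv x.
by rewrite /ff mulrC divfK ?gt_eqF// addrC addrA subrr add0r.
Qed.

(** [ff] is the nonnegative root of this quadratic equation: the ground velocity p / f differs from
    the wind by a vector of length v. *)
Lemma ff_eq x p :
  (p.1 - ff v w x p * (w x).1) ^+ 2 + (p.2 - ff v w x p * (w x).2) ^+ 2 = v ^+ 2 * ff v w x p ^+ 2.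
Proof.
have a0 := vdot_w_lt v0 wv x; have := ff_root x p; set f := ff v w x p => E.
have D0 : 0 <= vdot p (w x) ^+ 2 + (v ^+ 2 - vdot (w x) (w x)) * vdot p p.
  by rewrite addr_ge0 ?sqr_ge0// mulr_ge0 ?vdot_ge0// ltW.
have := congr1 (fun u => u ^+ 2) E; rewrite sqr_sqrtr// => {D0}E2.
have {}E2 : (v ^+ 2 - vdot (w x) (w x)) *
   ((v ^+ 2 - vdot (w x) (w x)) * f ^+ 2 + 2 * vdot p (w x) * f - vdot p p) = 0.
  apply/eqP; rewrite -[X in _ == X](subrr (vdot p (w x) ^+ 2 + (v ^+ 2 - vdot (w x) (w x)) * vdot p p)).
  by rewrite -[X in _ == X - _]E2; apply/eqP; ring.
move/eqP: E2; rewrite mulf_eq0 gt_eqF//= => /eqP E2.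
apply/eqP; rewrite -subr_eq0 -oppr_eq0 -[X in _ == X]E2; apply/eqP.
by rewrite /vdot; ring.
Qed.

Lemma ff_ge0 x p : 0 <= ff v w x p.
Proof.
have a0 := vdot_w_lt v0 wv x; rewrite /ff divr_ge0 ?(ltW a0)//.
rewrite addrC subr_ge0; apply: le_trans (ler_norm _) _.
by rewrite -sqrtr_sqr ler_wsqrtr// lerDl mulr_ge0 ?vdot_ge0// ltW.
Qed.


(** The vector q = p - f w has length v f, and both bounds are triangle inequalities. *)
Lemma ff_bounds x p :
  vnorm p <= (v + vnorm (w x)) * ff v w x p /\ (v - vnorm (w x)) * ff v w x p <= vnorm p.
Proof.
have f0 := ff_ge0 x p; have := ff_eq x p; set f := ff v w x p => E.
pose q := vsub p (vscale f (w x)).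
have qE : vnorm q = v * f.
  have qq : vdot q q = (v * f) ^+ 2 by rewrite exprMn -E /vdot /q /vsub /vscale /= !expr2.
  by rewrite /vnorm qq sqrtr_sqr ger0_norm// mulr_ge0// ltW.
split.
  have -> : p = vadd q (vscale f (w x)).
    by rewrite /q /vadd /vsub /vscale /= !subrK -surjective_pairing.
  by rewrite (le_trans (vnorm_vadd _ _))// qE vnorm_vscale (ger0_norm f0) mulrDl lerD2l mulrC.
have h : vnorm q <= vnorm p + f * vnorm (w x).
  have -> : q = vadd p (vscale (- f) (w x)).
    by rewrite /q /vadd /vsub /vscale /= !mulNr.
  by rewrite (le_trans (vnorm_vadd _ _))// vnorm_vscale normrN (ger0_norm f0).
by move: h; rewrite qE; lra.
Qed.

Lemma vnorm_gt0 p : p != vzero R -> 0 < vnorm p.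
Proof. by move=> p0; rewrite sqrtr_gt0; exact: vdot_gt0. Qed.

Lemma ff_gt0 x p : p != vzero R -> 0 < ff v w x p.
Proof.
move=> p0; have [h _] := ff_bounds x p; have n0 := vnorm_gt0 p0.
rewrite lt_def ff_ge0 andbT; apply: contraTneq (lt_le_trans n0 h) => ->.
by rewrite mulr0 ltxx.
Qed.

Lemma ff_scale x p (k : R) : 0 < k -> ff v w x (vscale k p) = k * ff v w x p.
Proof.
move=> k0; rewrite /ff.
have -> : vdot (vscale k p) (w x) = k * vdot p (w x) by rewrite /vdot /vscale /=; ring.
have -> : vdot (vscale k p) (vscale k p) = k ^+ 2 * vdot p p by rewrite /vdot /vscale /=; ring.
have -> : (k * vdot p (w x)) ^+ 2 + (v ^+ 2 - vdot (w x) (w x)) * (k ^+ 2 * vdot p p) =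
  k ^+ 2 * (vdot p (w x) ^+ 2 + (v ^+ 2 - vdot (w x) (w x)) * vdot p p) by ring.
rewrite sqrtrM ?sqr_ge0// sqrtr_sqr gtr0_norm//; ring.
Qed.

Section AirspeedConstants.
Variable c0 : R.
Hypotheses (c00 : 0 <= c0) (c0v : c0 <= v / Num.sqrt 5).

Lemma five_c0 : 5 * c0 ^+ 2 <= v ^+ 2.
Proof.
have s5 : 0 < Num.sqrt 5 :> R by rewrite sqrtr_gt0.
have hs : Num.sqrt 5 * c0 <= v by rewrite mulrC -ler_pdivlMr.
have -> : 5 * c0 ^+ 2 = (Num.sqrt 5 * c0) ^+ 2 by rewrite exprMn sqr_sqrtr.
by rewrite ler_sqr ?nnegrE ?(ltW v0)// mulr_ge0// ltW.
Qed.

Lemma c0_lt_v : c0 < v.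
Proof.
rewrite -ltr_sqr ?nnegrE ?(ltW v0)//.
have := five_c0; have := exprn_gt0 2 v0; have := sqr_ge0 c0; lra.
Qed.

Lemma vunder_gt0 : 0 < vunder v c0.
Proof. by rewrite /vunder sqrtr_gt0 subr_gt0 ltr_sqr ?nnegrE ?(ltW v0)// c0_lt_v. Qed.

End AirspeedConstants.

Section SecondDerivative.
Hypothesis Cw : Ck 3 w.
Variable jt : jets M (lagr v w).
Variables (z h : V) (c0 c1 c2 : R).
Hypotheses (Mz : M z) (z4 : z 0 i4 = 0) (h4 : h 0 i4 = 0).
Local Notation x := (pos z).
Local Notation p := (vel z).
Local Notation X := (pos h).
Local Notation P := (vel h).
Hypotheses (wc0 : vnorm (w x) <= c0) (c0v : c0 <= v / Num.sqrt 5).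
Hypotheses (c10 : 0 <= c1) (c20 : 0 <= c2).
Hypothesis wc1 : vnorm (ddir w x X) <= c1 * vnorm X.
Hypothesis wc2 : vnorm (ddir (fun y => ddir w y X) x X) <= c2 * vnorm X * vnorm X.

Lemma D2_travel_le : D2 jt z h h <=
  5 / 4 * (vnorm P + tau v w z * (c1 * vnorm X)) ^+ 2 / (vunder v c0 * vnorm p) +
  2 * (vnorm P + tau v w z * (c1 * vnorm X)) * (c1 * vnorm X) / (v - c0) ^+ 2 +
  tau v w z * (c2 * vnorm X * vnorm X) / (v - c0).
Proof.
have c00 : 0 <= c0 := le_trans (vnorm_ge0 _) wc0.
have h5 := five_c0 c00 c0v; have c0v' := c0_lt_v c00 c0v.
have [Cw1 [dw Cw2]] := Cw; have [_ [ddw _]] := Cw2 X.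
pose f s := tau v w (z + s *: h).
pose A s := (w (vadd x (vscale s X))).1; pose B s := (w (vadd x (vscale s X))).2.
pose A1 s := (ddir w (vadd x (vscale s X)) X).1; pose B1 s := (ddir w (vadd x (vscale s X)) X).2.
pose A2 := (ddir (fun y => ddir w y X) x X).1; pose B2 := (ddir (fun y => ddir w y X) x X).2.
have posE s : pos (z + s *: h) = vadd x (vscale s X) by rewrite /pos !mxE.
have velE s : vel (z + s *: h) = vadd p (vscale s P) by rewrite /vel !mxE.
have x0 : vadd x (vscale 0 X) = x by rewrite /vadd /vscale /= !mul0r !addr0.
have dA (s : R) : is_derive s 1 A (A1 s).
  by apply: (@is_derive_ddirR _ (fun y => (w y).1)) => y k; have [] := dw y k.
have dB (s : R) : is_derive s 1 B (B1 s).
  by apply: (@is_derive_ddirR _ (fun y => (w y).2)) => y k; have [] := dw y k.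
have dA1 : is_derive (0 : R) 1 A1 A2.
  have := @is_derive_ddirR _ (fun y => (ddir w y X).1) x X 0; rewrite x0; apply.
  by move=> y k; have [] := ddw y k.
have dB1 : is_derive (0 : R) 1 B1 B2.
  have := @is_derive_ddirR _ (fun y => (ddir w y X).2) x X 0; rewrite x0; apply.
  by move=> y k; have [] := ddw y k.
have fE : f = (fun s => lagr v w (z + s *: h)).
  by apply/funext => s; rewrite /lagr !mxE z4 h4 mulr0 addr0 mul0r addr0.
have [r r0 Hr] : exists2 r : R, 0 < r & forall y, snorm (y - z) < r -> M y.
  by apply: near_snorm; apply: open_nbhs_nbhs; split => //; exact: open_moving.
have df : \forall s \near (0 : R), is_derive (s : R) 1 f (D1 jt (z + s *: h) h).
  rewrite fE; apply: (@near0_norm _ (r / (snorm h + 1))).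
    by rewrite divr_gt0// ltr_wpDl ?snorm_ge0.
  move=> s; rewrite ltr_pdivlMr ?ltr_wpDl ?snorm_ge0// => hs; apply: is_derive_G0_line.
  apply: Hr; rewrite addrAC subrr add0r snormZ; apply: le_lt_trans hs.
  by rewrite ler_wpM2l// lerDl.
have df1 : is_derive (0 : R) 1 (fun s => D1 jt (z + s *: h) h) (D2 jt z h h).
  by have := @is_derive_D1_line _ _ _ _ jt z h h 0; rewrite scale0r addr0; apply.
have E s : (z 0 i2 + s * h 0 i2 - f s * A s) ^+ 2 + (z 0 i3 + s * h 0 i3 - f s * B s) ^+ 2 =
    v ^+ 2 * f s ^+ 2.
  have := ff_eq (pos (z + s *: h)) (vel (z + s *: h)).
  by rewrite -/(tau v w (z + s *: h)) -/(f s) posE velE.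
have f0E : f 0 = tau v w z by rewrite /f scale0r addr0.
have fpos : 0 < tau v w z by exact: ff_gt0.
have E1 := implicit_first E (nbhs_singleton df) (dA 0) (dB 0).
have E2 := implicit_second E df dA dB df1 dA1 dB1.
have A0 : A 0 = (w x).1 by rewrite /A x0.
have B0 : B 0 = (w x).2 by rewrite /B x0.
rewrite /= scale0r addr0 !mul0r !addr0 in E1 E2.
have E0 := E 0; rewrite !mul0r !addr0 in E0.
pose n1 := (z 0 i2 - f 0 * A 0) / (v * f 0); pose n2 := (z 0 i3 - f 0 * B 0) / (v * f 0).
have vf : v * f 0 != 0 by rewrite f0E gt_eqF// mulr_gt0.
have q1 : z 0 i2 - f 0 * A 0 = v * f 0 * n1 by rewrite [RHS]mulrC divfK.
have q2 : z 0 i3 - f 0 * B 0 = v * f 0 * n2 by rewrite [RHS]mulrC divfK.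
rewrite q1 q2 in E0 E1 E2.
have n1n : n1 ^+ 2 + n2 ^+ 2 = 1.
  apply: (mulfI (_ : (v * f 0) ^+ 2 != 0)); first by rewrite expf_neq0.
  by rewrite mulr1 [RHS]exprMn -E0; ring.
have sq_le (y : R * R) (d : R) : vnorm y <= d -> y.1 ^+ 2 + y.2 ^+ 2 <= d ^+ 2.
  move=> yd; rewrite !expr2 -/(vdot y y) -sqr_vnorm -expr2 ler_sqr ?nnegrE ?vnorm_ge0//.
  exact: le_trans (vnorm_ge0 _) yd.
(* By [ff_root] this quantity is the square root in the formula for [ff], hence at least [vunder]
   times the speed; that is the lower bound e0 used below. *)
have nwE : v * f 0 * (v + (n1 * (w x).1 + n2 * (w x).2)) =
  (v ^+ 2 - vdot (w x) (w x)) * tau v w z + vdot p (w x).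
  rewrite /vdot -A0 -B0 -f0E.
  have -> : v * f 0 * (v + (n1 * A 0 + n2 * B 0)) =
     v ^+ 2 * f 0 + (v * f 0 * n1) * A 0 + (v * f 0 * n2) * B 0 by ring.
  by rewrite -q1 -q2 /vel /=; ring.
have x1 : A1 0 = (ddir w x X).1 by rewrite /A1 x0.
have y1 : B1 0 = (ddir w x X).2 by rewrite /B1 x0.
rewrite A0 B0 x1 y1 f0E in E1 E2; rewrite f0E in nwE.
have nw_ge : v - c0 <= v + (n1 * (w x).1 + n2 * (w x).2).
  rewrite lerD2l lerNl; apply: le_trans (ler_norm _) _; rewrite normrN.
  by apply: abs_dot_le => //; exact: sq_le.
have p0 := vnorm_gt0 (Mz : vel z != vzero R).
apply: (second_derivative_le v0 fpos n1n (sq_le _ _ wc0) h5 (sq_le _ _ (lexx (vnorm P)))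
  (vnorm_ge0 _) (sq_le _ _ wc1) _ (sq_le _ _ wc2) _ _ _ _ nw_ge E1 E2).
- by rewrite mulr_ge0 ?vnorm_ge0.
- by rewrite !mulr_ge0 ?vnorm_ge0.
- by rewrite mulr_gt0// vunder_gt0.
- rewrite nwE ff_root /vunder /vnorm -sqrtrM; last by rewrite subr_ge0 ler_sqr ?nnegrE ?(ltW v0)// ltW.
  rewrite ler_wsqrtr//; apply: ler_wpDl; first exact: sqr_ge0.
  rewrite ler_wpM2r ?vdot_ge0// lerD2l lerN2 -sqr_vnorm ler_sqr ?nnegrE ?vnorm_ge0//.
- by rewrite subr_gt0.
Qed.

End SecondDerivative.
End TravelTimeBounds.

Section SecondDerivativeConstants.
Variable R : realType.
Local Notation V := 'rV[R]_6.
Local Notation M := (@moving R).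

(* 1.7 exceeds the golden ratio, the value of vunder / (v - c0) at c0 = v / sqrt 5. *)
Lemma vunder_le (v c0 : R) : 0 < v -> 0 <= c0 -> c0 < v -> 5 * c0 ^+ 2 <= v ^+ 2 ->
  vunder v c0 <= 17 / 10 * (v - c0).
Proof.
move=> v0 c00 cv h5.
have d0 : 0 < v - c0 by rewrite subr_gt0.
have key : v + c0 <= (17 / 10) ^+ 2 * (v - c0).
  have h : 25 * c0 <= 12 * v.
    have : 0 <= v ^+ 2 by exact: sqr_ge0.
    move=> v2; rewrite -ler_sqr ?nnegrE ?mulr_ge0 ?(ltW v0)// !exprMn; lra.
  lra.
rewrite -ler_sqr ?nnegrE ?sqrtr_ge0 ?mulr_ge0 ?(ltW d0)//.
rewrite sqr_sqrtr; last by rewrite subr_ge0 ler_sqr ?nnegrE ?(ltW v0)// ltW.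
rewrite subr_sqr [leRHS](_ : _ = (v - c0) * ((17 / 10) ^+ 2 * (v - c0))); last by ring.
by rewrite ler_wpM2l// ltW.
Qed.

(** Used with g = 1 / vunder, k = 1 / (v - c0), L the speed, T the travel time density and Y = c1 X.
    The numbers 14, 4, 14 and 2 are the coefficients in [beta0], in twice [beta1] and in half of
    [beta2]. *)
Lemma quadratic_constants (g L T k P Y c2 X : R) : 0 < g -> 0 < L -> 0 <= k -> 0 <= P -> 0 <= Y ->
  0 <= c2 -> 0 <= X -> 0 <= T -> k <= 17 / 10 * g -> T <= L * k ->
  5 / 4 * (P + T * Y) ^+ 2 * (g / L) + 2 * (P + T * Y) * Y * k ^+ 2 + T * (c2 * X * X) * k <=
  L * g ^+ 3 * 14 * Y ^+ 2 + L * g ^+ 2 * 4 * c2 * X ^+ 2 + 14 * g ^+ 2 * (Y * P) +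
  2 * (g / L) * P ^+ 2.
Proof.
move=> g0 L0 k0 P0 Y0 c20 X0 T0 kg Tk.
pose k' := 17 / 10 * g; pose T' := L * k'.
have k'0 : 0 <= k' by rewrite /k' mulr_ge0// ltW.
have TT' : T <= T' by apply: (le_trans Tk); rewrite ler_wpM2l// ltW.
have T'0 : 0 <= T' := le_trans T0 TT'.
have PT : P + T * Y <= P + T' * Y by rewrite lerD2l ler_wpM2r.
have PT0 : 0 <= P + T * Y by rewrite addr_ge0// mulr_ge0.
have PT'0 : 0 <= P + T' * Y by rewrite addr_ge0// mulr_ge0.
have gL : 0 <= g / L by rewrite divr_ge0// ltW.
have kk : k ^+ 2 <= k' ^+ 2 by rewrite ler_sqr ?nnegrE.
have cXX : 0 <= c2 * X * X by rewrite !mulr_ge0.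
have s1 : 5 / 4 * (P + T * Y) ^+ 2 * (g / L) <= 5 / 4 * (P + T' * Y) ^+ 2 * (g / L).
  by rewrite ler_wpM2r// ler_wpM2l// ler_sqr ?nnegrE.
have s2 : 2 * (P + T * Y) * Y * k ^+ 2 <= 2 * (P + T' * Y) * Y * k' ^+ 2.
  apply: ler_pM => //; rewrite ?sqr_ge0// ?mulr_ge0//.
  by rewrite ler_wpM2r// ler_wpM2l.
have s3 : T * (c2 * X * X) * k <= T' * (c2 * X * X) * k'.
  by apply: ler_pM => //; rewrite ?mulr_ge0// ler_wpM2r.
apply: (le_trans (lerD (lerD s1 s2) s3)).
rewrite -subr_ge0.
(* After k is replaced by its upper bound 17/10 g, every coefficient of the difference is
   nonnegative. *)
have -> : L * g ^+ 3 * 14 * Y ^+ 2 + L * g ^+ 2 * 4 * c2 * X ^+ 2 + 14 * g ^+ 2 * (Y * P) +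
  2 * (g / L) * P ^+ 2 - (5 / 4 * (P + T' * Y) ^+ 2 * (g / L) + 2 * (P + T' * Y) * Y * k' ^+ 2 +
   T' * (c2 * X * X) * k') =
  3 / 4 * (g / L) * P ^+ 2 + (14 - 5 / 2 * (17 / 10) - 2 * (17 / 10) ^+ 2) * g ^+ 2 * (Y * P) +
  (14 - 5 / 4 * (17 / 10) ^+ 2 - 2 * (17 / 10) ^+ 3) * (L * g ^+ 3) * Y ^+ 2 +
  (4 - (17 / 10) ^+ 2) * (L * g ^+ 2) * (c2 * X ^+ 2).
  by rewrite /T' /k'; field; rewrite gt_eqF.
have n1 : 0 <= (14 - 5 / 2 * (17 / 10) - 2 * (17 / 10) ^+ 2 : R) by lra.
have n2 : 0 <= (14 - 5 / 4 * (17 / 10) ^+ 2 - 2 * (17 / 10) ^+ 3 : R) by lra.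
have n3 : 0 <= (4 - (17 / 10) ^+ 2 : R) by lra.
have g2 := exprn_gt0 2 g0; have Lg3 := mulr_gt0 L0 (exprn_gt0 3 g0); have Lg2 := mulr_gt0 L0 g2.
have m1 : 0 <= 3 / 4 * (g / L) * P ^+ 2 by apply: mulr_ge0; [apply: mulr_ge0|exact: sqr_ge0].
have m2 := mulr_ge0 (mulr_ge0 n1 (ltW g2)) (mulr_ge0 Y0 P0).
have m3 := mulr_ge0 (mulr_ge0 n2 (ltW Lg3)) (sqr_ge0 Y).
have m4 := mulr_ge0 (mulr_ge0 n3 (ltW Lg2)) (mulr_ge0 c20 (sqr_ge0 X)).
by apply: addr_ge0 => //; apply: addr_ge0 => //; exact: addr_ge0.
Qed.

Variables (v : R) (w : R * R -> R * R).
Hypotheses (v0 : 0 < v) (wv : forall x, vnorm (w x) < v) (Cw : Ck 3 w).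
Variable jt : jets M (lagr v w).

Lemma D2_quadratic_le (z h : V) (c0 c1 c2 : R) : M z -> z 0 i4 = 0 -> h 0 i4 = 0 ->
  vnorm (w (pos z)) <= c0 -> c0 <= v / Num.sqrt 5 -> 0 <= c1 -> 0 <= c2 ->
  vnorm (ddir w (pos z) (pos h)) <= c1 * vnorm (pos h) ->
  vnorm (ddir (fun y => ddir w y (pos h)) (pos z) (pos h)) <= c2 * vnorm (pos h) * vnorm (pos h) ->
  D2 jt z h h <= vnorm (vel z) * beta0 v c0 c1 c2 * vnorm (pos h) ^+ 2 +
    2 * beta1 v c0 c1 * (vnorm (pos h) * vnorm (vel h)) +
    beta2 v c0 / (2 * vnorm (vel z)) * vnorm (vel h) ^+ 2.
Proof.
move=> Mz z4 h4 wc0 c0v c10 c20 wc1 wc2.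
have c00 : 0 <= c0 := le_trans (vnorm_ge0 _) wc0.
have h5 := five_c0 v0 c00 c0v; have cv := c0_lt_v v0 c00 c0v.
have vu := vunder_gt0 v0 c00 c0v; have d0 : 0 < v - c0 by rewrite subr_gt0.
have p0 := vnorm_gt0 (Mz : vel z != vzero R).
apply: (le_trans (D2_travel_le v0 wv Cw jt Mz z4 h4 wc0 c0v c10 c20 wc1 wc2)).
have [_ fle] := ff_bounds v0 wv (pos z) (vel z).
have f0 := ff_ge0 v0 wv (pos z) (vel z); rewrite -/(tau v w z) in fle f0.
have T1 : tau v w z <= vnorm (vel z) * (v - c0)^-1.
  rewrite ler_pdivlMr// mulrC; apply: le_trans fle.
  by rewrite ler_wpM2r// lerD2l lerN2.
have kg : (v - c0)^-1 <= 17 / 10 * (vunder v c0)^-1.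
  have H := vunder_le v0 c00 cv h5.
  by rewrite ler_pdivlMr// mulrC ler_pdivrMr.
have := @quadratic_constants (vunder v c0)^-1 (vnorm (vel z)) (tau v w z) (v - c0)^-1
  (vnorm (vel h)) (c1 * vnorm (pos h)) c2 (vnorm (pos h)).
rewrite invr_gt0 vu p0 invr_ge0 (ltW d0) !vnorm_ge0 mulr_ge0 ?vnorm_ge0//.
move=> /(_ isT isT isT isT isT c20 isT f0 kg T1) H.
apply: le_trans (le_trans _ H) _; rewrite le_eqVlt; apply/orP; left; apply/eqP.
  by field; rewrite !gt_eqF.
by rewrite /beta0 /beta1 /beta2; field; rewrite !gt_eqF.
Qed.

End SecondDerivativeConstants.

(** * The Hessian at the optimum *)

Section TaylorTwo.
Variables (R : realType) (n : nat).
Local Notation V := 'rV[R]_n.+1.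
Variables (U : set V) (g : V -> R) (jt : jets U g) (C : R) (y : V) (r : R).
Hypothesis HC : forall z, snorm (z - y) < r ->
  [/\ U z, `|g z| <= C, forall i, `|G1 jt i z| <= C, forall i j, `|G2 jt i j z| <= C &
     forall i j k, `|G3 jt i j k z| <= C].

Lemma taylor_D0_order2 z h : snorm (z - y) + snorm h < r ->
  `|g (z + h) - g z - D1 jt z h - D2 jt z h h / 2| <= C * snorm h ^+ 3.
Proof.
move=> zhr.
have C0 : 0 <= C.
  have zr : snorm (z - y) < r by apply: le_lt_trans zhr; rewrite lerDl snorm_ge0.
  have [_ g0 _ _ _] := HC zr; exact: le_trans (normr_ge0 _) g0.
(* Subtracting the linear and quadratic terms lets one mean value step reduce the claim to
   [taylor_D1]. *)
pose F s := g (z + s *: h) + (0 + s * - D1 jt z h) + (- (D2 jt z h h / 2)) * s ^+ 2.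
have dF (s : R) : `|s| <= 1 ->
    is_derive s 1 F (D1 jt (z + s *: h) h - D1 jt z h - s * D2 jt z h h).
  move=> s1; have dg := is_derive_G0_line jt (proj1 (and5_ind (fun a _ _ _ _ => conj a Logic.I) (HC (snorm_segment zhr s1)))).
  have d1 := is_derive_affine 0 (- D1 jt z h) s.
  have d2 := is_deriveZ (- (D2 jt z h h / 2)) (is_deriveX 2 (is_derive_id s 1)).
  apply: (is_derive_eq (is_deriveD (is_deriveD dg d1) d2)).
  rewrite /GRing.scale/= expr1; by field.
have n1 : `|1 : R| <= 1 by rewrite normr1.
have [c c1] := mvt_ball n1 dF; rewrite normr1 in c1.
rewrite /F scale1r scale0r addr0 !mul0r !mul1r expr1n expr0n/= !mulr1 mulr0 !addr0 !add0r => E.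
have -> : g (z + h) - g z - D1 jt z h - D2 jt z h h / 2 =
   g (z + h) - D1 jt z h - D2 jt z h h / 2 - g z by ring.
rewrite E.
have zch : snorm (z - y) + snorm (c *: h) < r.
  by apply: le_lt_trans zhr; rewrite lerD2l snormZ ler_piMl// snorm_ge0.
have := taylor_D1 HC h zch; rewrite D2Zl => H; apply: (le_trans H).
have -> : C * snorm h ^+ 3 = C * snorm h ^+ 2 * snorm h by ring.
rewrite ler_wpM2r ?snorm_ge0// ler_wpM2l// lerXn2r ?nnegrE ?snorm_ge0//.
by rewrite snormZ ler_piMl ?snorm_ge0.
Qed.

End TaylorTwo.

Section CompactTube.
Variable R : realType.
Local Notation V := 'rV[R]_6.
Local Notation M := (@moving R).

(** Compact set containing almost all states of a path with constant speed l, length l and zero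
    multiplier; for l nonzero it avoids zero velocity. *)
Definition tube (B l : R) : set V := [set y | [/\ `|y 0 i0| <= B /\ `|y 0 i1| <= B,
  y 0 i2 * y 0 i2 + y 0 i3 * y 0 i3 = l ^+ 2, y 0 i4 = 0 & y 0 i5 = l]].

Lemma compact_tube B l : compact (tube B l).
Proof.
pose A (i : 'I_6) : set R := if i == i4 then `[0, 0]%classic else if i == i5 then `[l, l]%classic
  else `[- (`|B| + `|l|), `|B| + `|l|]%classic.
pose Sp : set V := (fun y : V => y 0 i2 * y 0 i2 + y 0 i3 * y 0 i3) @^-1` [set x | x = l ^+ 2].
pose S0 : set V := (fun y : V => y 0 i0) @^-1` `[- B, B]%classic.
pose S1 : set V := (fun y : V => y 0 i1) @^-1` `[- B, B]%classic.
have c (i : 'I_6) : continuous (fun y : V => y 0 i) by move=> y; exact: coord_continuous.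
have cA : compact [set y : V | forall i, A i (y 0 i)].
  by apply: rV_compact => i; rewrite /A; case: ifP => _; [|case: ifP => _]; exact: segment_compact.
have cSp : closed Sp.
  apply: (continuous_closedP _).1; last exact: closed_eq.
  by move=> y; exact: (cvgD (cvgM (c i2 y) (c i2 y)) (cvgM (c i3 y) (c i3 y))).
have cS i : closed ((fun y : V => y 0 i) @^-1` `[- B, B]%classic).
  by apply: (continuous_closedP _).1; [exact: c|exact: interval_closed].
have -> : tube B l = [set y : V | forall i, A i (y 0 i)] `&` (Sp `&` (S0 `&` S1)).
  apply/seteqP; split => y.
    move=> [[y0 y1] sp y4 y5]; split; last first.
      by split => //; split; rewrite /S0 /S1 /= in_itv/= -ler_norml.
    have sq (a b : R) : a * a + b * b = l ^+ 2 -> `|a| <= `|l|.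
      move=> ab; rewrite -ler_sqr ?nnegrE// !real_normK ?num_real// -ab expr2 lerDl.
      by rewrite -expr2 sqr_ge0.
    have Bl : B <= `|B| + `|l| by rewrite (le_trans (ler_norm B))// lerDl.
    have lB : `|l| <= `|B| + `|l| by rewrite lerDr.
    apply: ord6_ind; rewrite /A /= ?in_itv/= -?ler_norml.
    - exact: le_trans y0 Bl.
    - exact: le_trans y1 Bl.
    - exact: le_trans (sq _ _ sp) lB.
    - by apply: le_trans lB; apply: (sq _ (y 0 i2)); rewrite addrC.
    - by rewrite y4 lexx.
    - by rewrite y5 lexx.
  move=> [HA [sp [s0 s1]]]; split => //.
  - by move: s0 s1; rewrite /S0 /S1 /= !in_itv/= -!ler_norml.
  - by have := HA i4; rewrite /A /= in_itv/= => h; apply/eqP; rewrite eq_le andbC.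
  - by have := HA i5; rewrite /A /= in_itv/= => h; apply/eqP; rewrite eq_le andbC.
by apply: compact_closedI => //; apply: closedI => //; apply: closedI; exact: cS.
Qed.

Lemma tube_moving B l : l != 0 -> tube B l `<=` M.
Proof.
move=> l0 y [_ sp _ _]; rewrite /moving /= /vel; apply: contra l0 => /eqP[y2 y3].
by move: sp; rewrite y2 y3 !mul0r addr0 => /esym/eqP; rewrite sqrf_eq0.
Qed.

Lemma state_tube (xi : R -> R * R) (l : R) : Lip01 xi ->
  ae01 (fun t => vdot (dpath xi t) (dpath xi t) = l ^+ 2) ->
  exists2 B : R, 0 <= B & ae01 (fun t => tube B l (state (mkChi l xi (fun=> 0)) t)).
Proof.
move=> Lxi sp; have rl : regular (mkChi l xi (fun=> 0)) by split => //; exact: abounded_cst.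
have [B0 B00 h0] := abounded_bound (abounded_state i0 rl).
have [B1 B10 h1] := abounded_bound (abounded_state i1 rl).
exists (B0 + B1); first exact: addr_ge0.
apply: (ae01_mp2 (ae01_and h0 h1) sp) => t _ [b0 b1] s; split.
- by split; [apply: (le_trans b0)|apply: (le_trans b1)]; rewrite ?lerDl ?lerDr.
- by rewrite !mxE.
- by rewrite mxE.
- by rewrite mxE.
Qed.

Variables (v : R) (w : R * R -> R * R).
Hypotheses (v0 : 0 < v) (Cw : Ck 3 w) (wv : forall x, vnorm (w x) < v).

Lemma travel_abounded (xi : R -> R * R) (l : R) : l != 0 -> Lip01 xi ->
  ae01 (fun t => vdot (dpath xi t) (dpath xi t) = l ^+ 2) ->
  abounded (fun t => ff v w (xi t) (dpath xi t)).
Proof.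
move=> l0 Lxi sp; have [B _ tb] := state_tube Lxi sp.
have rl : regular (mkChi l xi (fun=> 0)) by split => //; exact: abounded_cst.
have tl := smooth_tame (smooth_lagr v0 Cw wv).
have [C _ HC] := compact_bounded_fun (@compact_tube B l) (@open_moving R) (tube_moving l0) tl.1.
have : abounded (fun t => lagr v w (state (mkChi l xi (fun=> 0)) t)).
  by apply: (abounded_tame tl rl (C := C)); apply: (ae01_mp tb) => t _; exact: HC.
apply: abounded_ae; apply: ae01_all => t _.
rewrite /lagr !mxE /= mul0r addr0 /tau /pos /vel !mxE /=.
by rewrite -!surjective_pairing.
Qed.

End CompactTube.

(** * Length bounds and competitors of the optimal path *)

Section Lengths.
Variable R : realType.
Local Notation V := 'rV[R]_6.
Variables (v : R) (w : R * R -> R * R).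
Hypotheses (v0 : 0 < v) (Cw : Ck 3 w) (wv : forall x, vnorm (w x) < v).


Lemma abounded_vdot_cst (p : R * R) (xi : R -> R * R) : Lip01 xi ->
  abounded (fun t => vdot p (dpath xi t)).
Proof.
move=> /Lip01_dpath[a1 a2 _].
by apply: (@abounded_vdot _ (fun=> p)) => //; exact: abounded_cst.
Qed.

Lemma Int_vdot_dpath (p : R * R) (xi : R -> R * R) : Lip01 xi ->
  Int01 (fun t => vdot p (dpath xi t)) = vdot p (vsub (xi 1) (xi 0)).
Proof.
move=> Lxi; have [K [L1 L2]] := (Lip01P xi).1 Lxi.
have [a1 e1 _] := lip_derive1 L1; have [a2 e2 _] := lip_derive1 L2.
rewrite /vdot /dpath /= IntD ?IntZ ?e1 ?e2//; exact: aboundedZ.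
Qed.

Lemma speed_vnorm (p : R * R) (l : R) : vdot p p = l ^+ 2 -> vnorm p = `|l|.
Proof. by rewrite /vnorm => ->; rewrite sqrtr_sqr. Qed.

(** The displacement is tested against itself: its inner product with the velocity integrates to its
    squared length. *)
Lemma dist_le_length (xi : R -> R * R) (l : R) : Lip01 xi ->
  ae01 (fun t => vdot (dpath xi t) (dpath xi t) = l ^+ 2) ->
  vnorm (vsub (xi 1) (xi 0)) <= `|l|.
Proof.
move=> Lxi sp; set e := vsub _ _.
have : vdot e e <= vnorm e * `|l|.
  rewrite -[leLHS](Int_vdot_dpath e Lxi) -[leRHS]Int_cst; apply: Int_le.
  - exact: abounded_vdot_cst.
  - exact: abounded_cst.
  - apply: (ae01_mp sp) => t _ /speed_vnorm <-.
    exact: le_trans (ler_norm _) (le_vdot _ _).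
rewrite -sqr_vnorm expr2.
have [->|e0] := eqVneq (vnorm e) 0; first by [].
by rewrite ler_pM2l// lt_def e0 vnorm_ge0.
Qed.

Lemma transversal_le_vnorm (u p : R * R) c : vnorm u = 1 -> c <= vdot u p -> c <= vnorm p.
Proof.
move=> u1 cu; apply: (le_trans cu); apply: (le_trans (ler_norm _)).
by apply: (le_trans (le_vdot _ _)); rewrite u1 mul1r.
Qed.


Definition chord (x y : R * R) (t : R) : R * R := vadd x (vscale t (vsub y x)).

Lemma chord_dpath (x y : R * R) t : dpath (chord x y) t = vsub y x.
Proof.
by rewrite /dpath /chord /=; congr (_, _); apply: is_derive1_derive1; exact: is_derive_affine.
Qed.

Lemma chord_inX (x y : R * R) : inX x y (chord x y).
Proof.
split; last by rewrite /chord /vadd /vscale /vsub /= !mul0r !mul1r !addr0 ![_ + (_ - _)]addrC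
  !subrK -!surjective_pairing.
exists (vnorm (vsub y x)) => s t _ _.
have -> : vsub (chord x y s) (chord x y t) = vscale (s - t) (vsub y x).
  by rewrite /vsub /chord /vadd /vscale /=; congr (_, _); ring.
by rewrite vnorm_vscale mulrC.
Qed.

Lemma travel_bounds (xi : R -> R * R) (l c0 : R) : l != 0 -> Lip01 xi ->
  ae01 (fun t => vdot (dpath xi t) (dpath xi t) = l ^+ 2) -> c0 < v ->
  (forall t, I01 t -> vnorm (w (xi t)) <= c0) ->
  `|l| <= (v + c0) * Tt v w xi /\ (v - c0) * Tt v w xi <= `|l|.
Proof.
move=> l0 Lxi sp c0v wc0; have ab := travel_abounded v0 Cw wv l0 Lxi sp.
rewrite /Tt -!IntZ//; split.
- rewrite -[leLHS]Int_cst; apply: Int_le; [exact: abounded_cst|exact: aboundedZ|].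
  apply: (ae01_mp sp) => t It /speed_vnorm <-.
  apply: (le_trans (ff_bounds v0 wv _ _).1); apply: ler_wpM2r; first exact: ff_ge0.
  by rewrite lerD2l wc0.
- rewrite -[leRHS]Int_cst; apply: Int_le; [exact: aboundedZ|exact: abounded_cst|].
  apply: (ae01_mp sp) => t It /speed_vnorm <-.
  apply: le_trans (ff_bounds v0 wv _ _).2; apply: ler_wpM2r; first exact: ff_ge0.
  by rewrite lerD2l lerN2 wc0.
Qed.

(** The straight chord is a competitor with travel time at most its length divided by v - c0, while
    a path of length |L| takes at least |L| / (v + c0). *)
Lemma optimal_length_le (xO xD : R * R) (L c0 : R) (xi : R -> R * R) :
  globsolP v w xO xD L xi -> L != 0 -> xO != xD -> c0 < v ->
  (forall t, I01c t -> vnorm (w (xi t)) <= c0) ->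
  (forall t, I01c t -> vnorm (w (chord xO xD t)) <= c0) ->
  `|L| <= (v + c0) / (v - c0) * vnorm (vsub xD xO).
Proof.
move=> [[[Lxi _] sp] opt] L0 OD c0v wx wc.
have e0 : vnorm (vsub xD xO) != 0.
  apply: contra OD => /eqP e0; have := le_fst_vnorm (vsub xD xO); have := le_snd_vnorm (vsub xD xO).
  rewrite e0 !normr_le0 /= !subr_eq0 => /eqP h2 /eqP h1.
  by rewrite [xO]surjective_pairing [xD]surjective_pairing h1 h2.
have spc : ae01 (fun t => vdot (dpath (chord xO xD) t) (dpath (chord xO xD) t) =
    vnorm (vsub xD xO) ^+ 2) by apply: ae01_all => t _; rewrite chord_dpath sqr_vnorm.
have [_ up] := travel_bounds e0 (chord_inX xO xD).1 spc c0v (fun t It => wc t (I01W It)).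
have [lo _] := travel_bounds L0 Lxi sp c0v (fun t It => wx t (I01W It)).
have le := opt _ _ (conj (chord_inX xO xD) spc).
have vc : 0 < v - c0 by rewrite subr_gt0.
have c00 : 0 <= c0 := le_trans (vnorm_ge0 _) (wx 0 (I01c0 R)).
have vp : 0 <= v + c0 by rewrite addr_ge0 ?(ltW v0).
rewrite (ger0_norm (vnorm_ge0 _)) in up.
move: lo up le; move: (Tt v w xi) (Tt v w _) => T1 T2 lo up le.
apply: (le_trans lo); rewrite -mulrA; apply: ler_wpM2l => //.
by rewrite ler_pdivlMl//; apply: le_trans up; rewrite ler_pM2l.
Qed.

Lemma chord_ellipse (x y : R * R) t a : I01c t -> vnorm (vsub y x) < a ->
  vnorm (vsub (chord x y t) x) + vnorm (vsub (chord x y t) y) <= a.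
Proof.
rewrite /I01c /= in_itv/= => /andP[t0 t1] /ltW; apply: le_trans.
have -> : vsub (chord x y t) x = vscale t (vsub y x).
  by rewrite /vsub /chord /vadd /vscale /=; congr (_, _); ring.
have -> : vsub (chord x y t) y = vscale (t - 1) (vsub y x).
  by rewrite /vsub /chord /vadd /vscale /=; congr (_, _); ring.
rewrite !vnorm_vscale (ger0_norm t0) ler0_norm ?subr_le0// -mulrDl.
by rewrite opprB addrC subrK mul1r.
Qed.

(* Reparametrization at constant speed turns any nearby path into a competitor. *)
Lemma optimal_among_transversal (xO xD : R * R) (L m : R) (xi eta : R -> R * R) :
  globsolP v w xO xD L xi -> inX xO xD eta -> 0 < m ->
  ae01 (fun t => m <= vnorm (dpath eta t)) -> Tt v w xi <= Tt v w eta.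
Proof.
move=> [_ opt] [Le [e0 e1]] m0 me.
have [zeta [l [[Lz z0 z1 l0 sp] [_ TF]]]] := constant_speed Le m0 me.
have -> : Tt v w eta = Tt v w zeta.
  apply/esym/(TF (ff v w)) => [x p k k0|]; first exact: ff_scale.
  by apply: (travel_abounded v0 Cw wv _ Lz sp); rewrite gt_eqF.
by apply: (opt l zeta); split => //; split => //; split; [rewrite z0|rewrite z1].
Qed.

End Lengths.

Lemma second_difference_ge0 (R : realType) (x y z : R) : z <= x -> z <= y -> 0 <= x + y - 2 * z.
Proof. lra. Qed.

Lemma squeeze_contradiction (R : realType) (A m s : R) : 0 < s -> 0 <= m ->
  s * (2 * (m + 1)) <= - A -> - A <= m * s -> False.
Proof. nra. Qed.

(** * The KKT operator at the base point and the second variation of the travel time *)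

Section Hessian.
Variable R : realType.
Local Notation V := 'rV[R]_6.
Local Notation M := (@moving R).
Variables (v : R) (w : R * R -> R * R).
Local Notation l := (lagr v w).
Variables (jt : jets M l) (K : set V) (r C : R).
Hypotheses (K4 : forall y, K y -> y 0 i4 = 0) (KM : K `<=` M) (r0 : 0 < r) (C0 : 0 < C).
Hypothesis HC : forall y, K y -> forall z, snorm (z - y) < r ->
  [/\ M z, `|l z| <= C, forall i, `|G1 jt i z| <= C, forall i j, `|G2 jt i j z| <= C &
     forall i j k, `|G3 jt i j k z| <= C].
Variable a : chi R.
Hypotheses (ra : regular a) (Ka : ae01 (fun t => K (state a t))) (a0 : clam a = fun=> 0).
Implicit Types e d f : chi R.

Lemma snorm0 : snorm (0 : V) = 0.
Proof. by have := snormZ 0 (0 : V); rewrite scale0r normr0 mul0r. Qed.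

Lemma base_close rho : 0 < rho -> close K rho a.
Proof.
move=> rho0; split => //; apply: (ae01_mp Ka) => t _ Kt; exists (state a t) => //.
by rewrite subrr snorm0.
Qed.

Let r2 : 0 < r / 2 := divr_gt0 r0 (ltr0Sn R 1).
Let r2r : r / 2 < r. Proof. by rewrite ltr_pdivrMr// mulr_natr mulr2n ltrDr. Qed.

(** By [Fd_hess] this is F'(a), multiplier directions included; on bare directions it is T''. *)
Definition hess e d : R := Int01 (fun t => D2 jt (state a t) (state e t) (state d t)).

Lemma hess_abounded e d : regular e -> regular d ->
  abounded (fun t => D2 jt (state a t) (state e t) (state d t)).
Proof. by move=> re rd; exact: (close_D2_abounded HC (base_close r2) (ltW r2r) re rd). Qed.

Lemma hess_sym e d : hess e d = hess d e.
Proof.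
apply: Int_ae; apply: (ae01_mp Ka) => t _ Kt; apply: D2_sym; first exact: open_moving.
exact: KM.
Qed.

Lemma hessD s e f d : regular e -> regular f -> regular d ->
  hess (cadd e (cscale s f)) d = hess e d + s * hess f d.
Proof.
move=> re rf rd; have ab1 := hess_abounded re rd; have ab2 := hess_abounded rf rd.
have ab3 := aboundedZ s ab2; rewrite /hess -IntZ// -IntD//.
by apply: Int_ae; apply: (ae01_mp (state_add s re rf)) => t _ ->; rewrite D2Dl D2Zl.
Qed.


Lemma Fd_hess e d : regular e -> regular d -> Fd v w a e d = hess e d.
Proof.
move=> re rd; apply: is_derive1_derive1.
exact: (Fd_state K4 C0 HC (base_close r2) r2r re rd).
Qed.

Lemma abounded_coupling e d : regular e -> regular d ->
  abounded (fun t => clam d t * (vdot (dpath (cxi a) t) (dpath (cxi e) t) - cL a * cL e)).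
Proof.
move=> re rd; have [b1 b2 _] := Lip01_dpath re.1; have [b3 b4 _] := Lip01_dpath ra.1.
apply: aboundedM; first exact: rd.2.
by apply: aboundedB; [exact: abounded_vdot|exact: abounded_cst].
Qed.

(** The off-diagonal block of the saddle-point form: the linearised constraint tested with mu. *)
Definition coupling (mu : R -> R) e : R :=
  Int01 (fun t => mu t * (2 * (vdot (dpath (cxi a) t) (dpath (cxi e) t) - cL a * cL e))).

Lemma hess_saddle e d : regular e -> regular d ->
  hess e d = hess (bare e) (bare d) + coupling (clam d) e + coupling (clam e) d.
Proof.
move=> re rd; have ab e' d' : regular e' -> regular d' ->
  abounded (fun t => clam d' t * (2 * (vdot (dpath (cxi a) t) (dpath (cxi e') t) - cL a * cL e'))).
  move=> h1 h2; have := aboundedZ 2 (abounded_coupling h1 h2); congr abounded.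
  by apply/funext => t; ring.
rewrite /hess /coupling -IntD//; last 2 first.
- exact: hess_abounded (regular_bare re) (regular_bare rd).
- exact: ab.
rewrite -IntD//; last 2 first.
- by apply: aboundedD; [exact: hess_abounded (regular_bare re) (regular_bare rd)|exact: ab].
- exact: ab.
apply: Int_ae; apply: (ae01_mp Ka) => t _ Kt; rewrite (D2_cut _ _ _ (KM Kt)).
have -> : cut (state a t) = state a t by rewrite -state_bare; congr (state _ t); case: a a0 => ? ? ? /= ->.
rewrite -!state_bare -!addrA; congr (_ + _).
by rewrite /Q2 !mxE /= a0 /vdot /dpath /=; ring.
Qed.

(** When base point and direction both have zero multiplier, the constraint integrals of [Fop]
    vanish; this turns [Td2] into a derivative of [Fop]. *)
Lemma Td1_Fop s d : clam d = (fun=> 0) ->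
  derive1 (fun s => Tt v w (pathpert (cxi a) (cxi d) s)) s = Fop v w (cadd a (cscale s d)) d.
Proof.
move=> d0; rewrite derive1_shift /Fop /Td1 /= a0 d0.
rewrite [X in _ + 2 * X](_ : _ = 0); last first.
  rewrite -[RHS](Int_cst 0); apply: Int_ae; apply: ae01_all => t _; rewrite mulr0 addr0.
  exact: mul0r.
rewrite [X in _ + _ + X](_ : _ = 0); last first.
  by rewrite -[RHS](Int_cst 0); apply: Int_ae; apply: ae01_all => t _; rewrite mul0r.
rewrite mulr0 !addr0; apply: (congr1 (fun G : R -> R => derive1 G 0)); apply/funext => q.
by apply: (congr1 (Tt v w)); apply/funext => t; rewrite /pathpert /vadd /vscale /=; congr (_, _); ring.
Qed.

Lemma Td2_hess d : regular d -> clam d = (fun=> 0) -> Td2 v w (cxi a) (cxi d) = hess d d.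
Proof.
move=> rd d0; rewrite /Td2 -(Fd_hess rd rd) /Fd; congr (derive1 _ 0).
by apply/funext => s; exact: Td1_Fop.
Qed.

(** In the symmetric difference the first order terms cancel, so minimality can be used directly,
    without the first order conditions. *)
Lemma second_difference_Int d : regular d -> exists s0 m : R, [/\ 0 < s0, 0 <= m &
  forall s, `|s| < s0 ->
  `|Tt v w (cxi (cadd a (cscale s (bare d)))) + Tt v w (cxi (cadd a (cscale (- s) (bare d)))) -
    2 * Tt v w (cxi a) - s ^+ 2 * hess (bare d) (bare d)| <= m * `|s| ^+ 3].
Proof.
move=> rd0; have rd := regular_bare rd0; set b := bare d in rd *.
have [s0 [m [s00 dm s0m cl]]] := close_perturb (base_close r2) r2r rd.
have m0 : 0 <= m by have [t _ h] := ae01_ex dm; exact: le_trans (snorm_ge0 _) h.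
exists s0, (2 * (C * m ^+ 3)); split => //; first by rewrite !mulr_ge0 ?exprn_ge0// ltW.
move=> s ss.
have rr2 : (r / 2 + r) / 2 <= r by move: r0; lra.
have bareE q : bare (cadd a (cscale q b)) = cadd a (cscale q b).
  by rewrite /bare /cadd /cscale /= a0; congr mkChi; apply/funext => t; rewrite mulr0 addr0.
have abl q : `|q| < s0 -> abounded (fun t => l (state (cadd a (cscale q b)) t)).
  move=> qs; apply: (close_abounded (B := C) (cl q qs) rr2 (G0_tame jt)) => y Ky z zy.
  by have [] := HC Ky zy.
have ab0 : abounded (fun t => l (state a t)).
  apply: (close_abounded (B := C) (base_close r2) (ltW r2r) (G0_tame jt)) => y Ky z zy.
  by have [] := HC Ky zy.
have bareaE : bare a = a by rewrite /bare; case: a a0 => ? ? ? /= ->.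
have ns : `|- s| < s0 by rewrite normrN.
have ab1 := abl _ ss; have ab2 := abl _ ns; have abh := hess_abounded rd rd.
rewrite !Tt_state !bareE bareaE /hess -IntD// -!IntZ//.
have ab3 : abounded (fun t => l (state (cadd a (cscale s b)) t) +
    l (state (cadd a (cscale (- s) b)) t) - 2 * l (state a t)).
  by apply: aboundedB; [exact: aboundedD|exact: aboundedZ].
have ab4 : abounded (fun t => s ^+ 2 * D2 jt (state a t) (state b t) (state b t)).
  exact: aboundedZ.
rewrite -IntB//; [|exact: aboundedD|exact: aboundedZ].
rewrite -IntB//.
rewrite -[leRHS]Int_cst; apply: Int_norm_le; [exact: aboundedB|exact: abounded_cst|].
apply: (ae01_mp2 (ae01_and (state_add s ra rd) (state_add (- s) ra rd)) (ae01_and Ka dm)).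
move=> t _ [-> ->] [Kt dt].
have bd q : `|q| = `|s| -> `|l (state a t + q *: state b t) - l (state a t) -
   q * D1 jt (state a t) (state b t) - q ^+ 2 * D2 jt (state a t) (state b t) (state b t) / 2|
   <= C * m ^+ 3 * `|s| ^+ 3.
  move=> qs; have hs : snorm (q *: state b t) <= `|s| * m by rewrite snormZ qs ler_wpM2l.
  have zhr : snorm (state a t - state a t) + snorm (q *: state b t) < r.
    rewrite subrr snorm0 add0r; apply: (le_lt_trans hs).
    apply: (@le_lt_trans _ _ (s0 * m)); first by rewrite ler_wpM2r// ltW.
    by apply: (le_lt_trans s0m); move: r0; lra.
  have := taylor_D0_order2 (HC Kt) zhr; rewrite D2Zl D2Zr.
  have -> : D1 jt (state a t) (q *: state b t) = q * D1 jt (state a t) (state b t).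
    by rewrite /D1 mulr_sumr; apply: eq_bigr => i _; rewrite mxE mulrA.
  rewrite mulrA -expr2 => H; apply: (le_trans H); rewrite -mulrA ler_wpM2l ?(ltW C0)//.
  rewrite -exprMn [m * _]mulrC; apply: lerXn2r; rewrite ?nnegrE ?snorm_ge0//.
  exact: mulr_ge0.
have b1 := bd s erefl; have b2 := bd (- s) (normrN s).
rewrite (_ : _ + _ - _ - _ = (l (state a t + s *: state b t) - l (state a t) -
   s * D1 jt (state a t) (state b t) - s ^+ 2 * D2 jt (state a t) (state b t) (state b t) / 2) +
  (l (state a t + (- s) *: state b t) - l (state a t) -
   (- s) * D1 jt (state a t) (state b t) - (- s) ^+ 2 * D2 jt (state a t) (state b t) (state b t) / 2)).
  apply: (le_trans (ler_normD _ _)); apply: (le_trans (lerD b1 b2)).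
  by have -> : 2 * (C * m ^+ 3) * `|s| ^+ 3 = C * m ^+ 3 * `|s| ^+ 3 + C * m ^+ 3 * `|s| ^+ 3 by ring.
by field.
Qed.

(** Minimality makes the second difference nonnegative, whereas a negative value A would make it
    about s^2 A, with an error of order s^3. *)
Lemma hess_ge0 d : regular d ->
  (exists2 s1 : R, 0 < s1 & forall s, `|s| < s1 ->
     Tt v w (cxi a) <= Tt v w (cxi (cadd a (cscale s (bare d))))) ->
  0 <= hess (bare d) (bare d).
Proof.
move=> rd [s1 s10 opt]; have [s0 [m [s00 m0 H]]] := second_difference_Int rd.
rewrite leNgt; apply/negP; set A := hess _ _ => A0.
pose s := Num.min (Num.min s0 s1 / 2) (- A / (2 * (m + 1))).
have p0 : 0 < 2 * (m + 1) by rewrite mulr_gt0// ltr_wpDl.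
have sp : 0 < s.
  by rewrite lt_min !divr_gt0 ?lt_min ?s00 ?s10 ?oppr_gt0.
have sm : s < Num.min s0 s1.
  have h : 0 < Num.min s0 s1 by rewrite lt_min s00 s10.
  apply: (@le_lt_trans _ _ (Num.min s0 s1 / 2)); first by rewrite ge_min lexx.
  by rewrite ltr_pdivrMr// mulr_natr mulr2n ltrDl.
have [ss0 ss1] : s < s0 /\ s < s1 by move: sm; rewrite lt_min => /andP.
have sA : s * (2 * (m + 1)) <= - A by rewrite -ler_pdivlMr// ge_min lexx orbT.
have ns : `|s| = s by rewrite gtr0_norm.
have h0 := H s; rewrite ns in h0; have {}h0 := h0 ss0.
have o1 := opt s; rewrite ns in o1; have {}o1 := o1 ss1.
have o2 := opt (- s); rewrite normrN ns in o2; have {}o2 := o2 ss1.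
move: h0; rewrite ler_norml => /andP[_ h0].
have d0 := second_difference_ge0 o1 o2.
have h3 : s ^+ 2 * - A <= s ^+ 2 * (m * s).
  rewrite mulrN (_ : s ^+ 2 * (m * s) = m * s ^+ 3); last by ring.
  by apply: le_trans h0; rewrite lerDr.
rewrite ler_pM2l ?exprn_gt0// in h3.
exact: squeeze_contradiction sp m0 sA h3.
Qed.

End Hessian.

Section HessianBound.
Variable R : realType.
Local Notation V := 'rV[R]_6.
Local Notation M := (@moving R).

(** The speed of the optimum lies between T and (v + c0) / (v - c0) T. The position term is largest
    at the upper end and the velocity term at the lower end. For radii up to T this is at most
    [Bbar]. *)
Definition hess_bound (v c0 c1 c2 T : R) : R := beta1 v c0 c1 +
  Num.max ((v + c0) / (v - c0) * T * beta0 v c0 c1 c2) (beta2 v c0 / (2 * T)).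

Lemma quadratic_le_bound (b0 b1 b2 l T rho x y : R) : 0 <= b0 -> 0 <= b1 -> 0 <= b2 -> 0 < T ->
  T <= l -> l <= rho * T -> 0 <= x -> 0 <= y ->
  l * b0 * x ^+ 2 + 2 * b1 * (x * y) + b2 / (2 * l) * y ^+ 2 <=
  (b1 + Num.max (rho * T * b0) (b2 / (2 * T))) * (x + y) ^+ 2.
Proof.
move=> b00 b10 b20 T0 Tl lT x0 y0; set m := Num.max _ _.
have m1 : l * b0 <= m by rewrite le_max ler_wpM2r.
have m2 : b2 / (2 * l) <= m.
  rewrite le_max; apply/orP; right; rewrite ler_wpM2l// lef_pV2 ?posrE ?mulr_gt0//.
    by rewrite ler_pM2l.
  exact: lt_le_trans Tl.
have h1 : l * b0 * x ^+ 2 <= m * x ^+ 2 by rewrite ler_wpM2r ?sqr_ge0.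
have h2 : b2 / (2 * l) * y ^+ 2 <= m * y ^+ 2 by rewrite ler_wpM2r ?sqr_ge0.
have m0 : 0 <= m.
  by apply: le_trans m1; rewrite mulr_ge0// (le_trans (ltW T0)).
have xy : 0 <= x * y := mulr_ge0 x0 y0.
have h3 : 0 <= m * (x * y) := mulr_ge0 m0 xy.
have h4 : 0 <= b1 * x ^+ 2 := mulr_ge0 b10 (sqr_ge0 x).
have h5 : 0 <= b1 * y ^+ 2 := mulr_ge0 b10 (sqr_ge0 y).
rewrite (_ : (b1 + m) * (x + y) ^+ 2 = m * x ^+ 2 + m * y ^+ 2 + 2 * (m * (x * y)) +
  (b1 * x ^+ 2 + b1 * y ^+ 2 + 2 * b1 * (x * y))); last by ring.
lra.
Qed.

Lemma nZ2_ge0 (k : R) (d : R -> R * R) : 0 <= nZ2 k d.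
Proof. by rewrite /nZ2 !addr_ge0// L2N_ge0. Qed.

Variables (v : R) (w : R * R -> R * R).
Hypotheses (v0 : 0 < v) (Cw : Ck 3 w) (wv : forall x, vnorm (w x) < v).
Variables (jt : jets M (lagr v w)) (K : set V) (r C : R).
Hypotheses (KM : K `<=` M) (r0 : 0 < r) (C0 : 0 < C).
Hypothesis HC : forall y, K y -> forall z, snorm (z - y) < r ->
  [/\ M z, `|lagr v w z| <= C, forall i, `|G1 jt i z| <= C, forall i j, `|G2 jt i j z| <= C &
     forall i j k, `|G3 jt i j k z| <= C].
Variable a : chi R.
Hypotheses (ra : regular a) (Ka : ae01 (fun t => K (state a t))) (a0 : clam a = fun=> 0).
Variables (c0 c1 c2 T : R).
Hypotheses (c0v : c0 <= v / Num.sqrt 5) (c10 : 0 <= c1) (c20 : 0 <= c2).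
Hypothesis sp : ae01 (fun t => vdot (dpath (cxi a) t) (dpath (cxi a) t) = cL a ^+ 2).
Hypothesis wc : forall t, I01c t -> [/\ vnorm (w (cxi a t)) <= c0,
  forall h, vnorm (ddir w (cxi a t) h) <= c1 * vnorm h &
  forall h h', vnorm (ddir (fun y => ddir w y h) (cxi a t) h') <= c2 * vnorm h * vnorm h'].
Hypotheses (T0 : 0 < T) (Ta : T <= `|cL a|) (aT : `|cL a| <= (v + c0) / (v - c0) * T).

Lemma hess_le d : regular d ->
  hess jt a (bare d) (bare d) <= hess_bound v c0 c1 c2 T * nZ2 (cL d) (cxi d) ^+ 2.
Proof.
move=> rd; have rb := regular_bare rd; have [ab1 ab2 _] := regular_vnorms rd.
have [wc0 _ _] := wc (I01c0 R); have c00 : 0 <= c0 := le_trans (vnorm_ge0 _) wc0.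
have cv := c0_lt_v v0 c00 c0v; have vu := vunder_gt0 v0 c00 c0v.
have b00 : 0 <= beta0 v c0 c1 c2.
  by rewrite /beta0 addr_ge0// divr_ge0 ?mulr_ge0 ?exprn_ge0// ltW.
have b10 : 0 <= beta1 v c0 c1 by rewrite /beta1 divr_ge0 ?mulr_ge0 ?exprn_ge0// ltW.
have b20 : 0 <= beta2 v c0 by rewrite /beta2 divr_ge0// ltW.
pose X t := vnorm (cxi d t); pose P t := vnorm (dpath (cxi d) t).
pose l := `|cL a|; have l0 : 0 < l := lt_le_trans T0 Ta.
pose q t := l * beta0 v c0 c1 c2 * X t ^+ 2 + 2 * beta1 v c0 c1 * (X t * P t) +
  beta2 v c0 / (2 * l) * P t ^+ 2.
have aX2 : abounded (fun t => X t ^+ 2) := abounded_sqr ab1.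
have aP2 : abounded (fun t => P t ^+ 2) := abounded_sqr ab2.
have aXP : abounded (fun t => X t * P t) := aboundedM ab1 ab2.
have aq : abounded q.
  by apply: aboundedD; [apply: aboundedD|]; exact: aboundedZ.
have e1 : hess jt a (bare d) (bare d) <= Int01 q.
  apply: Int_le => //; first exact: (hess_abounded r0 HC ra Ka rb rb).
  apply: (ae01_mp2 Ka sp) => t It Kt spt; have [wt0 wt1 wt2] := wc (I01W It).
  have pE : pos (state a t) = cxi a t by rewrite /pos !mxE /= -surjective_pairing.
  have vE : vnorm (vel (state a t)) = l.
    by rewrite /vel !mxE; exact: speed_vnorm.
  have pX : pos (state (bare d) t) = cxi d t by rewrite /pos !mxE /= -surjective_pairing.
  have vP : vel (state (bare d) t) = dpath (cxi d) t by rewrite /vel !mxE.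
  have s4 : state a t 0 i4 = 0 by rewrite mxE /= a0.
  have b4 : state (bare d) t 0 i4 = 0 by rewrite mxE.
  have := @D2_quadratic_le _ _ _ v0 wv Cw jt _ _ c0 c1 c2 (KM Kt) s4 b4.
  rewrite pE pX vE vP => H; exact: H.
apply: (le_trans e1); rewrite /q IntD ?IntD ?IntZ//; last 4 first.
- exact: aboundedZ.
- exact: aboundedZ.
- by apply: aboundedD; exact: aboundedZ.
- exact: aboundedZ.
have cs := Int_cauchy_schwarz ab1 ab2.
rewrite -!sqr_L2N.
apply: (@le_trans _ _ (l * beta0 v c0 c1 c2 * L2N X ^+ 2 + 2 * beta1 v c0 c1 * (L2N X * L2N P) +
  beta2 v c0 / (2 * l) * L2N P ^+ 2)).
  by rewrite lerD2r lerD2l ler_wpM2l// mulr_ge0.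
apply: le_trans (quadratic_le_bound b00 b10 b20 T0 Ta aT (L2N_ge0 _) (L2N_ge0 _)) _.
rewrite ler_wpM2l//; first by rewrite addr_ge0// le_max divr_ge0 ?orbT// mulr_ge0// ltW.
rewrite lerXn2r ?nnegrE ?addr_ge0 ?L2N_ge0 ?nZ2_ge0//.
by rewrite /nZ2 -addrA lerDr.
Qed.

End HessianBound.

(** * Inverse of the KKT operator *)

Section Lift.
Variable R : realType.
Local Notation I := (@I01 R).

Lemma abounded_inv (f : R -> R) (m : R) : 0 < m -> abounded f -> ae01 (fun t => m <= f t) ->
  abounded (fun t => (f t)^-1).
Proof.
move=> m0 [g [B [mg gB fg]]] mf.
exists (fun t => (Num.max m (g t))^-1), m^-1; split.
- apply: (measurableT_comp (@measurable_inv R)).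
  by apply: measurable_maxr => //; exact: measurable_cst.
- move=> t; have mm : 0 < Num.max m (g t) by rewrite lt_max m0.
  by rewrite ger0_norm ?invr_ge0 ?(ltW mm)// lef_pV2 ?posrE// le_max lexx.
- by apply: (ae01_mp2 fg mf) => t _ <- h; rewrite max_r.
Qed.

(* Subtracting from f its mean with respect to a weight decreases the weighted L2 norm. *)
Lemma weighted_mean (W f : R -> R) : abounded W -> abounded f -> ae01 (fun t => 0 <= W t) ->
  0 < Int01 W -> let m := Int01 (fun t => W t * f t) / Int01 W in
  Int01 (fun t => W t * (f t - m) ^+ 2) <= Int01 (fun t => W t * f t ^+ 2) /\
  m ^+ 2 * Int01 W <= Int01 (fun t => W t * f t ^+ 2).
Proof.
move=> aW af W0 I0 m; have aWf := aboundedM aW af.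
have aWf2 := aboundedM aW (abounded_sqr af).
have E : Int01 (fun t => W t * (f t - m) ^+ 2) = Int01 (fun t => W t * f t ^+ 2) - m ^+ 2 * Int01 W.
  have -> : m ^+ 2 * Int01 W = 2 * m * Int01 (fun t => W t * f t) - m ^+ 2 * Int01 W.
    by rewrite /m; field; rewrite gt_eqF.
  rewrite -!IntZ// -!IntB//; try (apply: aboundedB || idtac); try exact: aboundedZ => //.
  by congr Int01; apply/funext => t; ring.
have m2 : 0 <= m ^+ 2 * Int01 W by rewrite mulr_ge0 ?sqr_ge0// ltW.
have p0 : 0 <= Int01 (fun t => W t * (f t - m) ^+ 2).
  by apply: Int_ge0; apply: (ae01_mp W0) => t _ h; rewrite mulr_ge0// sqr_ge0.
by split; [rewrite E lerBlDr lerDl|rewrite -subr_ge0 -E].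
Qed.

Lemma L2N_norm (f : R -> R) : L2N (fun t => `|f t|) = L2N f.
Proof.
by congr (Num.sqrt (Int01 _)); apply/funext => t; rewrite real_normK ?num_real.
Qed.

Lemma L2N_le_sqr (f : R -> R) (k : R) : 0 <= k -> Int01 (fun t => f t ^+ 2) <= k ^+ 2 -> L2N f <= k.
Proof. by move=> k0 h; rewrite -ler_sqr ?nnegrE ?L2N_ge0// sqr_L2N. Qed.

Lemma Int_norm_le_L2N (f : R -> R) : abounded f -> Int01 (fun t => `|f t|) <= L2N f.
Proof.
move=> af; have := Int_cauchy_schwarz (abounded_cst 1) (abounded_norm af).
rewrite L2N_cst// mul1r L2N_norm; congr (_ <= _).
by congr Int01; apply/funext => t; rewrite mul1r.
Qed.

Lemma dpath_scaled (u : R * R) (H : R -> R) (t k : R) : is_derive t 1 H k ->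
  dpath (fun s => vscale (H s) u) t = vscale k u.
Proof.
have aux (q : R) : is_derive t 1 H k -> derive1 (fun s => H s * q) t = k * q.
  move=> dH; apply: is_derive1_derive1.
  apply: (is_derive_eq (is_deriveM dH (is_derive_cst q t 1))).
  by rewrite /GRing.scale/= mulr0 add0r mulrC.
by move=> dH; rewrite /dpath /vscale /=; congr (_, _); exact: aux.
Qed.


Lemma Lip01_scaled K (u : R * R) (H : R -> R) : lip K H -> Lip01 (fun s => vscale (H s) u).
Proof.
move=> LH; exists (K * vnorm u) => s t Is It.
have -> : vsub (vscale (H s) u) (vscale (H t) u) = vscale (H s - H t) u.
  by rewrite /vsub /vscale /=; congr (_, _); ring.
by rewrite vnorm_vscale mulrAC; apply: ler_wpM2r; [exact: vnorm_ge0|exact: LH].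
Qed.

Variables (xi : R -> R * R) (L c : R) (u : R * R).
Hypotheses (Lxi : Lip01 xi) (c0 : 0 < c) (u1 : vnorm u = 1).
Hypothesis sp : ae01 (fun t => vdot (dpath xi t) (dpath xi t) = L ^+ 2).
Hypothesis tr : ae01 (fun t => c <= vdot u (dpath xi t)).

Let psi t := vdot u (dpath xi t).

Let psi_le : ae01 (fun t => psi t <= `|L|).
Proof.
apply: (ae01_mp sp) => t _ /speed_vnorm <-; rewrite -[leRHS]mul1r -u1.
exact: le_trans (ler_norm _) (le_vdot _ _).
Qed.

Lemma transversal_le_speed : c <= `|L|.
Proof. by have [t _ [h1 h2]] := ae01_ex (ae01_and tr psi_le); exact: le_trans h1 h2. Qed.

Definition defect (k : R) (d : R -> R * R) (t : R) : R :=
  2 * (vdot (dpath xi t) (dpath d t) - L * k).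

(* The direction is u times a primitive of (mu/2 + L k) / (u . xi'), with k making it vanish at 1. *)
Lemma lift_exists (mu : R -> R) : abounded mu -> exists (k : R) (H : R -> R),
  let d := fun t => vscale (H t) u in
  [/\ indX d, ae01 (fun t => defect k d t = mu t) & nZ2 k d <= 3 / (2 * c) * L2N mu].
Proof.
move=> amu; pose W t := (psi t)^-1; pose f t := mu t / 2.
have cL := transversal_le_speed; have L0 : 0 < `|L| := lt_le_trans c0 cL.
have apsi : abounded psi := abounded_vdot_cst u Lxi.
have aW : abounded W := abounded_inv c0 apsi tr.
have af : abounded f.
  by have := aboundedZ 2^-1 amu; congr abounded; apply/funext => t; rewrite mulrC.
have Wge : ae01 (fun t => `|L|^-1 <= W t).
  apply: (ae01_mp2 tr psi_le) => t _ h1 h2; rewrite lef_pV2 ?posrE//.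
  exact: lt_le_trans h1.
have Wle : ae01 (fun t => W t <= c^-1).
  by apply: (ae01_mp tr) => t _ h; rewrite lef_pV2 ?posrE//; exact: lt_le_trans h.
have W0 : ae01 (fun t => 0 <= W t).
  by apply: (ae01_mp Wge) => t _; apply: le_trans; rewrite invr_ge0.
have I1 : `|L|^-1 <= Int01 W.
  by rewrite -[leLHS]Int_cst; apply: Int_le => //; exact: abounded_cst.
have I0 : 0 < Int01 W by apply: lt_le_trans I1; rewrite invr_gt0.
(* The path ends at 0 exactly when the integral of W (f + L k) vanishes, that is, when L k = - m
   with m the weighted mean of f. *)
have [wm1 wm2] := weighted_mean aW af W0 I0; set m := _ / Int01 W in wm1 wm2.
have Wf2 : Int01 (fun t => W t * f t ^+ 2) <= c^-1 * (L2N mu ^+ 2 / 4).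
  have -> : c^-1 * (L2N mu ^+ 2 / 4) = Int01 (fun t => c^-1 / 4 * mu t ^+ 2).
    by rewrite IntZ ?sqr_L2N; [ring|exact: abounded_sqr].
  have a2 := aboundedM aW (abounded_sqr af).
  have a3 := aboundedZ (c^-1 / 4) (abounded_sqr amu).
  apply: Int_le => //; apply: (ae01_mp Wle) => t _ h.
  have -> : W t * f t ^+ 2 = W t * (mu t ^+ 2 / 4) by rewrite /f; field.
  rewrite [leRHS](_ : _ = c^-1 * (mu t ^+ 2 / 4)); last by ring.
  by rewrite ler_wpM2r// divr_ge0 ?sqr_ge0.
pose phi t := W t * (f t - m).
have aphi : abounded phi.
  by apply: aboundedM => //; apply: aboundedB => //; exact: abounded_cst.
have phi0 : Int01 phi = 0.
  rewrite /phi (_ : (fun t => _) = (fun t => W t * f t - m * W t)); last first.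
    by apply/funext => t; ring.
  rewrite IntB ?IntZ//; [|exact: aboundedM|exact: aboundedZ].
  by rewrite /m divfK ?gt_eqF// subrr.
have phin : L2N phi <= L2N mu / (2 * c).
  apply: L2N_le_sqr; first by rewrite divr_ge0 ?L2N_ge0 ?mulr_ge0// ltW.
  apply: (@le_trans _ _ (c^-1 * Int01 (fun t => W t * (f t - m) ^+ 2))).
    have a1 : abounded (fun t => W t * (f t - m) ^+ 2).
      apply: aboundedM => //; apply: abounded_sqr; apply: aboundedB => //; exact: abounded_cst.
    rewrite -IntZ//; apply: Int_le; [exact: abounded_sqr|exact: aboundedZ|].
    apply: (ae01_mp2 W0 Wle) => t _ h1 h2.
    rewrite /phi exprMn expr2 -!mulrA; apply: ler_wpM2r => //.
    by rewrite mulr_ge0// sqr_ge0.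
  apply: (@le_trans _ _ (c^-1 * (c^-1 * (L2N mu ^+ 2 / 4)))).
    by rewrite ler_wpM2l ?invr_ge0 ?(ltW c0)// (le_trans wm1).
  by rewrite le_eqVlt; apply/orP; left; apply/eqP; field; rewrite gt_eqF.
have [H [K [LH H0 H1 dH]]] := abounded_primitive aphi.
rewrite phi0 in H1; exists (- (m / L)), H => d.
have dd : ae01 (fun t => dpath d t = vscale (phi t) u).
  by apply: (ae01_mp dH) => t _; exact: dpath_scaled.
have nrm q : vnorm (vscale q u) = `|q| by rewrite vnorm_vscale u1 mulr1.
have n1 : L2N (fun t => vnorm (dpath d t)) = L2N phi.
  by rewrite -[RHS]L2N_norm; apply: L2N_ae; apply: (ae01_mp dd) => t _ ->; exact: nrm.
have Lneq : L != 0 by rewrite -normr_gt0.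
have Id : indX d.
  by split; [exact: (Lip01_scaled u LH)|split; rewrite /d /vscale ?H0 ?H1 !mul0r].
split => //.
- apply: (ae01_mp2 dd tr) => t _ E h; rewrite /defect E.
  have -> : vdot (dpath xi t) (vscale (phi t) u) = phi t * psi t.
    by rewrite /psi /vdot /vscale /=; ring.
  have p0 : psi t != 0 by rewrite gt_eqF// (lt_le_trans c0 h).
  by rewrite /phi /W /f; field; rewrite Lneq p0.
have n2 : L2N (fun t => vnorm (d t)) <= L2N phi.
  rewrite -[leRHS]L2N_cst ?L2N_ge0//; apply: L2N_le; [|exact: abounded_cst|].
    have rd : regular (mkChi 0 d (fun=> 0)) by split; [exact: Id.1|exact: abounded_cst].
    by have [] := regular_vnorms rd.
  apply: ae01_all => t It; rewrite vnorm_ge0 /d nrm /=.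
  have := lip_le_Int LH (I01W It); rewrite H0 subr0 => h; apply: (le_trans h).
  apply: le_trans (Int_norm_le_L2N aphi).
  rewrite le_eqVlt; apply/orP; left; apply/eqP; apply: Int_ae.
  by apply: (ae01_mp dH) => s _ /is_derive1_derive1 ->.
(* The integral of W is at least 1 / |L|, so the weighted bound controls m^2 / |L|; the second
   factor 1 / |L| is at most 1 / c. *)
have n3 : `|- (m / L)| <= L2N mu / (2 * c).
  rewrite -ler_sqr ?nnegrE//; last by rewrite divr_ge0 ?L2N_ge0 ?mulr_ge0// ltW.
  rewrite real_normK ?num_real// sqrrN.
  have h1 : m ^+ 2 * `|L|^-1 <= c^-1 * (L2N mu ^+ 2 / 4).
    by apply: le_trans Wf2; apply: le_trans wm2; rewrite ler_wpM2l ?sqr_ge0.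
  have -> : (m / L) ^+ 2 = m ^+ 2 * `|L|^-1 * `|L|^-1.
    by rewrite -mulrA -expr2 exprVn real_normK ?num_real// exprMn exprVn.
  apply: (@le_trans _ _ (c^-1 * (L2N mu ^+ 2 / 4) * c^-1)).
    have i0 : 0 <= `|L|^-1 by rewrite invr_ge0.
    by apply: ler_pM h1 _ => //; [rewrite mulr_ge0 ?sqr_ge0|rewrite lef_pV2 ?posrE].
  by rewrite le_eqVlt; apply/orP; left; apply/eqP; field; rewrite gt_eqF.
rewrite /nZ2 n1; have := le_trans n2 phin.
(* One third each for |k|, for the path and for its derivative. *)
have -> : 3 / (2 * c) * L2N mu = L2N mu / (2 * c) + L2N mu / (2 * c) + L2N mu / (2 * c).
  by field; rewrite gt_eqF.
by move=> h; apply: lerD => //; apply: lerD.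
Qed.

End Lift.

Lemma le_sqrt_div (R : realType) (b x y : R) : 0 < b -> 0 <= x -> b * x ^+ 2 <= y ->
  x <= (Num.sqrt b)^-1 * Num.sqrt y.
Proof.
move=> b0 x0 h; rewrite ler_pdivlMl ?sqrtr_gt0// -(ger0_norm x0) -sqrtr_sqr -sqrtrM ?(ltW b0)//.
exact: ler_wsqrtr.
Qed.

Lemma square_expand (R : realType) (ee eq qq pq ep pp : R) : qq = eq - pq -> pq = ep - pp ->
  eq = ee - ep -> ee = 2 * eq - qq + pp.
Proof. by move=> -> -> ->; ring. Qed.

(** Used with i = 1 / sqrt Bl, s = sqrt N and k the lift constant; zq, zp, ze are norms of q, p and
    e = q + p, aq and E the energy norms of q and e, and l the norm of the multiplier. Solving the
    quadratic inequality for aq, and completing a square for E, bounds both by (i + s k) rho. *)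
Lemma inverse_bound_arith (R : realType) (rho k i s zq zp aq E ze l : R) :
  0 < i -> 0 <= s -> 0 <= k -> 0 <= rho -> 0 <= aq -> 0 <= E -> zq <= i * aq ->
  aq ^+ 2 <= rho * zq + s * k * rho * aq -> zp <= k * rho -> ze <= zq + zp ->
  E ^+ 2 <= 2 * (rho * zq) - aq ^+ 2 + (s * k * rho) ^+ 2 -> l <= (rho + E * s) * k ->
  ze + l <= (i ^+ 2 + 2 * k * (1 + s * i) + s ^+ 2 * k ^+ 2) * rho.
Proof.
move=> i0 s0 k0 r0 a0 E0 zi ha zp1 ze1 hE hl.
have rz : rho * zq <= i * rho * aq.
  by rewrite [leRHS](_ : _ = rho * (i * aq)); [rewrite ler_wpM2l|ring].
have n0 : 0 <= s * k * rho by rewrite !mulr_ge0.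
have ir0 : 0 <= i * rho by rewrite mulr_ge0// ltW.
have a1 : aq <= i * rho + s * k * rho.
  have [->|an] := eqVneq aq 0; first exact: addr_ge0.
  have ap : 0 < aq by rewrite lt_def an.
  rewrite -(ler_pM2r ap) mulrDl -expr2; apply: (le_trans ha); exact: lerD.
have E1 : E <= i * rho + s * k * rho.
  rewrite -ler_sqr ?nnegrE ?addr_ge0//; apply: (le_trans hE).
  have := mulr_ge0 ir0 n0; have := sqr_ge0 (i * rho - aq).
  rewrite (_ : (i * rho - aq) ^+ 2 = (i * rho) ^+ 2 - 2 * (i * rho * aq) + aq ^+ 2); last by ring.
  rewrite (_ : (i * rho + s * k * rho) ^+ 2 = (i * rho) ^+ 2 + 2 * (i * rho * (s * k * rho)) +
    (s * k * rho) ^+ 2); last by ring.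
  move: (i * rho * aq) (i * rho * (s * k * rho)) ((i * rho) ^+ 2) ((s * k * rho) ^+ 2) (aq ^+ 2)
    (rho * zq) rz => x1 x2 x3 x4 x5 x6; clear; lra.
have h1 : zq <= i * (i * rho + s * k * rho).
  by apply: (le_trans zi); rewrite ler_wpM2l// ltW.
have h2 : l <= (rho + (i * rho + s * k * rho) * s) * k.
  by apply: (le_trans hl); rewrite ler_wpM2r// lerD2l ler_wpM2r.
rewrite [leRHS](_ : _ = i * (i * rho + s * k * rho) + k * rho +
  (rho + (i * rho + s * k * rho) * s) * k); last by ring.
by rewrite lerD// (le_trans ze1)// lerD.
Qed.

(* With x = N / Bl >= 1, twice (1 + sqrt x) / (1 + 4 x) is largest at x = 1. *)
Lemma inverse_constant_le (R : realType) (Bl N k M : R) : 0 < Bl -> Bl <= N -> 0 <= k ->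
  4 / Bl <= M -> k * (1 + 4 * N / Bl) <= M -> N * k ^+ 2 <= M ->
  Bl^-1 + 2 * k * (1 + Num.sqrt N / Num.sqrt Bl) + N * k ^+ 2 <= 41 / 20 * M.
Proof.
move=> B0 BN k0 h1 h2 h3.
have N0 : 0 < N := lt_le_trans B0 BN.
set s := Num.sqrt N / Num.sqrt Bl.
have s2 : s ^+ 2 = N / Bl by rewrite /s expr_div_n !sqr_sqrtr// ltW.
have s1 : 1 <= s.
  by rewrite /s ler_pdivlMr ?sqrtr_gt0// mul1r ler_wsqrtr.
have q : 5 * (1 + s) <= 2 * (1 + 4 * s ^+ 2).
  have : 0 <= (s - 1) * (8 * s + 3) by rewrite mulr_ge0 ?subr_ge0//; lra.
  rewrite (_ : (s - 1) * (8 * s + 3) = 8 * s ^+ 2 - 5 * s - 3); last by ring.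
  by move: (s ^+ 2) => y; lra.
rewrite -mulrA -s2 in h2.
have h4 : k * (5 * (1 + s)) <= 2 * M.
  by apply: (le_trans (ler_wpM2l k0 q)); rewrite mulrCA ler_pM2l.
rewrite -mulrA; move: h4; rewrite mulrCA; move: (k * (1 + s)) (N * k ^+ 2) (Bl^-1) h1 h3 => x y z.
lra.
Qed.

(** * Abstract saddle-point estimate *)

Section SaddlePoint.
Variable R : realType.
Implicit Types e d f p q : chi R.

Lemma dpath_add (s : R) e d : regular e -> regular d -> ae01 (fun t =>
  dpath (cxi (cadd e (cscale s d))) t = vadd (dpath (cxi e) t) (vscale s (dpath (cxi d) t))).
Proof.
move=> re rd; apply: (ae01_mp (state_add s re rd)) => t _ E.
have E2 := congr1 (fun z : 'rV_6 => z 0 i2) E; have E3 := congr1 (fun z : 'rV_6 => z 0 i3) E.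
rewrite !mxE /= in E2 E3.
by rewrite /vadd /vscale /=; apply: injective_projections.
Qed.

Lemma nZ2_sub e d : regular e -> regular d -> nZ2 (cL e) (cxi e) <=
  nZ2 (cL (cadd e (cscale (-1) d))) (cxi (cadd e (cscale (-1) d))) + nZ2 (cL d) (cxi d).
Proof.
move=> re rd; set q := cadd _ _; have rq : regular q := regular_add (-1) re rd.
have [e1 e2 _] := regular_vnorms re; have [d1 d2 _] := regular_vnorms rd.
have [q1 q2 _] := regular_vnorms rq.
have split_norm (x y z : R -> R * R) : abounded (fun t => vnorm (x t)) ->
    abounded (fun t => vnorm (y t)) -> abounded (fun t => vnorm (z t)) ->
    ae01 (fun t => x t = vadd (y t) (z t)) ->
    L2N (fun t => vnorm (x t)) <= L2N (fun t => vnorm (y t)) + L2N (fun t => vnorm (z t)).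
  move=> ax ay az E; apply: le_trans (L2N_triangle ay az); apply: L2N_le => //.
    exact: aboundedD.
  by apply: (ae01_mp E) => t _ ->; rewrite vnorm_ge0 vnorm_vadd.
have h0 : `|cL e| <= `|cL q| + `|cL d|.
  by apply: le_trans (ler_normD _ _); rewrite /q /= mulN1r subrK.
have h1 := split_norm (cxi e) (cxi q) (cxi d) e1 q1 d1.
have h2 := split_norm (dpath (cxi e)) (dpath (cxi q)) (dpath (cxi d)) e2 q2 d2.
have vE (x y : R * R) : x = vadd (vadd x (vscale (-1) y)) y.
  by rewrite [LHS]surjective_pairing /vadd /vscale /=; congr (_, _); ring.
have {}h1 := h1 (ae01_all (fun t _ => vE _ _)).
have E2 : ae01 (fun t => dpath (cxi e) t = vadd (dpath (cxi q) t) (dpath (cxi d) t)).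
  by apply: (ae01_mp (dpath_add (-1) re rd)) => t _ E; rewrite -/q in E; rewrite E; exact: vE.
have {}h2 := h2 E2.
have := lerD (lerD h0 h1) h2; rewrite [X in _ <= X + _]addrACA [X in _ <= X]addrACA.
exact.
Qed.

Lemma nY2_bare e : nY2 (bare e) = nZ2 (cL e) (cxi e).
Proof.
rewrite /nY2 /bare /= (_ : L2N (fun t : R => `|0|) = 0) ?addr0//.
by rewrite normr0; exact: L2N_cst.
Qed.

Lemma indY_regular d : indY d -> regular d.
Proof. by move=> [[Ld _] ld]; split => //; exact: Linf_abounded. Qed.

Lemma Linf_cst (k : R) : Linf (fun=> k).
Proof.
split; first exact: measurable_cst.
by exists `|k|; apply: ae01_all.
Qed.

Lemma indX_add (s : R) e d : indX (cxi e) -> indX (cxi d) -> indX (cxi (cadd e (cscale s d))).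
Proof.
move=> [Le [e0 e1]] [Ld [d0 d1]]; split; first exact: (Lip01D Le (Lip01Z s Ld)).
by split; rewrite /= ?e0 ?e1 ?d0 ?d1 /vadd /vscale /= !mulr0 !addr0.
Qed.

Lemma indX0 : indX (fun=> vzero R).
Proof.
split => //; exists 0 => s t _ _; rewrite mul0r.
have -> : vsub (vzero R) (vzero R) = vscale 0 (vzero R) by rewrite /vsub /vscale /= subrr mulr0.
by rewrite vnorm_vscale normr0 mul0r.
Qed.

Variables (a : chi R) (c : R) (u : R * R).
Local Notation xi := (cxi a).
Local Notation L := (cL a).
Hypotheses (La : Lip01 xi) (c0 : 0 < c) (u1 : vnorm u = 1).
Hypothesis sp : ae01 (fun t => vdot (dpath xi t) (dpath xi t) = L ^+ 2).
Hypothesis tr : ae01 (fun t => c <= vdot u (dpath xi t)).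

Lemma defect_add (s : R) e d : regular e -> regular d -> ae01 (fun t =>
  let q := cadd e (cscale s d) in
  defect xi L (cL q) (cxi q) t = defect xi L (cL e) (cxi e) t + s * defect xi L (cL d) (cxi d) t).
Proof.
move=> re rd; apply: (ae01_mp (dpath_add s re rd)) => t _ E.
by rewrite /defect E /vdot /vadd /vscale /=; ring.
Qed.

Lemma defect_abounded e : regular e -> abounded (defect xi L (cL e) (cxi e)).
Proof.
move=> re; have [b1 b2 _] := Lip01_dpath re.1; have [b3 b4 _] := Lip01_dpath La.
by apply: aboundedZ; apply: aboundedB; [exact: abounded_vdot|exact: abounded_cst].
Qed.

(* B is the Hessian of the Lagrangian in the primal variables, seen as a form on triples. *)
Variable B : chi R -> chi R -> R.
Hypothesis Bsym : forall e d, B e d = B d e.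
Hypothesis BD : forall s e f d, regular e -> regular f -> regular d ->
  B (cadd e (cscale s f)) d = B e d + s * B f d.
Variables (Bl N : R).
Hypothesis Bl0 : 0 < Bl.
Hypothesis B_le : forall d, regular d -> B d d <= N * nZ2 (cL d) (cxi d) ^+ 2.
Hypothesis B_ge0 : forall d, regular d -> indX (cxi d) -> 0 <= B d d.
Hypothesis B_coercive : forall d, regular d -> indX (cxi d) ->
  ae01 (fun t => defect xi L (cL d) (cxi d) t = 0) -> Bl * nZ2 (cL d) (cxi d) ^+ 2 <= B d d.

Lemma BDr s e f d : regular e -> regular f -> regular d ->
  B d (cadd e (cscale s f)) = B d e + s * B d f.
Proof. by move=> *; rewrite ![B d _]Bsym BD. Qed.

Lemma B_cauchy_schwarz e d : regular e -> regular d -> indX (cxi e) -> indX (cxi d) ->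
  B e d ^+ 2 <= B e e * B d d.
Proof.
move=> re rd Ie Id; apply: discriminant; first exact: B_ge0.
move=> s; have := B_ge0 (regular_add (- s) re rd) (indX_add (- s) Ie Id).
rewrite BD ?BDr//; last exact: regular_add.
rewrite (Bsym d e); congr (_ <= _); ring.
Qed.

(** Coercivity and the upper bound are compared on one nonzero kernel direction: t (1 - t) times the
    normal of u, corrected along u to satisfy the constraint. The correction cannot cancel the
    normal component. *)
Lemma hess_bound_ge : Bl <= N.
Proof.
pose up : R * R := (- u.2, u.1); pose H (t : R) := t * (1 - t).
have uu : u.1 * u.1 + u.2 * u.2 = 1.
  by have := sqr_vnorm u; rewrite u1 expr1n => ->.
have LH : lip 1 H.
  move=> s t; rewrite /I01c /= !in_itv/= => /andP[s0 s1] /andP[t0 t1].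
  rewrite (_ : H s - H t = (1 - s - t) * (s - t)); last by rewrite /H; ring.
  rewrite normrM; apply: ler_wpM2r => //; rewrite ler_norml; apply/andP; split; lra.
pose e := mkChi (0 : R) (fun t => vscale (H t) up) (fun=> 0).
have re : regular e by split; [exact: (Lip01_scaled up LH)|exact: abounded_cst].
have Ie : indX (cxi e).
  split; first exact: re.1.
  by split; rewrite /e /vscale /H /= ?subrr ?mul0r ?mulr0 ?mul0r.
have [k [G [Id Ed _]]] := lift_exists La c0 u1 sp tr (defect_abounded re).
pose d := mkChi k (fun t => vscale (G t) u) (fun=> 0).
have rd : regular d by split; [exact: Id.1|exact: abounded_cst].
pose q := cadd e (cscale (-1) d).
have rq : regular q := regular_add (-1) re rd.
have Iq : indX (cxi q) := @indX_add (-1) e d Ie Id.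
have Kq : ae01 (fun t => defect xi L (cL q) (cxi q) t = 0).
  apply: (ae01_mp2 (defect_add (-1) re rd) Ed) => t _ -> E.
  by rewrite [in X in _ + _ * X]/d /= E mulN1r subrr.
have h := le_trans (B_coercive rq Iq Kq) (B_le rq).
have q0 : 0 < nZ2 (cL q) (cxi q).
  rewrite lt_def nZ2_ge0 andbT; apply/eqP => z0.
  have [q1 _ _] := regular_vnorms rq.
  have : L2N (fun t => vnorm (cxi q t)) = 0.
    apply/eqP; rewrite eq_le L2N_ge0 andbT -z0 /nZ2 addrAC lerDr.
    by rewrite addr_ge0// L2N_ge0.
  move=> /(L2N_eq0 q1)/ae01_ex[t]; rewrite /I01 /= in_itv/= => /andP[t0 t1].
  move=> n0; have : `|H t| <= 0.
    rewrite -n0; apply: (@le_trans _ _ (`|vdot up (cxi q t)|)).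
      rewrite (_ : vdot _ _ = H t)//.
      rewrite /q /e /d /vdot /up /vadd /vscale /=.
      by rewrite -[RHS]mulr1 -uu; ring.
    apply: (le_trans (le_vdot _ _)).
    have -> : vnorm up = 1; last by rewrite mul1r.
    by rewrite -u1 /vnorm /vdot /up /=; congr Num.sqrt; ring.
  by rewrite normr_le0 /H mulf_eq0 subr_eq0 !gt_eqF.
by move: h; rewrite ler_pM2r// exprn_gt0.
Qed.

Let N0 : 0 < N := lt_le_trans Bl0 hess_bound_ge.

Definition saddle e d := B e d + coupling a (clam d) e + coupling a (clam e) d.

Lemma coupling_eq0 mu e : ae01 (fun t => defect xi L (cL e) (cxi e) t = 0) -> coupling a mu e = 0.
Proof.
move=> E; rewrite -[RHS](Int_cst 0); apply: Int_ae; apply: (ae01_mp E) => t _.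
by rewrite /defect => ->; rewrite mulr0.
Qed.

Lemma coupling0 e : coupling a (fun=> 0) e = 0.
Proof.
by rewrite -[RHS](Int_cst 0); apply: Int_ae; apply: ae01_all => t _; rewrite mul0r.
Qed.

(** Testing with the defect itself as a pure multiplier direction leaves only the coupling, which
    equals the squared norm of the defect. *)
Lemma saddle_defect_le e (rho : R) : regular e -> indX (cxi e) -> 0 <= rho ->
  (forall d, indY d -> `|saddle e d| <= rho * nY2 d) ->
  L2N (defect xi L (cL e) (cxi e)) <= rho.
Proof.
move=> re Ie rho0 H; set g := defect _ _ _ _.
have ag : abounded g := defect_abounded re.
have [g' Lg gg'] := abounded_Linf ag.
pose d := mkChi 0 (fun=> vzero R) g'.
have Yd : indY d by split => //; exact: indX0.
have rd := indY_regular Yd.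
have dv0 t : dpath (fun=> vzero R) t = vzero R by rewrite /dpath /= derive1_cst.
have z0 : nZ2 0 (fun=> vzero R) = 0.
  rewrite /nZ2 normr0 add0r; have -> : (fun t => vnorm (dpath (fun=> vzero R) t)) = (fun=> 0).
    by apply/funext => t; rewrite dv0 /vnorm /vdot /= mulr0 addr0 sqrtr0.
  have -> : vnorm (vzero R) = 0 by rewrite /vnorm /vdot /= mulr0 addr0 sqrtr0.
  by rewrite L2N_cst// addr0.
have Bed : B e d = 0.
  have Bdd : B d d <= 0 by have := B_le rd; rewrite z0 expr0n /= mulr0.
  have := B_cauchy_schwarz re rd Ie indX0.
  have -> : B d d = 0 by apply/eqP; rewrite eq_le Bdd B_ge0//; exact: indX0.
  by rewrite mulr0 => h; apply/eqP; rewrite -sqrf_eq0 eq_le h sqr_ge0.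
have c2 : coupling a (clam e) d = 0.
  apply: coupling_eq0; apply: ae01_all => t _.
  by rewrite /defect /d /= dv0 /vdot /= !mulr0 addr0 subrr mulr0.
have := H d Yd; rewrite /saddle Bed c2 add0r addr0.
have -> : coupling a (clam d) e = L2N g ^+ 2.
  rewrite sqr_L2N; apply: Int_ae; apply: (ae01_mp gg') => t _ E.
  by rewrite /= -E expr2.
have -> : nY2 d = L2N g.
  rewrite /nY2 -/(nZ2 _ _) z0 add0r -[RHS]L2N_norm; apply: L2N_ae.
  by apply: (ae01_mp gg') => t _ ->.
rewrite ger0_norm ?sqr_ge0// expr2.
have [->//|g0] := eqVneq (L2N g) 0.
by rewrite ler_pM2r// lt_def g0 L2N_ge0.
Qed.

Hypothesis Bbare : forall e d, B (bare e) d = B e d.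

(** Write e = q + p with p the lift of the defect of e and q in the kernel of the constraint.
    Testing with q removes the multiplier, and coercivity bounds q; Cauchy-Schwarz for B handles the
    cross term with p. *)
Lemma saddle_inverse e (rho : R) : indY e -> 0 <= rho ->
  (forall d, indY d -> `|saddle e d| <= rho * nY2 d) ->
  nY2 e <= (Bl^-1 + 2 * (3 / (2 * c)) * (1 + Num.sqrt N / Num.sqrt Bl) + N * (3 / (2 * c)) ^+ 2) * rho.
Proof.
move=> Ye rho0 H; have re := indY_regular Ye; have Ie := Ye.1.
have ng := saddle_defect_le re Ie rho0 H.
have [k1 [G [Ip Ep np]]] := lift_exists La c0 u1 sp tr (defect_abounded re).
set k := 3 / (2 * c) in np *.
have k0 : 0 <= k by rewrite /k divr_ge0// mulr_ge0// ltW.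
pose p := mkChi k1 (fun t => vscale (G t) u) (fun=> 0).
have rp : regular p by split; [exact: Ip.1|exact: abounded_cst].
pose q := cadd e (cscale (-1) p); have rq : regular q := regular_add (-1) re rp.
have Iq : indX (cxi q) := @indX_add (-1) e p Ie Ip.
have Kq : ae01 (fun t => defect xi L (cL q) (cxi q) t = 0).
  apply: (ae01_mp2 (defect_add (-1) re rp) Ep) => t _ -> E.
  by rewrite [in X in _ + _ * X]/p /= E mulN1r subrr.
have coer := B_coercive rq Iq Kq.
have zq0 := nZ2_ge0 (cL q) (cxi q); have ze := nZ2_sub re rp; rewrite -/q in ze.
have zp : nZ2 (cL p) (cxi p) <= k * rho by apply: (le_trans np); rewrite ler_wpM2l.
have zp0 := nZ2_ge0 (cL p) (cxi p).
have sN0 : 0 <= Num.sqrt N := sqrtr_ge0 N.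
have test d : regular d -> indX (cxi d) -> `|B e d + coupling a (clam e) d| <= rho * nZ2 (cL d) (cxi d).
  move=> rd Id; have Yd : indY (bare d) by split; [exact: Id|exact: Linf_cst].
  by have := H _ Yd; rewrite nY2_bare /saddle coupling0 addr0 Bsym Bbare Bsym.
have le_sqrtN f : regular f -> indX (cxi f) -> Num.sqrt (B f f) <= Num.sqrt N * nZ2 (cL f) (cxi f).
  move=> rf If; rewrite -ler_sqr ?nnegrE ?mulr_ge0 ?sqrtr_ge0 ?nZ2_ge0//.
  by rewrite exprMn !sqr_sqrtr ?(ltW N0) ?B_ge0// B_le.
have cs f d : regular f -> regular d -> indX (cxi f) -> indX (cxi d) ->
    `|B f d| <= Num.sqrt (B f f) * Num.sqrt (B d d).
  move=> rf rd If Id; rewrite -ler_sqr ?nnegrE ?mulr_ge0 ?sqrtr_ge0//.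
  by rewrite real_normK ?num_real// exprMn !sqr_sqrtr ?B_ge0// B_cauchy_schwarz.
set aq := Num.sqrt (B q q).
have aq2 : aq ^+ 2 = B q q by rewrite sqr_sqrtr// B_ge0.
have Beq : B e q <= rho * nZ2 (cL q) (cxi q).
  have h := test q rq Iq; rewrite (coupling_eq0 (clam e) Kq) addr0 in h.
  exact: le_trans (ler_norm _) h.
have Bqq : B q q = B e q - B p q by rewrite {1}/q BD// mulN1r.
have Bqp : B q p = B e p - B p p by rewrite {1}/q BD// mulN1r.
have Bee : B e q = B e e - B e p by rewrite /q BDr// mulN1r.
have npp : Num.sqrt (B p p) <= Num.sqrt N * k * rho.
  by apply: (le_trans (le_sqrtN p rp Ip)); rewrite -mulrA ler_wpM2l.
have Bpq : `|B p q| <= Num.sqrt N * k * rho * aq.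
  by apply: (le_trans (cs p q rp rq Ip Iq)); rewrite ler_wpM2r// sqrtr_ge0.
have b0 : 0 < Num.sqrt Bl by rewrite sqrtr_gt0.
have zqa : nZ2 (cL q) (cxi q) <= (Num.sqrt Bl)^-1 * aq := le_sqrt_div Bl0 zq0 coer.
set E := Num.sqrt (B e e).
have E2 : E ^+ 2 = B e e by rewrite sqr_sqrtr// B_ge0.
(* Testing with the lift of the multiplier itself turns the coupling into the squared norm of the
   multiplier. *)
have [k2 [G2 [Ip2 Ep2 np2]]] := lift_exists La c0 u1 sp tr re.2.
pose p2 := mkChi k2 (fun t => vscale (G2 t) u) (fun=> 0).
have rp2 : regular p2 by split; [exact: Ip2.1|exact: abounded_cst].
have coup2 : coupling a (clam e) p2 = L2N (clam e) ^+ 2.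
  by rewrite sqr_L2N; apply: Int_ae; apply: (ae01_mp Ep2) => t _ <-; rewrite expr2.
have lam : L2N (clam e) <= (rho + E * Num.sqrt N) * k.
  have t2 := test p2 rp2 Ip2; rewrite coup2 in t2.
  have c2 := cs e p2 re rp2 Ie Ip2; have l2 := le_sqrtN p2 rp2 Ip2.
  have z20 : 0 <= E := sqrtr_ge0 _.
  have h : L2N (clam e) ^+ 2 <= (rho + E * Num.sqrt N) * k * L2N (clam e).
    apply: (@le_trans _ _ ((rho + E * Num.sqrt N) * nZ2 (cL p2) (cxi p2))); last first.
      by rewrite -mulrA ler_wpM2l// addr_ge0// mulr_ge0.
    rewrite -[leLHS](addKr (B e p2)) mulrDl addrC; apply: lerD.
      exact: le_trans (ler_norm _) t2.
    apply: (@le_trans _ _ `|B e p2|); first by rewrite -normrN ler_norm.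
    by apply: (le_trans c2); rewrite -mulrA ler_wpM2l.
  have [->|l0] := eqVneq (L2N (clam e)) 0.
    by rewrite mulr_ge0// addr_ge0// mulr_ge0.
  by move: h; rewrite expr2 ler_pM2r// lt_def l0 L2N_ge0.
rewrite (_ : nY2 e = nZ2 (cL e) (cxi e) + L2N (clam e)); last first.
  by rewrite /nY2 -/(nZ2 _ _) L2N_norm.
have := @inverse_bound_arith R rho k (Num.sqrt Bl)^-1 (Num.sqrt N) (nZ2 (cL q) (cxi q))
  (nZ2 (cL p) (cxi p)) aq E (nZ2 (cL e) (cxi e)) (L2N (clam e)).
rewrite exprVn (sqr_sqrtr (ltW N0)) (sqr_sqrtr (ltW Bl0)) => A; apply: A => //.
- by rewrite invr_gt0.
- exact: sqrtr_ge0.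
- exact: sqrtr_ge0.
- rewrite aq2 Bqq; apply: lerD => //.
  by apply: le_trans Bpq; rewrite -normrN; exact: ler_norm.
- have pp2 : B p p <= (Num.sqrt N * k * rho) ^+ 2.
    rewrite -[leLHS]sqr_sqrtr ?B_ge0//; apply: lerXn2r => //; rewrite nnegrE ?sqrtr_ge0//.
    by apply: mulr_ge0 => //; apply: mulr_ge0.
  rewrite E2 aq2 (_ : B e e = 2 * B e q - B q q + B p p); last first.
    by rewrite (Bsym q p) in Bqp; exact: square_expand Bqq Bqp Bee.
  apply: lerD pp2; rewrite lerD2r; apply: ler_wpM2l => //; exact: Beq.
Qed.

End SaddlePoint.

(** * Newton steps *)

Section Residual.
Variables (R : realType) (n : nat).
Local Notation V := 'rV[R]_n.+1.
Variables (U : set V) (g : V -> R) (jt : jets U g).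

(* For phi s = D1 (y + s h) d, the residual phi'(1) - (phi 1 - phi 0) and (phi'(1) - phi'(-1)) / 4 both equal
   phi''(0) / 2 up to the error in the linear expansion of phi'. *)
Lemma residual_symmetric (y h d : V) (m e : R) :
  (forall s : R, `|s| <= 1 -> U (y + s *: h)) ->
  (forall s : R, `|s| <= 1 -> `|D2 jt (y + s *: h) h d - D2 jt y h d - s * m| <= e) ->
  `|D2 jt (y + h) h d - D1 jt (y + h) d + D1 jt y d -
    (D2 jt (y + h) h d - D2 jt (y - h) h d) / 4| <= 5 / 2 * e.
Proof.
move=> Us He.
(* The derivative of [F] is the error of the linear expansion of phi', so one mean value step bounds
   phi 1 - phi 0 - phi'(0) - m / 2 by e. *)
pose F s := D1 jt (y + s *: h) d + (0 + s * - D2 jt y h d) + (- (m / 2)) * s ^+ 2.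
have dF (s : R) : `|s| <= 1 -> is_derive s 1 F (D2 jt (y + s *: h) h d - D2 jt y h d - s * m).
  move=> s1; have dg := is_derive_D1_line jt d (Us s s1).
  have d1 := is_derive_affine 0 (- D2 jt y h d) s.
  have d2 := is_deriveZ (- (m / 2)) (is_deriveX 2 (is_derive_id s 1)).
  apply: (is_derive_eq (is_deriveD (is_deriveD dg d1) d2)).
  by rewrite /GRing.scale/= expr1; by field.
have n1 : `|1 : R| <= 1 by rewrite normr1.
have [c c1] := mvt_ball n1 dF; rewrite normr1 in c1.
rewrite /F scale1r scale0r addr0 !mul0r !mul1r !mulr1 expr1n expr0n/= mulr0 !addr0 !add0r mulr1 => E.
have b0 := He c c1; rewrite -E in b0.
have := He 1 n1; rewrite scale1r mul1r => b1.
have nm1 : `|-1 : R| <= 1 by rewrite normrN normr1.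
have := He (-1) nm1; rewrite scaleN1r mulN1r opprK => b2.
move: b0 b1 b2; move: (D2 jt (y + h) h d) (D2 jt (y - h) h d) (D2 jt y h d) (D1 jt (y + h) d)
  (D1 jt y d) => x1 x2 x3 x4 x5; rewrite !ler_norml => /andP[p1 q1] /andP[p2 q2] /andP[p3 q3].
by apply/andP; split; lra.
Qed.

End Residual.

(** * Newton equation, residual and drift *)

Section NewtonStep.
Variable R : realType.
Local Notation V := 'rV[R]_6.
Local Notation M := (@moving R).
Variables (v : R) (w : R * R -> R * R).
Local Notation l := (lagr v w).
Variables (jt : jets M l) (K : set V) (r C : R).
Hypotheses (K4 : forall y, K y -> y 0 i4 = 0) (KM : K `<=` M) (r0 : 0 < r) (C0 : 0 < C).
Hypothesis HC : forall y, K y -> forall z, snorm (z - y) < r ->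
  [/\ M z, `|l z| <= C, forall i, `|G1 jt i z| <= C, forall i j, `|G2 jt i j z| <= C &
     forall i j k, `|G3 jt i j k z| <= C].
Variable a : chi R.
Hypotheses (ra : regular a) (Ka : ae01 (fun t => K (state a t))).
Variable Rad : R.
Hypotheses (R0 : 0 <= Rad) (Radr : 2 * Rad < r).
Implicit Types b d e : chi R.

(** Halfway between 2 Rad and r: states of iterates are within rho of K, with room left for
    differentiating there. *)
Let rho : R := (2 * Rad + r) / 2.
Let rho_r : rho < r.
Proof. by rewrite /rho ltr_pdivrMr// mulr_natr mulr2n ltrD2r. Qed.
Let Rad_rho : 2 * Rad < rho.
Proof. by rewrite /rho ltr_pdivlMr// mulr_natr mulr2n ltrD2l. Qed.

Lemma state_displacement b : regular b -> inN Rad a b ->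
  ae01 (fun t => state b t = state a t + state (csub b a) t /\ snorm (state (csub b a) t) <= 2 * Rad).
Proof.
move=> rb Nb; have rs := regular_sub rb ra.
apply: (ae01_mp2 (state_sub rb ra) (nYinf_snorm rs Nb)) => t _ E h; split => //.
by rewrite E addrC subrK.
Qed.

Lemma inN_close b : regular b -> inN Rad a b -> close K rho b.
Proof.
move=> rb Nb; split => //; apply: (ae01_mp2 (state_displacement rb Nb) Ka) => t _ [E h] Kt.
exists (state a t) => //; rewrite E addrAC subrr add0r.
exact: le_lt_trans Rad_rho.
Qed.

Let ca : close K rho a.
Proof.
split => //; apply: (ae01_mp Ka) => t _ Kt; exists (state a t) => //.
rewrite subrr snorm0; apply: le_lt_trans Rad_rho; exact: mulr_ge0.
Qed.

(** Density of F'(b)[b - a] - F(b) + F(a), the Taylor residual of F; [drift] is the density of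
    (F'(b) - F'(a))[e]. *)
Definition residual b d t : R := D2 jt (state b t) (state (csub b a) t) (state d t) -
  D1 jt (state b t) (state d t) + D1 jt (state a t) (state d t).

Definition drift b e d t : R :=
  D2 jt (state b t) (state e t) (state d t) - D2 jt (state a t) (state e t) (state d t).

Lemma residual_abounded b d : regular b -> inN Rad a b -> regular d -> abounded (residual b d).
Proof.
move=> rb Nb rd; have cb := inN_close rb Nb; have rs := regular_sub rb ra.
apply: aboundedD; last exact: (close_D1_abounded HC ca (ltW rho_r) rd).
by apply: aboundedB; [exact: (close_D2_abounded HC cb (ltW rho_r) rs rd)|
  exact: (close_D1_abounded HC cb (ltW rho_r) rd)].
Qed.

Lemma drift_abounded b e d : regular b -> inN Rad a b -> regular e -> regular d ->
  abounded (drift b e d).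
Proof.
move=> rb Nb re rd; have cb := inN_close rb Nb.
by apply: aboundedB; [exact: (close_D2_abounded HC cb (ltW rho_r) re rd)|
  exact: (close_D2_abounded HC ca (ltW rho_r) re rd)].
Qed.

Lemma Fd_inN b e d : regular b -> inN Rad a b -> regular e -> regular d ->
  Fd v w b e d = Int01 (fun t => D2 jt (state b t) (state e t) (state d t)).
Proof.
move=> rb Nb re rd; apply: is_derive1_derive1.
exact: (Fd_state K4 C0 HC (inN_close rb Nb) rho_r re rd).
Qed.

(** The Newton equation at b is rewritten with the fixed operator F'(a) on the left, so that only
    the inverse at the optimum is needed. *)
Lemma newton_identity b b' d : regular b -> inN Rad a b -> regular b' -> regular d ->
  Fop v w a d = 0 -> Fd v w b (csub b' b) d = - Fop v w b d ->
  hess jt a (csub b' a) d = Int01 (residual b d) - Int01 (drift b (csub b' a) d).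
Proof.
move=> rb Nb rb' rd F0; have cb := inN_close rb Nb.
have rs := regular_sub rb ra; have rs' := regular_sub rb' ra; have rn := regular_sub rb' rb.
rewrite (Fd_inN rb Nb rn rd) (Fop_state K4 C0 HC cb rho_r rd) => FE.
rewrite (Fop_state K4 C0 HC ca rho_r rd) in F0.
have h1 := close_D2_abounded HC cb (ltW rho_r) rs' rd.
have h2 := close_D2_abounded HC cb (ltW rho_r) rs rd.
have h3 := close_D2_abounded HC ca (ltW rho_r) rs' rd.
have h4 := close_D1_abounded HC cb (ltW rho_r) rd.
have h5 := close_D1_abounded HC ca (ltW rho_r) rd.
have FE2 : Int01 (fun t => D2 jt (state b t) (state (csub b' b) t) (state d t)) =
    Int01 (fun t => D2 jt (state b t) (state (csub b' a) t) (state d t)) -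
    Int01 (fun t => D2 jt (state b t) (state (csub b a) t) (state d t)).
  rewrite -IntB//; apply: Int_ae.
  apply: (ae01_mp2 (ae01_and (state_sub rb' ra) (state_sub rb ra)) (state_sub rb' rb)) => t _ [-> ->] ->.
  rewrite -[in RHS]mulN1r -D2Zl -D2Dl; congr (D2 jt _ _ _).
  by rewrite scaleN1r opprB addrA subrK.
rewrite FE2 in FE; rewrite /residual /drift /hess IntD ?IntB//; last exact: aboundedB.
by rewrite F0 addr0; move/eqP: FE; rewrite subr_eq addrC => /eqP ->; ring.
Qed.

Lemma drift_le b e d : regular b -> inN Rad a b -> regular e -> regular d ->
  `|Int01 (drift b e d)| <= 8 * C * Rad * nY2 e * nY2 d.
Proof.
move=> rb Nb re rd; have k0 : 0 <= C * (2 * Rad) by rewrite !mulr_ge0// ltW.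
have := @Int_bilinear_le _ (drift b e d) e d _ re rd k0 (drift_abounded rb Nb re rd).
rewrite (_ : 4 * (C * (2 * Rad)) = 8 * C * Rad); last by ring.
apply; apply: (ae01_mp2 (state_displacement rb Nb) Ka) => t _ [E h] Kt.
have zhr : snorm (state a t - state a t) + snorm (state (csub b a) t) < r.
  by rewrite subrr snorm0 add0r; exact: le_lt_trans Radr.
have := taylor_D2 (HC Kt) (state e t) (state d t) zhr; rewrite /drift E => H; apply: (le_trans H).
by rewrite !ler_wpM2r ?snorm_ge0// ler_wpM2l// ltW.
Qed.

Lemma residual_le b d : regular b -> inN Rad a b -> regular d ->
  `|Int01 (residual b d)| <= 16 * C * Rad * nY2 (csub b a) * nY2 d.
Proof.
move=> rb Nb rd; have k0 : 0 <= C * (4 * Rad) by rewrite !mulr_ge0// ltW.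
have rs := regular_sub rb ra.
have := @Int_bilinear_le _ _ _ d _ rs rd k0 (residual_abounded rb Nb rd).
rewrite (_ : 4 * (C * (4 * Rad)) = 16 * C * Rad); last by ring.
apply; apply: (ae01_mp2 (state_displacement rb Nb) Ka) => t _ [E h] Kt.
have zhr : snorm (state a t - state a t) + snorm (state (csub b a) t) < r.
  by rewrite subrr snorm0 add0r; exact: le_lt_trans Radr.
have t2 := taylor_D2 (HC Kt) (state (csub b a) t) (state d t) zhr.
have t1 := taylor_D1 (HC Kt) (state d t) zhr.
rewrite /residual E; set h' := state (csub b a) t in h t1 t2 *.
rewrite [X in `|X|](_ : _ = (D2 jt (state a t + h') h' (state d t) - D2 jt (state a t) h' (state d t)) -
  (D1 jt (state a t + h') (state d t) - D1 jt (state a t) (state d t) - D2 jt (state a t) h' (state d t)));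
  last by ring.
apply: (le_trans (ler_normB _ _)); apply: (le_trans (lerD t2 t1)).
rewrite (_ : _ + _ = C * (2 * snorm h') * snorm h' * snorm (state d t)); last by ring.
rewrite !ler_wpM2r ?snorm_ge0// ler_wpM2l ?(ltW C0)//.
by rewrite (_ : 4 * Rad = 2 * (2 * Rad)) ?ler_pM2l//; ring.
Qed.

(** The constant 20 is 4 from [Int_bilinear_le], times 5 / 2 from [residual_symmetric], times 2 from
    the displacement bound 2 Rad. *)
Lemma residual_sym_le (eps : R) b b' d : 0 <= eps ->
  (forall y, K y -> forall (h d : V) (s : R), snorm h <= 2 * Rad -> `|s| <= 1 ->
    `|D2 jt (y + s *: h) h d - D2 jt y h d - s * D3 jt y h h d| <= eps * snorm h ^+ 2 * snorm d) ->
  regular b -> inN Rad a b -> regular b' -> inN Rad a b' ->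
  ae01 (fun t => state b' t = state a t - state (csub b a) t) -> regular d ->
  `|Int01 (residual b d) - (Fd v w b (csub b a) d - Fd v w b' (csub b a) d) / 4|
    <= 20 * eps * Rad * nY2 (csub b a) * nY2 d.
Proof.
move=> e0 Hu rb Nb rb' Nb' E' rd; have rs := regular_sub rb ra.
rewrite (Fd_inN rb Nb rs rd) (Fd_inN rb' Nb' rs rd).
have h1 := close_D2_abounded HC (inN_close rb Nb) (ltW rho_r) rs rd.
have h2 := close_D2_abounded HC (inN_close rb' Nb') (ltW rho_r) rs rd.
have h3 := residual_abounded rb Nb rd.
have k0 : 0 <= 5 / 2 * eps * (2 * Rad) by rewrite !mulr_ge0.
have h4 := aboundedZ 4^-1 (aboundedB h1 h2).
rewrite -(IntB h1 h2) [_ / 4]mulrC -(IntZ _ (aboundedB h1 h2)) -(IntB h3 h4).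
have := @Int_bilinear_le _ _ _ d _ rs rd k0 (aboundedB h3 h4).
rewrite (_ : 4 * (5 / 2 * eps * (2 * Rad)) = 20 * eps * Rad); last by field.
apply; apply: (ae01_mp2 (ae01_and (state_displacement rb Nb) E') Ka) => t _ [[E h] E2] Kt.
rewrite /residual E E2; set h' := state (csub b a) t in h *.
have Us (s : R) : `|s| <= 1 -> M (state a t + s *: h').
  move=> s1; have zhr : snorm (state a t + s *: h' - state a t) < r.
    rewrite addrAC subrr add0r snormZ; apply: le_lt_trans Radr; apply: le_trans h.
    by rewrite ler_piMl ?snorm_ge0.
  by have [] := HC Kt zhr.
have := residual_symmetric Us (fun s s1 => Hu _ Kt h' (state d t) s h s1).
rewrite [_ / 4]mulrC => H; apply: (le_trans H).
rewrite (_ : _ * (_ * _ * _) = 5 / 2 * eps * snorm h' * snorm h' * snorm (state d t)); last by ring.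
by rewrite !ler_wpM2r ?snorm_ge0// ler_wpM2l// mulr_ge0.
Qed.

End NewtonStep.

Section ChiAlgebra.
Variable R : realType.
Implicit Types a b d e : chi R.

Lemma chi_eq a b : cL a = cL b -> cxi a =1 cxi b -> clam a =1 clam b -> a = b.
Proof.
by case: a => L x l; case: b => L' x' l' /= -> /funext -> /funext ->.
Qed.

(** Writes a scaling as an addition, so that the facts proved for [cadd] apply. *)
Lemma cscaleE (s : R) e : cscale s e = cadd e (cscale (s - 1) e).
Proof.
by apply: chi_eq => [|t|t] /=; [ring|rewrite /vadd /vscale /=; congr (_, _); ring|ring].
Qed.

Lemma regular_scale (s : R) e : regular e -> regular (cscale s e).
Proof. by move=> re; rewrite cscaleE; exact: regular_add. Qed.

Lemma state_scale (s : R) e : regular e -> ae01 (fun t => state (cscale s e) t = s *: state e t).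
Proof.
move=> re; rewrite cscaleE; apply: (ae01_mp (state_add (s - 1) re re)) => t _ ->.
by rewrite -{1}[state e t]scale1r -scalerDl addrC subrK.
Qed.

Lemma dpath_scale (s : R) e : regular e ->
  ae01 (fun t => dpath (cxi (cscale s e)) t = vscale s (dpath (cxi e) t)).
Proof.
move=> re; apply: (ae01_mp (state_scale s re)) => t _ E.
have E2 := congr1 (fun z : 'rV_6 => z 0 i2) E; have E3 := congr1 (fun z : 'rV_6 => z 0 i3) E.
by rewrite !mxE /= in E2 E3; apply: injective_projections.
Qed.

Lemma nY2_scale (s : R) e : regular e -> nY2 (cscale s e) = `|s| * nY2 e.
Proof.
move=> re; have [h1 h2 h3] := regular_vnorms re; have s0 := normr_ge0 s.
rewrite /nY2 !mulrDr -(L2N_Z h1 s0) -(L2N_Z h2 s0) -(L2N_Z h3 s0) /= normrM.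
congr (_ + L2N _ + _ + L2N _).
- by apply/funext => t; rewrite vnorm_vscale.
- by apply: L2N_ae; apply: (ae01_mp (dpath_scale s re)) => t _ ->; rewrite vnorm_vscale.
- by apply/funext => t; rewrite normrM.
Qed.

Lemma LinfN_ae_eq (f g : R -> R) : ae01 (fun t => f t = g t) -> LinfN f = LinfN g.
Proof.
move=> E; congr inf; apply/seteqP; split => C [C0 H]; split => //; by apply: (ae01_mp2 E H) => t _ ->.
Qed.

Lemma nYinf_opp e : regular e -> nYinf (cscale (-1) e) = nYinf e.
Proof.
move=> re; rewrite /nYinf; have -> : `|cL (cscale (-1) e)| = `|cL e| by rewrite /= mulN1r normrN.
have -> : LinfN (fun t => vnorm (cxi (cscale (-1) e) t)) = LinfN (fun t => vnorm (cxi e t)).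
  by apply/LinfN_ae_eq/ae01_all => t _; rewrite vnorm_vscale normrN normr1 mul1r.
have -> : LinfN (fun t => vnorm (dpath (cxi (cscale (-1) e)) t)) =
    LinfN (fun t => vnorm (dpath (cxi e) t)).
  apply/LinfN_ae_eq; apply: (ae01_mp (dpath_scale (-1) re)) => t _ ->.
  by rewrite vnorm_vscale normrN normr1 mul1r.
have -> // : LinfN (fun t => `|clam (cscale (-1) e) t|) = LinfN (fun t => `|clam e t|).
by apply/LinfN_ae_eq/ae01_all => t _; rewrite /= mulN1r normrN.
Qed.

Lemma Linf_add (s : R) (f g : R -> R) : Linf f -> Linf g -> Linf (fun t => f t + s * g t).
Proof.
move=> [mf [C fC]] [mg [D gD]]; split.
  by apply: measurable_funD => //; apply: measurable_funM => //; exact: measurable_cst.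
exists (C + `|s| * D); apply: (ae01_mp2 fC gD) => t _ h1 h2.
by apply: (le_trans (ler_normD _ _)); rewrite normrM; apply: lerD => //; exact: ler_wpM2l.
Qed.

Lemma inY_regular (xO xD : R * R) a : inY xO xD a -> regular a.
Proof. by move=> [[La _] la]; split => //; exact: Linf_abounded. Qed.

Lemma inY_sub (xO xD : R * R) a b : inY xO xD a -> inY xO xD b -> indY (csub b a).
Proof.
move=> [[La [a0 a1]] la] [[Lb [b0 b1]] lb]; rewrite csubE; split.
  split; first exact: (Lip01D Lb (Lip01Z (-1) La)).
  by split; rewrite /= ?a0 ?a1 ?b0 ?b1 /vadd /vscale /vzero /= !mulN1r !subrr.
by have := Linf_add (-1) lb la.
Qed.

Lemma inY_add (xO xD : R * R) (s : R) a d : inY xO xD a -> indY d -> inY xO xD (cadd a (cscale s d)).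
Proof.
move=> [[La [a0 a1]] la] [[Ld [d0 d1]] ld]; split; last exact: Linf_add.
split; first exact: (Lip01D La (Lip01Z s Ld)).
rewrite /= d0 d1 a0 a1 /vadd /vscale /vzero /= !mulr0 !addr0.
by rewrite -!surjective_pairing.
Qed.

Lemma indY_scale (s : R) d : indY d -> indY (cscale s d).
Proof.
move=> [Id ld]; rewrite cscaleE; split; first exact: (@indX_add _ (s - 1) d d Id Id).
by have := Linf_add (s - 1) ld ld.
Qed.

Lemma csub_reflect a b : csub (cadd a (cscale (-1) (csub b a))) a = cscale (-1) (csub b a).
Proof.
by apply: chi_eq => [|t|t] /=; [ring|rewrite /vsub /vadd /vscale /=; congr (_, _); ring|ring].
Qed.

Lemma csub_reflect2 a b : csub b (cadd a (cscale (-1) (csub b a))) = cscale 2 (csub b a).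
Proof.
by apply: chi_eq => [|t|t] /=; [ring|rewrite /vsub /vadd /vscale /=; congr (_, _); ring|ring].
Qed.

End ChiAlgebra.

(** * Consequences of the definition of omega2 *)

Section LipschitzConstant.
Variable R : realType.
Local Notation V := 'rV[R]_6.
Local Notation M := (@moving R).
Variables (v : R) (w : R * R -> R * R).
Local Notation l := (lagr v w).
Variables (jt : jets M l) (K : set V) (r C : R).
Hypotheses (K4 : forall y, K y -> y 0 i4 = 0) (KM : K `<=` M) (r0 : 0 < r) (C0 : 0 < C).
Hypothesis HC : forall y, K y -> forall z, snorm (z - y) < r ->
  [/\ M z, `|l z| <= C, forall i, `|G1 jt i z| <= C, forall i j, `|G2 jt i j z| <= C &
     forall i j k, `|G3 jt i j k z| <= C].
Variables (xO xD : R * R) (a : chi R).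
Hypotheses (Ya : inY xO xD a) (Ka : ae01 (fun t => K (state a t))).
Variables (Rad Bhat : R).
Hypotheses (R0 : 0 < Rad) (Radr : 2 * Rad < r).
Hypothesis ok : Bhat_ok v w xO xD a Rad Bhat.
Implicit Types b d e : chi R.

Let ra : regular a := inY_regular Ya.

Lemma Fd_scale b e d (s : R) : regular b -> inN Rad a b -> regular e -> regular d ->
  Fd v w b (cscale s e) d = s * Fd v w b e d.
Proof.
move=> rb Nb re rd.
rewrite !(Fd_inN K4 C0 HC ra Ka Radr rb Nb) //; last exact: regular_scale.
rewrite -IntZ; last first.
  by apply: (close_D2_abounded HC (inN_close ra Ka Radr rb Nb) _ re rd); move: Radr; lra.
by apply: Int_ae; apply: (ae01_mp (state_scale s re)) => t _ ->; rewrite D2Zl.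
Qed.

Lemma Fd_scaler b e d (s : R) : regular b -> inN Rad a b -> regular e -> regular d ->
  Fd v w b e (cscale s d) = s * Fd v w b e d.
Proof.
move=> rb Nb re rd.
rewrite !(Fd_inN K4 C0 HC ra Ka Radr rb Nb) //; last exact: regular_scale.
rewrite -IntZ; last first.
  by apply: (close_D2_abounded HC (inN_close ra Ka Radr rb Nb) _ re rd); move: Radr; lra.
by apply: Int_ae; apply: (ae01_mp (state_scale s rd)) => t _ ->; rewrite D2Zr.
Qed.

(** [Bhat_ok] tests directions of norm at most 1. Dividing d by its norm plus e and letting e tend
    to 0 also covers directions of norm 0. *)
Lemma omega2_homogeneous b b' d : inY xO xD b -> inY xO xD b' -> inN Rad a b -> inN Rad a b' ->
  indY d -> `|Fd v w b (csub b b') d - Fd v w b' (csub b b') d| <=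
    omega2 Bhat Rad * nY2 (csub b b') * nY2 d.
Proof.
move=> Yb Yb' Nb Nb' Yd; have rb := inY_regular Yb; have rb' := inY_regular Yb'.
have rd := indY_regular Yd; have rs := regular_sub rb rb'.
set X := `|_|; set W := omega2 _ _ * _.
have main (e : R) : 0 < e -> X <= W * (nY2 d + e).
  move=> e0; have n0 : 0 < nY2 d + e by rewrite ltr_wpDl ?nY2_ge0.
  have i0 : 0 <= (nY2 d + e)^-1 by rewrite invr_ge0 ltW.
  have small : nY2 (cscale (nY2 d + e)^-1 d) <= 1.
    by rewrite nY2_scale// ger0_norm// ler_pdivrMl// mulr1 lerDl ltW.
  have := ok Yb' Yb Nb' Nb (indY_scale (nY2 d + e)^-1 Yd) small.
  rewrite (Fd_scaler _ rb Nb rs rd) (Fd_scaler _ rb' Nb' rs rd) -mulrBr normrM (ger0_norm i0).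
  by rewrite ler_pdivrMl// mulrC.
have W0 : 0 <= W.
  have d0 : 0 < nY2 d + 1 by rewrite ltr_wpDl ?nY2_ge0.
  by have := le_trans (normr_ge0 _) (main 1 ltr01); rewrite pmulr_lge0.
apply/ler_addgt0Pr => e e0.
have W1 : 0 < W + 1 by rewrite ltr_wpDl.
have q0 : 0 < e / (W + 1) by rewrite divr_gt0.
apply: (le_trans (main _ q0)); rewrite mulrDr lerD2l mulrCA ger_pMr//.
by rewrite ler_pdivrMr// mul1r lerDl.
Qed.

(** The pair b, b' differs by 2 (b - a); this factor appears on both sides of the bound and
    cancels. *)
Lemma omega2_symmetric b : inY xO xD b -> inN Rad a b ->
  let e := csub b a in let b' := cadd a (cscale (-1) e) in
  [/\ inY xO xD b', inN Rad a b', ae01 (fun t => state b' t = state a t - state e t) &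
  forall d, indY d -> `|Fd v w b e d - Fd v w b' e d| <= omega2 Bhat Rad * nY2 e * nY2 d].
Proof.
move=> Yb Nb e b'; have rb := inY_regular Yb; have re : regular e := regular_sub rb ra.
have Yb' : inY xO xD b' := inY_add (-1) Ya (inY_sub Ya Yb).
have rb' := inY_regular Yb'.
have Nb' : inN Rad a b' by rewrite /inN csub_reflect nYinf_opp.
split => //.
  by apply: (ae01_mp (state_add (-1) ra re)) => t _ ->; rewrite scaleN1r.
move=> d Yd; have rd := indY_regular Yd.
have := omega2_homogeneous Yb Yb' Nb Nb' Yd.
rewrite csub_reflect2 -/e nY2_scale// (ger0_norm (ler0n R 2)).
rewrite (Fd_scale 2 rb Nb re rd) (Fd_scale 2 rb' Nb' re rd) -mulrBr normrM (ger0_norm (ler0n R 2)).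
rewrite (_ : _ * (2 * _) * _ = 2 * (omega2 Bhat Rad * nY2 e * nY2 d)); last by ring.
by rewrite ler_pM2l.
Qed.

(* Shifting only L by -Rad and Rad shows that no smaller constant can be admissible. *)
Lemma omega2_ge : 4 * Rad <= omega2 Bhat Rad.
Proof.
pose t := mkChi Rad (fun=> vzero R) (fun=> 0).
pose d := mkChi 0 (fun=> vzero R) (fun=> 1).
have dv0 q : dpath (fun=> vzero R) q = vzero R by rewrite /dpath /= derive1_cst.
have nv0 : vnorm (vzero R) = 0 by rewrite /vnorm /vdot /= mulr0 addr0 sqrtr0.
have Yt : indY t by split; [exact: indX0|exact: Linf_cst].
have Yd : indY d by split; [exact: indX0|exact: Linf_cst].
have rt := indY_regular Yt; have rd := indY_regular Yd.
have l0 : LinfN (fun=> 0 : R) <= 0.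
  by apply: ge_inf; [exists 0 => q []|split => //; exact: ae01_all].
have nt : nYinf t <= Rad.
  have e1 : (fun q => vnorm (dpath (cxi t) q)) = fun=> 0 by apply/funext => q; rewrite /= dv0 nv0.
  rewrite /nYinf e1 /= nv0 normr0 (ger0_norm (ltW R0)).
  by have := LinfN_ge0 (fun=> 0 : R); move: l0; lra.
have n2 s : nY2 (mkChi 0 (fun=> vzero R) (fun=> s)) = `|s|.
  have e1 : (fun q => vnorm (dpath (fun=> vzero R) q)) = fun=> 0 by apply/funext => q; rewrite dv0 nv0.
  by rewrite /nY2 /= e1 nv0 normr0 !L2N_cst// !add0r.
have n2t : nY2 t = Rad.
  have e1 : (fun q => vnorm (dpath (cxi t) q)) = fun=> 0 by apply/funext => q; rewrite /= dv0 nv0.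
  by rewrite /nY2 e1 /= nv0 normr0 !L2N_cst// !addr0 ger0_norm// ltW.
pose a2 := cadd a (cscale 1 t); pose a1 := cadd a (cscale (-1) t).
have Y2 : inY xO xD a2 := inY_add 1 Ya Yt; have Y1 : inY xO xD a1 := inY_add (-1) Ya Yt.
have c2 : csub a2 a = t.
  by apply: chi_eq => [|q|q] /=; [ring|rewrite /vsub /vadd /vscale /vzero /=; congr (_, _); ring|ring].
have c1 : csub a1 a = cscale (-1) t.
  by apply: chi_eq => [|q|q] /=; [ring|rewrite /vsub /vadd /vscale /vzero /=; congr (_, _); ring|ring].
have c21 : csub a2 a1 = cscale 2 t.
  by apply: chi_eq => [|q|q] /=; [ring|rewrite /vsub /vadd /vscale /vzero /=; congr (_, _); ring|ring].
have N2 : inN Rad a a2 by rewrite /inN c2.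
have N1 : inN Rad a a1 by rewrite /inN c1 nYinf_opp.
have r2t := regular_scale 2 rt.
(* When only L moves, the constraint varies through -(L + s Rad)^2; its derivative in the direction
   2 Rad is the value on the right. *)
have FE (s : R) : inN Rad a (cadd a (cscale s t)) ->
    Fd v w (cadd a (cscale s t)) (cscale 2 t) d = - (4 * Rad * (cL a + s * Rad)).
  move=> Ns; have rs := regular_add s ra rt.
  rewrite (Fd_inN K4 C0 HC ra Ka Radr rs Ns r2t rd) -[RHS]Int_cst; apply: Int_ae.
  apply: (ae01_mp2 (inN_close ra Ka Radr rs Ns).2 (state_scale 2 rt)) => q _ [y Ky zy] E.
  have zr : snorm (state (cadd a (cscale s t)) q - y) < r by apply: lt_trans zy _; move: Radr; lra.
  have [Mz _ _ _ _] := HC Ky zr; rewrite D2_cut//.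
  have d0 : cut (state d q) = 0 *: cut (state d q).
    by apply: row6P; rewrite !mxE /= ?derive1_cst ?mul0r.
  by rewrite d0 D2Zr mul0r add0r E /Q2 !mxE /= !derive1_cst; ring.
have nd : nY2 d <= 1 by rewrite n2 normr1.
have := ok Y1 Y2 N1 N2 Yd nd; rewrite c21 nY2_scale// n2t (ger0_norm (ler0n R 2)).
rewrite (FE 1 N2) (FE (-1) N1).
rewrite (_ : _ - _ = - (8 * Rad ^+ 2)); last by ring.
rewrite normrN ger0_norm ?mulr_ge0 ?(ltW R0)//.
rewrite (_ : 8 * Rad ^+ 2 = 4 * Rad * (2 * Rad)) ?ler_pM2r ?mulr_gt0//.
by ring.
Qed.

End LipschitzConstant.

(** The term in n' on the right is at most n' / 100 and is absorbed on the left, at the price of the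
    factor 100 / 99. *)
Lemma newton_rate_arith (R : realType) (n n' A mu q W : R) : 0 <= n -> 0 <= n' -> 0 <= mu -> 0 <= W ->
  n' <= mu * (A * n + q * n') -> mu * q <= 100^-1 -> A <= W -> n' <= mu * (100 / 99 * W) * n.
Proof.
move=> n0 n'0 mu0 W0 h hq AW.
have h1 : mu * (A * n + q * n') <= mu * W * n + 100^-1 * n'.
  rewrite mulrDr !mulrA; apply: lerD; last exact: ler_wpM2r.
  by apply: ler_wpM2r => //; exact: ler_wpM2l.
have h2 : n' - 100^-1 * n' <= mu * W * n by rewrite lerBlDr (le_trans h).
rewrite (_ : mu * (100 / 99 * W) * n = 100 / 99 * (mu * W * n)); last by ring.
rewrite (_ : n' = 100 / 99 * (n' - 100^-1 * n')); last by field.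
by apply: ler_wpM2l h2; rewrite divr_ge0.
Qed.

(** * Contraction of the Newton iteration *)

Section NewtonContraction.
Variable R : realType.
Local Notation V := 'rV[R]_6.
Local Notation M := (@moving R).
Variables (v : R) (w : R * R -> R * R).
Local Notation l := (lagr v w).
Variables (jt : jets M l) (K : set V) (r C : R).
Hypotheses (K4 : forall y, K y -> y 0 i4 = 0) (KM : K `<=` M) (cK : compact K).
Hypotheses (r0 : 0 < r) (C0 : 0 < C).
Hypothesis HC : forall y, K y -> forall z, snorm (z - y) < r ->
  [/\ M z, `|l z| <= C, forall i, `|G1 jt i z| <= C, forall i j, `|G2 jt i j z| <= C &
     forall i j k, `|G3 jt i j k z| <= C].
Variables (xO xD : R * R) (a : chi R).
Hypotheses (Ya : inY xO xD a) (Ka : ae01 (fun t => K (state a t))).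
Hypothesis F0 : forall d, indY d -> Fop v w a d = 0.
Variable mu : R.
Hypothesis mu0 : 0 < mu.
Hypothesis inverse_bound : forall e rho, indY e -> 0 <= rho ->
  (forall d, indY d -> `|hess jt a e d| <= rho * nY2 d) -> nY2 e <= mu * rho.
Implicit Types b d e : chi R.

Let ra : regular a := inY_regular Ya.

Definition newton_step b b' : Prop :=
  forall d, indY d -> Fd v w b (csub b' b) d = - Fop v w b d.

Lemma newton_step_le (Rad A : R) b b' : 0 <= Rad -> 2 * Rad < r -> 0 <= A ->
  inY xO xD b -> inY xO xD b' -> inN Rad a b -> newton_step b b' ->
  (forall d, indY d -> `|Int01 (residual jt a b d)| <= A * nY2 (csub b a) * nY2 d) ->
  nY2 (csub b' a) <= mu * (A * nY2 (csub b a) + 8 * C * Rad * nY2 (csub b' a)).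
Proof.
move=> R0 Rr A0 Yb Yb' Nb st H; have rb := inY_regular Yb; have rb' := inY_regular Yb'.
have C0' := ltW C0; apply: inverse_bound; first exact: (inY_sub Ya Yb').
  by apply: addr_ge0; rewrite !mulr_ge0 ?nY2_ge0.
move=> d Yd; have rd := indY_regular Yd; have rs := regular_sub rb' ra.
rewrite (newton_identity K4 C0 HC ra Ka R0 Rr rb Nb rb' rd (F0 Yd) (st d Yd)).
apply: (le_trans (ler_normB _ _)); rewrite mulrDl; apply: lerD; first exact: H.
exact: (drift_le C0 HC ra Ka R0 Rr rb Nb rs rd).
Qed.

Lemma newton_contraction : exists2 R1 : R, 0 < R1 & forall Rad : R, 0 < Rad -> Rad <= R1 ->
  forall b b', inY xO xD b -> inY xO xD b' -> inN Rad a b -> newton_step b b' ->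
  nY2 (csub b' a) <= 2^-1 * nY2 (csub b a) /\
  forall Bhat, Bhat_ok v w xO xD a Rad Bhat -> 0 <= omega2 Bhat Rad /\
    nY2 (csub b' a) <= mu * (13 / 50 * omega2 Bhat Rad) * nY2 (csub b a).
Proof.
(* With this choice the symmetric error 20 eps Rad is Rad / 100, at most W / 400 because W >= 4 Rad.
   The residual constant is then 101 / 400 W, and after the factor 100 / 99 it is still below 13 /
   50 W. *)
have [eps eps0 epsE] : exists2 eps : R, 0 < eps & 20 * eps = 100^-1.
  by exists (100^-1 / 20); [rewrite divr_gt0// invr_gt0 ltr0n|field].
have [re re0 He] := taylor_D2_uniform (@open_moving R) jt cK KM eps0.
pose Rm := Num.min (r / 4) (re / 4).
have h100 : 0 < 100^-1 :> R by rewrite invr_gt0 ltr0n.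
have muC : 0 < 8 * mu * C by rewrite !mulr_gt0.
(* The second bound makes the drift factor 8 mu C Rad at most 1 / 100; then the residual bound
   without Bhat gives a factor 2 / 99, well below 1 / 2. *)
pose R1 := Num.min Rm (100^-1 / (8 * mu * C)).
have R10 : 0 < R1 by rewrite !lt_min !divr_gt0.
exists R1 => // Rad Rad0 RadR1 b b' Yb Yb' Nb st.
have [Rr [Rre RC]] : 2 * Rad < r /\ 2 * Rad < re /\ mu * (8 * C * Rad) <= 100^-1.
  move: RadR1; rewrite !le_min => /andP[/andP[h1 h2] h3]; split; last split.
  - by move: r0 Rad0 h1; lra.
  - by move: re0 Rad0 h2; lra.
  - rewrite (_ : mu * (8 * C * Rad) = Rad * (8 * mu * C)); last by ring.
    by rewrite -ler_pdivlMr.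
have R0 := ltW Rad0; have rb := inY_regular Yb; have C0' := ltW C0.
have n0 := nY2_ge0 (csub b a); have n0' := nY2_ge0 (csub b' a).
split.
  have A0 : 0 <= 16 * C * Rad by rewrite !mulr_ge0.
  have h := newton_step_le R0 Rr A0 Yb Yb' Nb st
    (fun d Yd => residual_le C0 HC ra Ka R0 Rr rb Nb (indY_regular Yd)).
  have := newton_rate_arith n0 n0' (ltW mu0) A0 h RC (lexx _).
  move=> h'; apply: (le_trans h'); apply: ler_wpM2r => //.
  rewrite (_ : mu * (100 / 99 * (16 * C * Rad)) = 200 / 99 * (mu * (8 * C * Rad))); last by ring.
  by move: RC; lra.
move=> Bhat ok; have [Yr Nr Er sy] := omega2_symmetric K4 C0 HC Ya Ka Rr ok Yb Nb.
have om := omega2_ge K4 C0 HC Ya Ka Rad0 Rr ok.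
set W := omega2 Bhat Rad in om sy *.
have W0 : 0 <= W by apply: le_trans om; rewrite mulr_ge0.
have A0 : 0 <= W / 4 + 20 * eps * Rad by rewrite addr_ge0// ?divr_ge0// !mulr_ge0// ltW.
have Hu y : K y -> forall (h d : V) (s : R), snorm h <= 2 * Rad -> `|s| <= 1 ->
    `|D2 jt (y + s *: h) h d - D2 jt y h d - s * D3 jt y h h d| <= eps * snorm h ^+ 2 * snorm d.
  by move=> Ky h d s hs s1; apply: He => //; exact: le_lt_trans Rre.
have res d : indY d ->
    `|Int01 (residual jt a b d)| <= (W / 4 + 20 * eps * Rad) * nY2 (csub b a) * nY2 d.
  move=> Yd; have h1 := sy d Yd.
  have h2 := residual_sym_le K4 C0 HC ra Ka R0 Rr (ltW eps0) Hu rb Nb (inY_regular Yr) Nr Er (indY_regular Yd).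
  rewrite [X in _ <= X * _]mulrDl [leRHS]mulrDl -[X in `|X|](subrK ((Fd v w b (csub b a) d -
    Fd v w (cadd a (cscale (-1) (csub b a))) (csub b a) d) / 4)).
  apply: (le_trans (ler_normD _ _)); rewrite [leRHS]addrC; apply: lerD; first exact: h2.
  have i4 : 0 <= 4^-1 :> R by rewrite invr_ge0.
  rewrite normrM (ger0_norm i4) mulrC.
  rewrite (_ : W / 4 * _ * _ = 4^-1 * (W * nY2 (csub b a) * nY2 d)); last by ring.
  exact: ler_wpM2l.
have h := newton_step_le R0 Rr A0 Yb Yb' Nb st res.
have W1 : W / 4 + 20 * eps * Rad <= 101 / 400 * W.
  by rewrite epsE; move: om R0; move: (W) => W'; lra.
have W2 : 0 <= 101 / 400 * W by move: W0; move: (W) => W'; lra.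
have := newton_rate_arith n0 n0' (ltW mu0) W2 h RC W1.
move=> h'; split => //; apply: (le_trans h'); apply: ler_wpM2r => //; apply: ler_wpM2l; first exact: ltW.
by move: W0; move: (W) => W'; lra.
Qed.

Lemma newton_step_fixed b : (forall d, indY d -> Fop v w b d = 0) -> newton_step b b.
Proof.
move=> Fb d Yd; rewrite (Fb d Yd) oppr0 /Fd.
have -> : (fun s => Fop v w (cadd b (cscale s (csub b b))) d) = fun=> Fop v w b d.
  apply/funext => s; congr (Fop v w _ d); apply: chi_eq => [|t|t] /=; try ring.
  by rewrite /vadd /vscale /vsub /= !subrr !mulr0 !addr0 -surjective_pairing.
exact: derive1_cst.
Qed.

Lemma nY2_sub_eq0 b : inY xO xD b -> nY2 (csub b a) = 0 ->
  [/\ cL b = cL a, forall t, I01c t -> cxi b t = cxi a t & ae01 (fun t => clam b t = clam a t)].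
Proof.
move=> Yb; have [[Lip [d0 _]] ld] := inY_sub Ya Yb.
have rs := regular_sub (inY_regular Yb) ra; have [h1 h2 h3] := regular_vnorms rs.
set e := csub b a in Lip d0 rs h1 h2 h3 *; rewrite /nY2 => E.
have p1 := normr_ge0 (cL e); have p2 := L2N_ge0 (fun t => vnorm (cxi e t)).
have p3 := L2N_ge0 (fun t => vnorm (dpath (cxi e) t)); have p4 := L2N_ge0 (fun t => `|clam e t|).
have [e1 [e3 e4]] : `|cL e| = 0 /\ L2N (fun t => vnorm (dpath (cxi e) t)) = 0 /\
    L2N (fun t => `|clam e t|) = 0.
  by move: p1 p2 p3 p4 E; move: (L2N _) (L2N _) (L2N _) => x y z; lra.
have dz := L2N_eq0 h2 e3; have lz := L2N_eq0 h3 e4.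
(* The displacement starts at 0 and has zero derivative almost everywhere, so the paths agree at
   every point and not only almost everywhere. *)
have coord (f : R -> R) k : lip k f -> f 0 = 0 -> ae01 (fun t => derive1 f t = 0) ->
    forall t, I01c t -> f t = 0.
  move=> lf f0 df t It; have := lip_le_Int lf It; rewrite f0 subr0.
  have -> : Int01 (fun t => `|derive1 f t|) = 0.
    rewrite -[RHS](Int_cst 0); apply: Int_ae; apply: (ae01_mp df) => s _ ->; exact: normr0.
  by rewrite normr_le0 => /eqP.
have [k [l1 l2]] := (Lip01P (cxi e)).1 Lip.
split.
- by move/eqP: e1; rewrite normr_eq0 /= subr_eq0 => /eqP.
- move=> t It.
  have x1 : (cxi e t).1 = 0.
    apply: (coord (fun t => (cxi e t).1) k l1 _ _ t It); first by rewrite d0.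
    apply: (ae01_mp dz) => s _ E0; apply/eqP; rewrite -normr_le0 -E0.
    exact: (le_fst_vnorm (dpath (cxi e) s)).
  have x2 : (cxi e t).2 = 0.
    apply: (coord (fun t => (cxi e t).2) k l2 _ _ t It); first by rewrite d0.
    apply: (ae01_mp dz) => s _ E0; apply/eqP; rewrite -normr_le0 -E0.
    exact: (le_snd_vnorm (dpath (cxi e) s)).
  by apply: injective_projections; apply/eqP; rewrite -subr_eq0; apply/eqP.
- by apply: (ae01_mp lz) => t _ /eqP; rewrite normr_eq0 /= subr_eq0 => /eqP.
Qed.

End NewtonContraction.

(** * Comparison with omega1 *)

Section RateConstant.
Variable R : realType.
Variables (v c0 c1 c2 T c Rad Bl : R).
Hypotheses (c00 : 0 <= c0) (c0v : c0 < v) (c10 : 0 <= c1) (c20 : 0 <= c2) (T0 : 0 < T) (Bl0 : 0 < Bl).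
Hypotheses (R0 : 0 < Rad) (Rc : Rad < c) (RT : Rad <= T).
Local Notation N := (hess_bound v c0 c1 c2 T).
Local Notation k := (3 / (2 * c)).

Lemma omega1_ge : 0 <= N -> Num.sqrt 2 *
    Num.max (4 / Bl) (Num.max (k * (1 + 4 * N / Bl)) (N * k ^+ 2)) <=
  omega1 Bl (kappaR v c0 T c Rad) (Bbar v c0 c1 c2 T Rad) Rad.
Proof.
move=> N0; have c0' : 0 < c := lt_trans R0 Rc.
have v0 : 0 < v := le_lt_trans c00 c0v.
have vu : 0 < vunder v c0 by rewrite /vunder sqrtr_gt0 subr_gt0 ltr_sqr ?nnegrE// ltW.
have b00 : 0 <= beta0 v c0 c1 c2.
  by rewrite /beta0 addr_ge0// divr_ge0 ?mulr_ge0 ?exprn_ge0// ltW.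
have b20 : 0 <= beta2 v c0 by rewrite /beta2 divr_ge0// ltW.
have ratio : 1 <= (v + c0) / (v - c0).
  by rewrite ler_pdivlMr ?subr_gt0// mul1r lerD2l; move: c00; lra.
have NB : N <= Bbar v c0 c1 c2 T Rad.
  rewrite /hess_bound /Bbar lerD2l ge_max !le_max; apply/andP; split; apply/orP; [left|right].
    by rewrite ler_wpM2r// lerDl ltW.
  (* Here Rad <= T enters, through T + Rad <= 2 T. *)
  rewrite ler_wpM2l// lef_pV2 ?posrE ?mulr_gt0 ?addr_gt0//.
  by rewrite mulr_natl mulr2n lerD2l.
have kap : (kappaR v c0 T c Rad)^-1 >= k.
  rewrite /kappaR; set S := Num.sqrt _.
  (* The quantity squared in the radicand is at least 1, so the radicand is at least 3/8 + 2 = 19/8,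
     above 9/4. *)
  have S1 : 3 / 2 <= S.
    rewrite -[3 / 2]ger0_norm ?divr_ge0// -sqrtr_sqr ler_wsqrtr//.
    have q : 1 <= (v + c0) / (v - c0) + Rad / T.
      by rewrite (le_trans ratio)// lerDl divr_ge0// ltW.
    have : 1 <= ((v + c0) / (v - c0) + Rad / T) ^+ 2 by rewrite exprn_ege1.
    rewrite (_ : (3 / 2) ^+ 2 = 9 / 4); last by field.
    by move: (_ ^+ 2) => x; lra.
  rewrite invf_div ler_pdivlMr ?subr_gt0//.
  apply: le_trans S1; rewrite (_ : _ * (c - Rad) = 3 / 2 * ((c - Rad) / c)).
    by rewrite ler_piMr ?divr_ge0// ler_pdivrMr// mul1r lerBlDr lerDl ltW.
  by field; rewrite gt_eqF.
have k0 : 0 <= k by rewrite divr_ge0// mulr_ge0// ltW.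
set kp := kappaR _ _ _ _ _ in kap *; set Bb := Bbar _ _ _ _ _ _ in NB *.
have NBR : N <= Bb + Rad by rewrite (le_trans NB)// lerDl ltW.
rewrite /omega1 ler_wpM2l ?sqrtr_ge0// !ge_max !le_max lexx /=; apply/andP; split.
  apply/orP; right; apply/orP; left; apply: ler_pM => //.
    by rewrite addr_ge0// divr_ge0 ?mulr_ge0// ltW.
  by rewrite lerD2l ler_wpM2r ?invr_ge0 ?(ltW Bl0)// ler_pM2l.
apply/orP; right; apply/orP; right; rewrite -exprVn; apply: ler_pM => //.
  exact: exprn_ge0.
by apply: lerXn2r => //; rewrite nnegrE (le_trans k0).
Qed.

End RateConstant.

Lemma halving_cvg0 (R : realType) (x : nat -> R) : (forall k, 0 <= x k) ->
  (forall k, x k.+1 <= 2^-1 * x k) -> x @ \oo --> (0 : R).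
Proof.
move=> x0 hx; have bound k : x k <= x 0%N * 2^-1 ^+ k.
  elim: k => [|k IH]; first by rewrite expr0 mulr1.
  by apply: (le_trans (hx k)); rewrite exprS mulrCA ler_pM2l ?invr_gt0.
apply: (squeeze_cvgr (f := fun=> 0) (h := fun k => x 0%N * 2^-1 ^+ k)).
- by near=> k; rewrite x0 bound.
- exact: cvg_cst.
rewrite -[X in _ --> X](mulr0 (x 0%N)); apply: cvgM; first exact: cvg_cst.
by apply: cvg_expr; rewrite ger0_norm ?invr_ge0// invf_lt1// ltr1n.
Unshelve. all: by end_near. Qed.

(** The product (13 / 50) (41 / 20) = 0.533 is below 0.7, half of the lower bound 7 / 5 for sqrt
    2. *)
Lemma rate_le (R : realType) (mu M om1 W n : R) : 0 <= M -> 0 <= W -> 0 <= n -> mu <= 41 / 20 * M ->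
  Num.sqrt 2 * M <= om1 -> mu * (13 / 50 * W) * n <= om1 * W / 2 * n.
Proof.
move=> M0 W0 n0 hm ho; apply: ler_wpM2r => //.
have s2 : 7 / 5 <= Num.sqrt 2 :> R.
  by rewrite -(ger0_norm (_ : 0 <= 7 / 5)) ?divr_ge0// -sqrtr_sqr ler_wsqrtr//; lra.
have h1 : 7 / 5 * M <= om1 by apply: le_trans ho; exact: ler_wpM2r.
rewrite (_ : mu * (13 / 50 * W) = 13 / 50 * mu * W); last by ring.
rewrite (_ : om1 * W / 2 = om1 / 2 * W); last by ring.
by apply: ler_wpM2r => //; lra.
Qed.

(** * Variations of the optimal path *)

Section Optimum.
Variable R : realType.
Variables (v : R) (w : R * R -> R * R) (xO xD : R * R).
Hypotheses (v0 : 0 < v) (Cw : Ck 3 w) (wv : forall x, vnorm (w x) < v).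
Variables (L c : R) (xi : R -> R * R) (u : R * R).
Hypothesis opt : globsolP v w xO xD L xi.
Hypotheses (c0 : 0 < c) (u1 : vnorm u = 1).
Hypothesis tr : ae01 (fun t => c <= vdot u (dpath xi t)).

(** Integrating the transversality condition shows that the displacement has component at least c
    along u. *)
Lemma endpoints_neq : xO != xD.
Proof.
have [[[Lxi [x0 x1]] _] _] := opt; apply/eqP => OD.
have h := Int_vdot_dpath u Lxi.
have : c <= vdot u (vsub (xi 1) (xi 0)).
  rewrite -h -[leLHS]Int_cst; apply: Int_le => //; first exact: abounded_cst.
  exact: abounded_vdot_cst.
by rewrite x0 x1 OD /vdot /vsub /= !subrr !mulr0 addr0 leNgt c0.
Qed.

(** A small perturbation keeps the velocity component along u at least c / 2, so its speed is
    bounded below and it competes after reparametrization. *)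
Lemma optimal_nearby (d : chi R) : regular d -> indX (cxi d) -> let a := mkChi L xi (fun=> 0) in
  exists2 s1 : R, 0 < s1 & forall s, `|s| < s1 ->
    Tt v w (cxi a) <= Tt v w (cxi (cadd a (cscale s (bare d)))).
Proof.
move=> rd Id a; have [[[Lxi [x0 x1]] _] _] := opt.
have ra : regular a by split => //; exact: abounded_cst.
have rb := regular_bare rd; have [_ b2 _] := regular_vnorms rb.
have [m m0 hm] := abounded_bound b2.
have p0 : 0 < 2 * (m + 1) by rewrite mulr_gt0// ltr_wpDl.
exists (c / (2 * (m + 1))); first exact: divr_gt0.
move=> s; rewrite (ltr_pdivlMr _ _ p0) => ss.
apply: (optimal_among_transversal v0 Cw wv (m := c / 2) opt).
- have [Ld [d0 d1]] := Id; split; first exact: (Lip01D Lxi (Lip01Z s Ld)).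
  by rewrite /= x0 x1 d0 d1 /vadd /vscale /= !mulr0 !addr0 -!surjective_pairing.
- by rewrite divr_gt0.
apply: (ae01_mp2 (ae01_and tr hm) (dpath_add s ra rb)) => t _ [ht mt] ->.
apply: (transversal_le_vnorm u1).
have -> : vdot u (vadd (dpath (cxi a) t) (vscale s (dpath (cxi (bare d)) t))) =
   vdot u (dpath xi t) + s * vdot u (dpath (cxi d) t) by rewrite /vdot /vadd /vscale /=; ring.
have h1 : `|s * vdot u (dpath (cxi d) t)| <= `|s| * m.
  rewrite normrM; apply: ler_wpM2l => //; apply: (le_trans (le_vdot _ _)).
  by rewrite u1 mul1r; exact: le_trans (ler_norm _) mt.
have h2 : - (`|s| * m) <= s * vdot u (dpath (cxi d) t).
  by rewrite lerNl; apply: le_trans h1; rewrite -normrN; exact: ler_norm.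
have h3 : `|s| * (2 * (m + 1)) = 2 * (`|s| * m) + 2 * `|s| by ring.
rewrite h3 in ss; have s0 := normr_ge0 s.
move: ht h2 ss s0; move: (vdot u (dpath xi t)) (s * _) (`|s| * m) (`|s|) => y1 y2 y3 y4; lra.
Qed.

End Optimum.

Theorem theorem17 (R : realType) (vbar : R) (xO xD : R * R) (w : R * R -> R * R)
  (a c0 c1 c2 c3 : R) (Ls : R) (xis : R -> R * R) (Bl c : R) (u : R * R) :
  0 < vbar ->
  Ck 3 w ->
  (forall x, vnorm (w x) < vbar) ->
  (* Omega = closed ellipse with foci xO, xD, containing every globally optimal trajectory *)
  vnorm (vsub xD xO) < a ->
  (forall L xi, globsolP vbar w xO xD L xi ->
     forall t, I01c t -> vnorm (vsub (xi t) xO) + vnorm (vsub (xi t) xD) <= a) ->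
  (* bounds on w and its derivatives on Omega *)
  (forall x, vnorm (vsub x xO) + vnorm (vsub x xD) <= a -> vnorm (w x) <= c0) ->
  (forall x h, vnorm (vsub x xO) + vnorm (vsub x xD) <= a ->
     vnorm (ddir w x h) <= c1 * vnorm h) ->
  (forall x h1 h2, vnorm (vsub x xO) + vnorm (vsub x xD) <= a ->
     vnorm (ddir (fun y => ddir w y h1) x h2) <= c2 * vnorm h1 * vnorm h2) ->
  (forall x h1 h2 h3, vnorm (vsub x xO) + vnorm (vsub x xD) <= a ->
     vnorm (ddir (fun y => ddir (fun y' => ddir w y' h1) y h2) x h3)
       <= c3 * vnorm h1 * vnorm h2 * vnorm h3) ->
  c0 <= vbar / Num.sqrt 5 ->
  (* chi star = (L star, xi star, 0) is a global solution of (P) with multiplier 0 *)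
  globsolP vbar w xO xD Ls xis ->
  (* first order conditions *)
  (forall d, indY d -> Fop vbar w (mkChi Ls xis (fun _ => 0)) d = 0) ->
  (* second order sufficient conditions *)
  0 < Bl ->
  (exists kap : R, 0 < kap /\
     forall dl : R -> R, L2 dl -> L2N (fun t => `|dl t|) != 0 ->
     forall eps : R, 0 < eps -> exists (dL : R) (dxi : R -> R * R), indX dxi /\
       kap - eps < Int01 (fun t => dl t *
                     (2 * vdot (dpath xis t) (dpath dxi t) - 2 * Ls * dL))
                   / (L2N (fun t => `|dl t|) * nZ2 dL dxi)) ->
  (forall (dL : R) (dxi : R -> R * R), indX dxi ->
     ae01 (fun t => vdot (dpath dxi t) (dpath xis t) = dL * Ls) ->
     Bl * nZ2 dL dxi ^+ 2 <= Td2 vbar w xis dxi) ->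
  (* uniform transversality *)
  0 < c -> vnorm u = 1 ->
  ae01 (fun t => c <= vdot u (dpath xis t)) ->
  let chis := mkChi Ls xis (fun _ => 0) in
  let Ltil := vnorm (vsub xD xO) in
  exists RC : R, 0 < RC /\
    (* rate estimate, for every admissible constant Bhat *)
    (forall Bhat : R, Bhat_ok vbar w xO xD chis RC Bhat ->
      let om := omega1 Bl (kappaR vbar c0 Ltil c RC) (Bbar vbar c0 c1 c2 Ltil RC) RC
                * omega2 Bhat RC in
      forall it : nat -> chi R, newton_seq vbar w xO xD it ->
        (forall k, inN RC chis (it k)) ->
        forall k, nY2 (csub (it k.+1) chis) <= om / 2 * nY2 (csub (it k) chis)) /\
    (* convergence *)
    (forall it : nat -> chi R, newton_seq vbar w xO xD it ->
        (forall k, inN RC chis (it k)) ->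
        (fun k => nY2 (csub (it k) chis)) @ \oo --> (0 : R)) /\
    (* local uniqueness of the KKT point *)
    (forall b : chi R, inY xO xD b -> inN RC chis b ->
       (forall d, indY d -> Fop vbar w b d = 0) ->
       cL b = Ls /\ (forall t, I01c t -> cxi b t = xis t) /\ ae01 (fun t => clam b t = 0)).
Proof.
move=> v0 Cw wv aL Hell wc0 wc1 wc2 _ c0v opt F0 Bl0 _ sosc c0' u1 tr chis Ltil.
have [[[Lxi [x0 x1]] sp] _] := opt.
have Lc : c <= `|Ls| := transversal_le_speed u1 sp tr.
have Ls0 : Ls != 0 by rewrite -normr_gt0 (lt_le_trans c0').
have OD := endpoints_neq opt c0' tr.
have Om t : I01c t -> vnorm (vsub (xis t) xO) + vnorm (vsub (xis t) xD) <= a := Hell _ _ opt t.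
have Om0 := Om 0 (I01c0 R).
have c00 : 0 <= c0 := le_trans (vnorm_ge0 _) (wc0 _ Om0).
have n10 : vnorm ((1, 0) : R * R) = 1 by rewrite /vnorm /vdot /= mul1r mulr0 addr0 sqrtr1.
have c10 : 0 <= c1 by have := le_trans (vnorm_ge0 _) (wc1 _ (1, 0) Om0); rewrite n10 mulr1.
have c20 : 0 <= c2.
  by have := le_trans (vnorm_ge0 _) (wc2 _ (1, 0) (1, 0) Om0); rewrite n10 !mulr1.
have cv := c0_lt_v v0 c00 c0v.
have T0 : 0 < Ltil.
  rewrite lt_def vnorm_ge0 andbT; apply: contra OD => /eqP e0.
  have := le_fst_vnorm (vsub xD xO); have := le_snd_vnorm (vsub xD xO).
  rewrite -/Ltil e0 !normr_le0 /= !subr_eq0 => /eqP h2 /eqP h1.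
  by rewrite [xO]surjective_pairing [xD]surjective_pairing h1 h2.
have TL : Ltil <= `|Ls| by have := dist_le_length Lxi sp; rewrite x0 x1.
have LT : `|Ls| <= (vbar + c0) / (vbar - c0) * Ltil.
  apply: (optimal_length_le v0 Cw wv opt Ls0 OD cv) => t It; apply: wc0; first exact: Om.
  exact: chord_ellipse.
have Ya : inY xO xD chis by split => //; exact: Linf_cst.
have ra := inY_regular Ya.
have [B _ Ka] := state_tube Lxi sp.
have cK := @compact_tube R B Ls; have KM := @tube_moving R B Ls Ls0.
have K4 y : tube B Ls y -> y 0 i4 = 0 by case.
have [jt _] := smooth_jets (smooth_lagr v0 Cw wv).
have [r [C [r0 C0 HC]]] := jets_tube (@open_moving R) jt cK KM.
pose N := hess_bound vbar c0 c1 c2 Ltil.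
(* Multipliers are stripped from both arguments, which leaves the Hessian of the travel time; the
   identity [Bbare] then holds by computation. *)
pose Bf (e d : chi R) := hess jt chis (bare e) (bare d).
have bareD s (e f : chi R) : bare (cadd e (cscale s f)) = cadd (bare e) (cscale s (bare f)).
  by apply: chi_eq => //= t; rewrite mulr0 addr0.
have Bsym e d : Bf e d = Bf d e := hess_sym jt KM Ka (bare e) (bare d).
have BD s e f d : regular e -> regular f -> regular d -> Bf (cadd e (cscale s f)) d = Bf e d + s * Bf f d.
  by move=> re rf rd; rewrite /Bf bareD (hessD r0 HC ra Ka)//; exact: regular_bare.
have B_le d : regular d -> Bf d d <= N * nZ2 (cL d) (cxi d) ^+ 2.
  apply: (hess_le v0 Cw wv KM r0 HC ra Ka erefl c0v c10 c20 sp _ T0 TL LT) => t It.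
  by have Ot := Om t It; split; [exact: wc0|move=> h; exact: wc1|move=> h h'; exact: wc2].
have B_ge0 d : regular d -> indX (cxi d) -> 0 <= Bf d d.
  move=> rd Id; apply: (hess_ge0 r0 C0 HC ra Ka erefl rd).
  exact: (optimal_nearby v0 Cw wv opt c0' u1 tr rd Id).
have B_co d : regular d -> indX (cxi d) ->
    ae01 (fun t => defect xis Ls (cL d) (cxi d) t = 0) -> Bl * nZ2 (cL d) (cxi d) ^+ 2 <= Bf d d.
  move=> rd Id Ed; rewrite /Bf -(Td2_hess K4 r0 C0 HC ra Ka erefl (regular_bare rd))//.
  apply: sosc => //; apply: (ae01_mp Ed) => t _ /eqP.
  by rewrite /defect mulf_eq0 pnatr_eq0 /= subr_eq0 vdotC mulrC => /eqP.
have BN : Bl <= N := hess_bound_ge (a := chis) Lxi c0' u1 sp tr B_le B_co.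
pose k : R := 3 / (2 * c).
pose mu := Bl^-1 + 2 * k * (1 + Num.sqrt N / Num.sqrt Bl) + N * k ^+ 2.
have k0 : 0 < k by rewrite divr_gt0// mulr_gt0.
have N0 : 0 < N := lt_le_trans Bl0 BN.
have mu0 : 0 < mu.
  have p1 : 0 <= Num.sqrt N / Num.sqrt Bl by rewrite divr_ge0 ?sqrtr_ge0.
  have p2 : 0 <= 2 * k * (1 + Num.sqrt N / Num.sqrt Bl).
    exact: mulr_ge0 (mulr_ge0 (ler0n R 2) (ltW k0)) (addr_ge0 ler01 p1).
  have p3 : 0 <= N * k ^+ 2 by rewrite mulr_ge0 ?sqr_ge0// ltW.
  by rewrite /mu -addrA ltr_pwDl ?invr_gt0// addr_ge0.
have inv e rho : indY e -> 0 <= rho -> (forall d, indY d -> `|hess jt chis e d| <= rho * nY2 d) ->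
    nY2 e <= mu * rho.
  move=> Ye rho0 H.
  apply: (saddle_inverse (a := chis) Lxi c0' u1 sp tr Bsym BD Bl0 B_le B_ge0 B_co _ Ye rho0) => // d Yd.
  have := H d Yd; rewrite (hess_saddle KM r0 HC ra Ka erefl (indY_regular Ye) (indY_regular Yd)).
  by [].
have [R1 R10 HR] := newton_contraction K4 KM cK r0 C0 HC Ya Ka F0 mu0 inv.
pose M := Num.max (4 / Bl) (Num.max (k * (1 + 4 * N / Bl)) (N * k ^+ 2)).
have mM : mu <= 41 / 20 * M.
  by apply: inverse_constant_le => //; rewrite ?(ltW k0)// /M !le_max lexx ?orbT.
have M0 : 0 <= M by rewrite /M le_max divr_ge0// ltW.
(* The bound c / 2 keeps [kappaR] positive, and Ltil makes [hess_bound] at most [Bbar]. The radius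
   is fixed before Bhat, so it serves every admissible Bhat. *)
pose RC := Num.min R1 (Num.min (c / 2) Ltil).
have RC0 : 0 < RC by rewrite !lt_min R10 T0 divr_gt0.
have [RC1 [RCc RCT]] : RC <= R1 /\ RC <= c / 2 /\ RC <= Ltil by rewrite !ge_min !lexx !orbT.
have RCc' : RC < c by apply: (le_lt_trans RCc); rewrite ltr_pdivrMr// mulr_natr mulr2n ltrDr.
exists RC; split => //; split; last split.
- move=> Bhat ok om it [Yit st] Nit j.
  have [_ /(_ Bhat ok)[W0 h]] := HR RC RC0 RC1 _ _ (Yit j) (Yit j.+1) (Nit j) (st j).
  apply: (le_trans h); apply: (rate_le M0 W0 (nY2_ge0 _) mM).
  exact: (omega1_ge c00 cv c10 c20 T0 Bl0 RC0 RCc' RCT (ltW N0)).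
- move=> it [Yit st] Nit; apply: halving_cvg0 => j; first exact: nY2_ge0.
  by have [] := HR RC RC0 RC1 _ _ (Yit j) (Yit j.+1) (Nit j) (st j).
move=> b Yb Nb Fb; have [h _] := HR RC RC0 RC1 b b Yb Yb Nb (newton_step_fixed Fb).
have z : nY2 (csub b chis) = 0.
  by have := nY2_ge0 (csub b chis); move: h; move: (nY2 _) => y; lra.
by have [] := nY2_sub_eq0 Ya Yb z.
Qed.
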